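(* Let $2\le n\le5$ and let $A=(a_{ij})\in GL(n,\mathbb{R})$ be a matrix whose columns form a Korkine-Zolotarev reduced basis of the lattice $\Lambda_A=A\mathbb{Z}^n$, in the normalized form: $A$ is upper triangular, $a_{11}=|A_1|=1$ and $a_{ii}=|A_i^\perp|>0$ for $2\le i\le n$. Let $f:(T_A^n,g_0)\to\mathbb{R}^N$ be an isometric immersion. Then its Willmore energy satisfies $$\mathcal{W}(f)\ \ge\ (2\pi)^n\left(\prod_{i=1}^n a_{ii}\right)\left(\sum_{i=1}^n\frac{1}{a_{ii}^2}\right)^{n/2},$$ with equality holding if and only if $A$ is diagonal and $f$ is congruent to $$(x_1,\ldots,x_n)\mapsto\frac{1}{2\pi}\left(a_{11}\cos\frac{2\pi x_1}{a_{11}},\,a_{11}\sin\frac{2\pi x_1}{a_{11}},\,\ldots,\,a_{nn}\cos\frac{2\pi x_n}{a_{nn}},\,a_{nn}\sin\frac{2\pi x_n}{a_{nn}}\right).$$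
   Context: $T_A^n=\mathbb{R}^n/A\mathbb{Z}^n$ with $g_0=\mathrm{d}x_1^2+\cdots+\mathrm{d}x_n^2$ induced by the Euclidean metric, $x=(x_1,\dots,x_n)$ the standard coordinates of $\mathbb{R}^n$. Immersions are smooth. Let $A_1,\dots,A_n$ be the columns of $A$, and let $A_i^\perp$ be the orthogonal projection of $A_i$ onto $\mathrm{Span}\{A_1,\dots,A_{i-1}\}^\perp$ (so $A_1^\perp=A_1$). The basis $\{A_1,\ldots,A_n\}$ of $\Lambda_A$ is Korkine-Zolotarev reduced if and only if: (1) for all $1\le i<j\le n$, $|\langle A_j,A_i^\perp\rangle|\le\frac12\|A_i^\perp\|^2$; (2) $A_1$ is one of the shortest non-zero vectors of $\Lambda_A$; (3) for each $2\le i\le n$, $A_i^\perp$ is one of the shortest non-zero vectors in the orthogonal projection of $\Lambda_A$ onto $\mathrm{Span}\{A_1,\ldots,A_{i-1}\}^\perp$. For an immersion $f:M^n\to\mathbb{R}^N$ of a closed $n$-manifold, $\mathcal{W}(f)=\left(\frac{n}{n-1}\right)^{n/2}\int_{M^n}(S-n|H|^2)^{n/2}\,\mathrm{d}V$, where $\mathrm{d}V$ is the induced volume element, $S$ is the squared norm of the second fundamental form, and $H=\frac1n\operatorname{tr}(\text{second fundamental form})$ is the mean curvature vector in $\mathbb{R}^N$. ''Congruent'' means equal up to composition with an isometry of $\mathbb{R}^N$, where $\mathbb{R}^{2n}$ is regarded as a linear subspace of $\mathbb{R}^N$ (in particular $N\ge2n$ in the equality case). *)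

(* Defs.v *)
From HB Require Import structures.
From mathcomp Require Import all_boot all_order all_algebra.
From mathcomp Require Import generic_quotient ring_quotient.
From mathcomp Require Import all_classical all_reals all_analysis.

Set Implicit Arguments.
Unset Strict Implicit.
Unset Printing Implicit Defensive.

Import Order.TTheory GRing.Theory Num.Theory.
Import numFieldNormedType.Exports.

Local Open Scope classical_set_scope.
Local Open Scope ring_scope.
Local Open Scope quotient_scope.

(* The library norm on 'cV[R]_n is the max norm: it only serves for the
   topology and for differentiation, and the Euclidean norm is defined here. *)
Definition dot (R : realType) (n : nat) (u v : 'cV[R]_n) : R :=
  \sum_(i < n) u i 0 * v i 0.

Definition enorm (R : realType) (n : nat) (u : 'cV[R]_n) : R :=
  Num.sqrt (dot u u).

Definition lattice (R : realType) (n : nat) (A : 'M[R]_n) : {pred 'cV[R]_n} :=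
  fun x => `[< exists z : 'cV[int]_n, x = A *m map_mx intr z >].

Lemma lattice_zmod_closed (R : realType) (n : nat) (A : 'M[R]_n) :
  zmod_closed (lattice A).
Proof.
split=> [|x y /asboolP[u ->] /asboolP[v ->]]; apply/asboolP.
  by exists 0; rewrite map_mx0 mulmx0.
by exists (u - v); rewrite map_mxB mulmxBr.
Qed.

HB.instance Definition _ (R : realType) (n : nat) (A : 'M[R]_n) :=
  GRing.isZmodClosed.Build 'cV[R]_n (lattice A) (lattice_zmod_closed A).

Definition torus (R : realType) (n : nat) (A : 'M[R]_n) : Type :=
  {ideal_quot (lattice A)}.

(* Row k of this matrix is the column A_k of A if k < i, and 0 otherwise, so
   that its row space is Span{A_k | k < i}. *)
Definition span_before (R : realType) (n : nat) (A : 'M[R]_n) (i : 'I_n) :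
  'M[R]_n := \matrix_(k, l) (if (k < i)%N then A l k else 0).

(* Orthogonal projection onto Span{A_k | k < i}^\perp; the row space of
   kermx B^T is the orthogonal complement of the row space of B, and proj_mx
   projects onto its first argument along the second one. *)
Definition perp_proj (R : realType) (n : nat) (A : 'M[R]_n) (i : 'I_n)
    (v : 'cV[R]_n) : 'cV[R]_n :=
  let B := span_before A i in (v^T *m proj_mx (kermx B^T) B)^T.

Definition col_perp (R : realType) (n : nat) (A : 'M[R]_n) (i : 'I_n) :
  'cV[R]_n := perp_proj A i (col i A).

Definition shortest_nonzero (R : realType) (n : nat) (L : set 'cV[R]_n)
    (v : 'cV[R]_n) : Prop :=
  [/\ L v, v != 0 & forall w, L w -> w != 0 -> enorm v <= enorm w].

(* Indices start at 0. *)
Definition korkine_zolotarev (R : realType) (n : nat) (A : 'M[R]_n) : Prop :=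
  [/\ A \in unitmx,
      (forall i j : 'I_n, (i < j)%N ->
         `|dot (col j A) (col_perp A i)| <= 2^-1 * enorm (col_perp A i) ^+ 2),
      (forall i : 'I_n, i = 0%N :> nat ->
         shortest_nonzero [set` lattice A] (col i A)) &
      (forall i : 'I_n, (0 < i)%N ->
         shortest_nonzero (perp_proj A i @` [set` lattice A]) (col_perp A i))].

(* is_trig_mx means lower triangular. *)
Definition kz_normalized (R : realType) (n : nat) (A : 'M[R]_n) : Prop :=
  [/\ is_trig_mx A^T,
      (forall i : 'I_n, i = 0%N :> nat ->
         A i i = enorm (col i A) /\ enorm (col i A) = 1) &
      (forall i : 'I_n, (0 < i)%N ->
         A i i = enorm (col_perp A i) /\ 0 < enorm (col_perp A i))].

(* Maps on the torus are differentiated in the coordinates x_1, ..., x_n,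
   through their periodic lifts to R^n. *)
Definition periodic_lift (R : realType) (n N : nat) (A : 'M[R]_n)
    (f : torus A -> 'cV[R]_N) : 'cV[R]_n -> 'cV[R]_N :=
  fun x => f (\pi_({ideal_quot (lattice A)}) x).

Definition partial (R : realType) (n N : nat) (i : 'I_n)
    (F : 'cV[R]_n -> 'cV[R]_N) : 'cV[R]_n -> 'cV[R]_N :=
  fun x => 'D_(delta_mx i 0) F x.

(* C^infinity: all the iterated partial derivatives exist and are
   differentiable (hence continuous). *)
Definition smooth (R : realType) (n N : nat) (F : 'cV[R]_n -> 'cV[R]_N) :
    Prop :=
  forall (s : seq 'I_n) (x : 'cV[R]_n),
    differentiable (foldr (fun i G => partial i G) F s) x.

Definition immersion (R : realType) (n N : nat) (A : 'M[R]_n)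
    (f : torus A -> 'cV[R]_N) : Prop :=
  smooth (periodic_lift f) /\
  forall x : 'cV[R]_n,
    injective ('d (periodic_lift f) x : 'cV[R]_n -> 'cV[R]_N).

(* First fundamental form (g_ij). *)
Definition induced_metric (R : realType) (n N : nat)
    (F : 'cV[R]_n -> 'cV[R]_N) (x : 'cV[R]_n) : 'M[R]_n :=
  \matrix_(i, j) dot (partial i F x) (partial j F x).

(* In the coordinates x_1, ..., x_n, the metric g_0 is the identity matrix. *)
Definition isometric_immersion (R : realType) (n N : nat) (A : 'M[R]_n)
    (f : torus A -> 'cV[R]_N) : Prop :=
  immersion f /\
  forall x : 'cV[R]_n, induced_metric (periodic_lift f) x = 1%:M.

(* The normal component of the second partial derivative of F. *)
Definition second_form (R : realType) (n N : nat) (F : 'cV[R]_n -> 'cV[R]_N)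
    (x : 'cV[R]_n) (i j : 'I_n) : 'cV[R]_N :=
  let ginv := invmx (induced_metric F x) in
  let w := partial i (partial j F) x in
  w - \sum_(k < n) \sum_(l < n)
        (ginv k l * dot w (partial k F x)) *: partial l F x.

Definition second_form_sqnorm (R : realType) (n N : nat)
    (F : 'cV[R]_n -> 'cV[R]_N) (x : 'cV[R]_n) : R :=
  let ginv := invmx (induced_metric F x) in
  \sum_(i < n) \sum_(j < n) \sum_(k < n) \sum_(l < n)
     ginv i k * ginv j l * dot (second_form F x i j) (second_form F x k l).

Definition mean_curvature (R : realType) (n N : nat)
    (F : 'cV[R]_n -> 'cV[R]_N) (x : 'cV[R]_n) : 'cV[R]_N :=
  n%:R^-1 *: \sum_(i < n) \sum_(j < n)
     invmx (induced_metric F x) i j *: second_form F x i j.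

(* Integral over the cube [0, 1]^n, as an iterated integral; it is only used
   for continuous functions. *)
Fixpoint cube_integral (R : realType) (n : nat) : ('cV[R]_n -> R) -> R :=
  match n return ('cV[R]_n -> R) -> R with
  | 0%N => fun F => F 0
  | m.+1 => fun F => \int[lebesgue_measure]_(t in `[0, 1])
      cube_integral (fun y : 'cV[R]_m => F (col_mx t%:M y : 'cV[R]_(1 + m)))
  end.

(* Integral with respect to dx_1 ... dx_n of a periodic function over the
   torus, in the parametrization t |-> A t of the fundamental domain
   A [0, 1]^n, whose Jacobian is |det A|. *)
Definition torus_integral (R : realType) (n : nat) (A : 'M[R]_n)
    (phi : 'cV[R]_n -> R) : R :=
  `|\det A| * cube_integral (fun t : 'cV[R]_n => phi (A *m t)).

(* The induced volume element is sqrt (det (g_ij)) dx_1 ... dx_n. *)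
Definition willmore (R : realType) (n N : nat) (A : 'M[R]_n)
    (f : torus A -> 'cV[R]_N) : R :=
  let F := periodic_lift f in
  (n%:R / (n%:R - 1)) `^ (n%:R / 2) *
  torus_integral A (fun x =>
    (second_form_sqnorm F x - n%:R * enorm (mean_curvature F x) ^+ 2)
      `^ (n%:R / 2) * Num.sqrt (\det (induced_metric F x))).

(* (x_1, ..., x_n) |-> (2 pi)^-1 (a_11 cos (2 pi x_1 / a_11),
   a_11 sin (2 pi x_1 / a_11), ...); mxvec lists the entries row by row. *)
Definition flat_embedding (R : realType) (n : nat) (A : 'M[R]_n)
    (x : 'cV[R]_n) : 'cV[R]_(n * 2) :=
  (2 * pi)^-1 *: (mxvec (\matrix_(k < n, j < 2)
     (let theta := 2 * pi * x k 0 / A k k in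
      A k k * (if j == 0 then cos theta else sin theta))))^T.

(* The inclusion of R^m into R^N for m <= N. *)
Definition pad (R : realType) (m N : nat) (v : 'cV[R]_m) : 'cV[R]_N :=
  \col_(i < N) (if insub (val i) is Some j then v j 0 else 0).

Definition euclidean_isometry (R : realType) (N : nat)
    (Phi : 'cV[R]_N -> 'cV[R]_N) : Prop :=
  bijective Phi /\ forall u v, enorm (Phi u - Phi v) = enorm (u - v).

Definition congruent (R : realType) (n m N : nat) (F : 'cV[R]_n -> 'cV[R]_N)
    (G : 'cV[R]_n -> 'cV[R]_m) : Prop :=
  (m <= N)%N /\ exists Phi : 'cV[R]_N -> 'cV[R]_N,
    euclidean_isometry Phi /\ forall x, F x = Phi (pad N (G x)).

(* Main.v *)
From HB Require Import structures.
Require Import Defs.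
From mathcomp Require Import all_boot all_order all_algebra.
From mathcomp Require Import all_classical all_reals all_analysis.
From mathcomp Require Import ring lra zify.
Import Order.TTheory GRing.Theory Num.Theory.
Local Open Scope ring_scope.

(** For an isometric immersion [F] of a flat torus the Gauss equation reads
    [S = |Lap F|^2], so the Willmore energy is the integral of [|Lap F|^n], which
    the tangent line inequality for [y |-> y^(n/2)] bounds below in terms of the
    mean of [|Lap F|^2]. Since the mean of [|d_i F|^2] is [1], it suffices that the
    mean of [|Lap F|^2 - 4 pi^2 sum_i |d_i F|^2 / a_ii^2] is nonnegative; by
    Parseval this is a weighted sum over the dual lattice of
    [|xi|^4 - sum_i xi_i^2 / a_ii^2]. That number is nonnegative on the dual of a
    Korkine-Zolotarev reduced lattice of dimension at most 5, and vanishes only at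
    [0], [e_p / a_pp] and [- e_p / a_pp].

    In the equality case the Fourier support of [F] lies in these points: each
    [e_p / a_pp] must then belong to the dual lattice, which makes [A] diagonal, and
    [F] is a trigonometric polynomial of degree one whose coefficient vectors are
    orthogonal by the isometry condition.

    Parseval is obtained from Fejer kernels, using the integral over the torus only
    as a positive translation-invariant functional on continuous functions. *)

Set Implicit Arguments.
Unset Strict Implicit.
Unset Printing Implicit Defensive.
Import numFieldNormedType.Exports.
Local Open Scope classical_set_scope.
Local Open Scope ring_scope.

(** * Integration over the cube *)

(** The dimension enters through the dual lattice. Let p be the first index where the integer
    coordinates of a dual vector xi are nonzero; triangularity makes xi_p an integer divided by
    a_pp. When that integer is 1 or -1, the inequality is immediate if a_kk^2 >= a_pp^2 / 2 for all
    k > p. One step down the basis costs at most a factor 3/4 and two steps a factor 2/3, so three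
    steps cost at most 1/2, exactly what is allowed; iterating 3/4 alone would give 27/64, which is
    why a ternary bound is proved. Four steps occur only from the first to the fifth vector, where
    3/8 is too little and a lattice vector orthogonal to xi has to compensate.

    The tangent line is taken at 4 pi^2 sum_i 1 / a_ii^2, the constant value of |Lap F|^2 on the
    model embedding, so nothing is lost there.

    The deficit is a Cesaro limit of sums of nonnegative terms and therefore dominates each single
    term. This one fact yields both the inequality and, when the deficit vanishes, the disappearance
    of every Fourier coefficient off the zero set of the dual quantity. *)

Definition unif_cont (R : realType) (V W : normedModType R) (F : V -> W) :=
  forall e : R, 0 < e ->
    exists2 d : R, 0 < d & forall x y, `|x - y| < d -> `|F x - F y| < e.

Section UnifCont.
Context {R : realType}.

Lemma unif_cont_continuous (V W : normedModType R) (F : V -> W) :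
  unif_cont F -> continuous F.
Proof.
move=> uF x; apply/cvgrPdist_lt => e e0; have [d d0 dF] := uF e e0.
near=> y; apply: dF; near: y; exact: cvgr_dist_lt.
Unshelve. all: by end_near. Qed.

Lemma unif_contD (V W : normedModType R) (F G : V -> W) :
  unif_cont F -> unif_cont G -> unif_cont (fun x => F x + G x).
Proof.
move=> uF uG e e0; have e20 : 0 < e / 2 by rewrite divr_gt0.
have [d d0 dF] := uF _ e20; have [d' d'0 dG] := uG _ e20.
exists (Num.min d d'); first by rewrite lt_min d0.
move=> x y; rewrite lt_min => /andP[xy1 xy2].
rewrite opprD addrACA (le_lt_trans (ler_normD _ _))// (splitr e) ltrD //.
- exact: dF.
- exact: dG.
Qed.

Lemma unif_contZ (V W : normedModType R) (F : V -> W) (c : R) :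
  unif_cont F -> unif_cont (fun x => c *: F x).
Proof.
move=> uF e e0; have c0 : 0 < `|c| + 1 by rewrite ltr_pwDr.
have [d d0 dF] := uF _ (divr_gt0 e0 c0).
exists d => // x y /dF; rewrite ltr_pdivlMr // => h.
rewrite -scalerBr normrZ (le_lt_trans _ h) // mulrC ler_wpM2l // lerDl //.
Qed.

Lemma unif_cont_cst (V W : normedModType R) (c : W) :
  unif_cont (fun _ : V => c).
Proof. by move=> e e0; exists 1 => // x y _; rewrite subrr normr0. Qed.

Lemma integrable_01 (h : R -> R) : continuous h ->
  (@lebesgue_measure R).-integrable `[0, 1] (EFin \o h).
Proof.
move=> ch; apply: continuous_compact_integrable; first exact: segment_compact.
exact: continuous_subspaceT.
Qed.

Lemma Rintegral_01_cst (c : R) :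
  \int[lebesgue_measure]_(t in `[0, 1]) c = c :> R.
Proof.
rewrite Rintegral_cst //= lebesgue_measure_itv /= lte_fin ltr01 /= oppr0 addr0.
by rewrite mulr1.
Qed.

(** With [K] an antiderivative of [h], both sides are values of [x |-> K (x + 1) - K x], whose
    derivative [h (x + 1) - h x] vanishes. *)
Lemma Rintegral_periodic (h : R -> R) (a : R) : continuous h ->
  (forall t, h (t + 1) = h t) ->
  \int[lebesgue_measure]_(t in `[0, 1]) h (t + a) =
  \int[lebesgue_measure]_(t in `[0, 1]) h t :> R.
Proof.
(* The margin 2 keeps every point [t + b] with [0 <= t <= 1] and [|b| <= |a|] strictly between [- B]
   and [B], where [K] is differentiable. *)
move=> ch ph; pose B : R := `|a| + 2.
pose K (x : R) : R := \int[lebesgue_measure]_(t in `[- B, x]) h t.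
have B2 : 2 <= B by rewrite lerDr.
have Kd (x : R) : `|x| < B -> is_derive x (1 : R) K (h x).
  move=> xB.
  have [] := @continuous_FTC1_closed R h (- B) x B.
  - by case/ltr_normlP: xB.
  - apply: continuous_compact_integrable; first exact: segment_compact.
    exact: continuous_subspaceT.
  - by move: xB; rewrite ltr_norml => /andP[Bx _]; 
    exact: Bx.
  - exact: ch.
  - by rewrite derive1E => dK Kx; apply: DeriveDef.
have int_shift b : `|b| <= `|a| ->
  \int[lebesgue_measure]_(t in `[0, 1]) h (t + b) = K (1 + b) - K b.
  move=> ba.
  have bB t : 0 <= t -> t <= 1 -> `|t + b| < B.
    move=> t0 t1; apply: le_lt_trans (ler_normD _ _) _.
    rewrite (ger0_norm t0); apply: (@le_lt_trans _ _ (1 + `|a|)).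
      exact: lerD.
    by rewrite /B addrC ltrD2l ltr1n.
  have D (t : R) : 0 <= t -> t <= 1 -> is_derive t (1 : R) (K \o shift b) (h (t + b)).
    move=> t0 t1; have dK := Kd _ (bB t t0 t1).
    have ds := is_derive_shift t 1 b.
    have := @is_derive1_comp R K (shift b) t _ _ dK ds.
    by rewrite mulr1.
  rewrite /Rintegral (@continuous_FTC2 R _ (K \o shift b) 0 1) //=.
  - by rewrite add0r.
  - apply: continuous_subspaceT => t.
    apply: continuous_comp; last exact: ch.
    by apply: cvgD; [exact: cvg_id|exact: cvg_cst].
  - have cK t : 0 <= t -> t <= 1 -> {for t, continuous (K \o shift b)}.
      move=> t0 t1; have [dK _] := D t t0 t1.
      by apply/differentiable_continuous/derivable1_diffP.
    split.
    + by move=> t /[!in_itv]/= /andP[/ltW t0 /ltW t1]; case: (D t t0 t1).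
    + by apply: cvg_at_right_filter; exact: cK.
    + by apply: cvg_at_left_filter; exact: cK.
  - move=> t /[!in_itv]/= /andP[/ltW t0 /ltW t1].
    by rewrite derive1E; have [_ ->] := D t t0 t1.
rewrite int_shift // [in RHS](_ : h = fun t => h (t + 0)); last first.
  by apply/funext => t; rewrite addr0.
rewrite int_shift ?normr0 // addr0.
pose D (x : R) := K (x + 1) - K x.
have dD (x : R) : `|x| <= `|a| -> is_derive x (1 : R) D 0.
  move=> xa; have x1B : `|x + 1| < B.
    rewrite (le_lt_trans (ler_normD _ _)) // normr1.
    by rewrite (le_lt_trans (lerD xa (lexx 1))) // ltrD2l ltr1n.
  have dK := Kd _ x1B; have ds := is_derive_shift x 1 1.
  have dK1 := @is_derive1_comp R K (shift 1) x _ _ dK ds.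
  have dK2 : is_derive x (1 : R) K (h x).
    by apply: Kd; rewrite (le_lt_trans xa) // ltrDl.
  by have := is_deriveB dK1 dK2; rewrite mulr1 ph subrr.
have abs1 x : x \in `[Num.min 0 a, Num.max 0 a] -> `|x| <= `|a|.
  rewrite in_itv /= /Num.min /Num.max; case: (ltP 0 a) => a0 /andP[x0 x1].
    by rewrite !ger0_norm // ltW.
  by rewrite !ler0_norm // lerN2.
have [] := @MVT_segment R D (fun=> 0) (Num.min 0 a) (Num.max 0 a).
- by rewrite ge_min le_max lexx.
- by move=> x xa; apply/dD/abs1; apply: subset_itv_oo_cc xa.
- apply: derivable_within_continuous => x xa.
  by case: (dD x (abs1 x xa)).
- move=> c _; rewrite mul0r => /eqP; rewrite subr_eq0 => /eqP DD.
  have : D a = D 0 by move: DD; rewrite /Num.min /Num.max; case: (ltP 0 a).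
  by rewrite /D add0r (addrC a 1).
Qed.
End UnifCont.

Section CubeIntegral.
Context {R : realType}.

Lemma ball_col_mx (m : nat) (s t : R) (y z : 'cV[R]_m) (d : R) : 0 < d ->
  `|s - t| < d -> `|y - z| < d ->
  `|(col_mx s%:M y : 'cV[R]_(1 + m)) - col_mx t%:M z| < d.
Proof.
move=> d0 std yzd; rewrite opp_col_mx add_col_mx.
rewrite [ltLHS]mx_normrE; apply/bigmax_ltP; split=> [|[i j] _] /=; first exact: d0.
rewrite mxE; case: (fintype.split i) => k; rewrite !mxE.
  by rewrite !ord1 /= mulr1n.
apply: le_lt_trans yzd; rewrite [leRHS]mx_normrE.
by apply: le_trans (le_bigmax _ _ (k, j)); rewrite !mxE.
Qed.

Definition slice (m : nat) (F : 'cV[R]_m.+1 -> R) (t : R) : 'cV[R]_m -> R :=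
  fun y => F (col_mx t%:M y : 'cV[R]_(1 + m)).

Lemma unif_cont_slice m (F : 'cV[R]_m.+1 -> R) t :
  unif_cont F -> unif_cont (slice F t).
Proof.
move=> uF e e0; have [d d0 dF] := uF e e0; exists d => // y z yz.
by apply: dF; apply: ball_col_mx => //; rewrite subrr normr0.
Qed.

(** The clauses need one another in a single induction: linearity and monotonicity in dimension
    [m + 1] rest on integrability of the slice integrals, supplied by the last clause in dimension
    [m], and the last clause in dimension [m + 1] follows from them. Uniform continuity is carried
    instead of continuity because a modulus for [F] serves all its slices at once. *)
Lemma cube_integralP m : [/\
  (forall F G : 'cV[R]_m -> R, unif_cont F -> unif_cont G ->
    cube_integral (fun x => F x + G x) = cube_integral F + cube_integral G),
  (forall (F : 'cV[R]_m -> R) c, unif_cont F ->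
    cube_integral (fun x => c * F x) = c * cube_integral F),
  (forall c, cube_integral (fun _ : 'cV[R]_m => c) = c),
  (forall F G : 'cV[R]_m -> R, unif_cont F -> unif_cont G ->
    (forall x, F x <= G x) -> cube_integral F <= cube_integral G) &
  (forall F : 'cV[R]_m.+1 -> R, unif_cont F ->
    unif_cont (fun t : R => cube_integral (slice F t)))].
Proof.
elim: m => [|m [ID IZ Ic Im Iu]].
  split=> //= F uF e e0; have [d d0 dF] := uF e e0.
  exists d => // s t st; apply: dF; apply: ball_col_mx => //.
  by rewrite subrr normr0.
have J (F : 'cV[R]_m.+1 -> R) : unif_cont F ->
    lebesgue_measure.-integrable `[0, 1]
      (EFin \o (fun t : R => cube_integral (slice F t))).
  by move=> /Iu /unif_cont_continuous; exact: integrable_01.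
have D (F G : 'cV[R]_m.+1 -> R) : unif_cont F -> unif_cont G ->
    cube_integral (fun x => F x + G x) = cube_integral F + cube_integral G.
  move=> uF uG /=; rewrite -RintegralD //; [|exact: J|exact: J].
  apply: eq_Rintegral => t _; rewrite -ID //; exact: unif_cont_slice.
have Z (F : 'cV[R]_m.+1 -> R) c : unif_cont F ->
    cube_integral (fun x => c * F x) = c * cube_integral F.
  move=> uF /=; rewrite -RintegralZl //; last exact: J.
  apply: eq_Rintegral => t _; rewrite -IZ //; exact: unif_cont_slice.
have C c : cube_integral (fun _ : 'cV[R]_m.+1 => c) = c.
  by rewrite /= Ic Rintegral_01_cst.
have M (F G : 'cV[R]_m.+1 -> R) : unif_cont F -> unif_cont G ->
    (forall x, F x <= G x) -> cube_integral F <= cube_integral G.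
  move=> uF uG FG /=; apply: le_Rintegral => //; [exact: J|exact: J|].
  by move=> t _; apply: Im => //; exact: unif_cont_slice.
split=> // F uF e e0.
have e20 : 0 < e / 2 by rewrite divr_gt0.
have [d d0 dF] := uF _ e20; exists d => // s t st.
apply: (@le_lt_trans _ _ (e / 2)); last first.
  by rewrite ltr_pdivrMr // ltr_pMr // ltr1n.
have us := unif_cont_slice s uF; have ut := unif_cont_slice t uF.
have usub : unif_cont (fun x => slice F s x + (-1) * slice F t x).
  by apply: unif_contD => //; exact: unif_contZ.
have uN : unif_cont (fun x => (-1) * slice F t x) by exact: unif_contZ.
have -> : cube_integral (slice F s) - cube_integral (slice F t) =
    cube_integral (fun x => slice F s x + (-1) * slice F t x).
  by rewrite D // Z // mulN1r.
have b x : `|slice F s x + (-1) * slice F t x| <= e / 2.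
  rewrite mulN1r ltW //; apply: dF; apply: ball_col_mx => //.
  by rewrite subrr normr0.
rewrite ler_norml -{1}(C (- (e / 2))) -{2}(C (e / 2)).
apply/andP; split; apply: M => //; do ?exact: unif_cont_cst.
- by move=> x; have := b x; rewrite ler_norml => /andP[].
- by move=> x; have := b x; rewrite ler_norml => /andP[].
Qed.

Lemma slice_periodic m (F : 'cV[R]_m.+1 -> R) (k : int) (z : 'cV[int]_m)
    (t : R) (y : 'cV[R]_m) :
  (forall x (z : 'cV[int]_m.+1), F (x + map_mx intr z) = F x) ->
  slice F (t + k%:~R) (y + map_mx intr z) = slice F t y.
Proof.
move=> pF; rewrite /slice -[RHS](pF _ (col_mx k%:M z : 'cV[int]_(1 + m))).
congr (F _); apply/colP => i; rewrite !mxE.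
by case: (@fintype.split 1 m i) => j; rewrite !mxE // ord1 !mulr1n.
Qed.

(** One coordinate at a time: the induction hypothesis translates the slices, and
    [Rintegral_periodic] the remaining variable, in which the slice integral has period 1. *)
Lemma cube_integral_shift m (F : 'cV[R]_m -> R) (v : 'cV[R]_m) :
  unif_cont F ->
  (forall x (z : 'cV[int]_m), F (x + map_mx intr z) = F x) ->
  cube_integral (fun x => F (x + v)) = cube_integral F.
Proof.
elim: m F v => [|m IH] F v uF pF; first by rewrite /= add0r flatmx0.
have [_ _ _ _ Iu] := cube_integralP m.
pose h (t : R) := cube_integral (slice F t).
transitivity (\int[lebesgue_measure]_(t in `[0, 1]) h (t + v 0 0)).
  apply: eq_Rintegral => t _.
  rewrite /h -(IH (slice F (t + v 0 0)) (dsubmx (v : 'cV[R]_(1 + m)))); last 2 first.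
  - exact: unif_cont_slice.
  - by move=> x z; have := slice_periodic 0 z (t + v 0 0) x pF; rewrite addr0.
  congr (cube_integral _); apply/funext => y; rewrite /slice; congr (F _).
  apply/colP => i; rewrite !mxE; case: (@splitP 1 m i) => j ij.
    rewrite !mxE ord1 !mulr1n; congr (_ + v _ _); apply/val_inj.
    by rewrite /= ij ord1.
  by rewrite !mxE; congr (_ + v _ _); exact/val_inj.
apply: Rintegral_periodic; first exact: (unif_cont_continuous (Iu F uF)).
move=> t; congr (cube_integral _); apply/funext => y.
by have := slice_periodic 1 0 t y pF; rewrite map_mx0 addr0.
Qed.

End CubeIntegral.

(** * The invariant mean on the torus *)

Section TorusMean.
Context {R : realType} {n : nat} (A : 'M[R]_n).
Hypothesis Au : A \in unitmx.

Lemma mx_norm_entry m p (x : 'M[R]_(m, p)) i j : `|x i j| <= `|x|.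
Proof.
rewrite [leRHS]mx_normrE; exact: (le_bigmax 0 (fun ij => `|x ij.1 ij.2|) (i, j)).
Qed.

Lemma mx_norm_le m p (x : 'M[R]_(m, p)) (c : R) : 0 <= c ->
  (forall i j, `|x i j| <= c) -> `|x| <= c.
Proof.
by move=> c0 xc; rewrite [leLHS]mx_normrE; apply: bigmax_le => // -[i j] _ /=.
Qed.

Lemma mx_norm_trmx m p (x : 'M[R]_(m, p)) : `|x^T| = `|x|.
Proof.
apply/eqP; rewrite eq_le; apply/andP; split; apply: mx_norm_le => // i j.
  by rewrite mxE mx_norm_entry.
by rewrite -[x]trmxK mxE trmxK mx_norm_entry.
Qed.

Lemma unif_cont_mulmx m p q (B : 'M[R]_(m, p)) :
  unif_cont (fun x : 'M[R]_(p, q) => B *m x).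
Proof.
move=> e e0; pose c : R := p%:R * `|B| + 1.
have c0 : 0 < c by rewrite ltr_wpDl // mulr_ge0.
exists (e / c); first by rewrite divr_gt0.
move=> x y xy; rewrite -mulmxBr.
apply: le_lt_trans (_ : `|x - y| * (p%:R * `|B|) < e).
  apply: mx_norm_le; first by rewrite !mulr_ge0.
  move=> i j; rewrite mxE (le_trans (ler_norm_sum _ _ _)) //.
  rewrite mulrCA mulr_natl -[X in _ *+ X](card_ord p) -sumr_const.
  by apply: ler_sum => k _; rewrite normrM mulrC ler_pM // mx_norm_entry.
rewrite ltr_pdivlMr // in xy; apply: le_lt_trans xy.
by rewrite ler_wpM2l // lerDl.
Qed.

Lemma continuous_mulmx m p q (B : 'M[R]_(m, p)) :
  continuous (fun x : 'M[R]_(p, q) => B *m x).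
Proof. exact/unif_cont_continuous/unif_cont_mulmx. Qed.

Lemma continuous_trmx m p : continuous (fun x : 'M[R]_(m, p) => x^T).
Proof.
apply: unif_cont_continuous => e e0; exists e => // x y.
by rewrite -linearB /= mx_norm_trmx.
Qed.

Definition torus_periodic (W : Type) (phi : 'cV[R]_n -> W) :=
  forall x (z : 'cV[int]_n), phi (x + A *m map_mx intr z) = phi x.

Definition torus_cont (phi : 'cV[R]_n -> R) :=
  continuous phi /\ torus_periodic phi.

Lemma reduce_mod_lattice (x : 'cV[R]_n) :
  exists (z : 'cV[int]_n) (y : 'cV[R]_n),
    x + A *m map_mx intr z = A *m y /\ forall i, 0 <= y i 0 <= 1.
Proof.
pose u := invmx A *m x; pose z : 'cV[int]_n := \col_i - Num.floor (u i 0).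
exists z, (u + map_mx intr z); split.
  by rewrite mulmxDr mulKVmx.
move=> i; rewrite !mxE rmorphN /= subr_ge0 ge_floor /=.
rewrite lerBlDr addrC ltW // (lt_le_trans (floorD1_gt _)) //.
by rewrite intrD.
Qed.

(** Row vectors are used so that [rV_compact] gives compactness of the cube. *)
Definition fundamental_domain : set 'cV[R]_n := (fun v : 'rV[R]_n => A *m v^T) @`
  [set v : 'rV[R]_n | forall i, `[0, 1]%classic (v ord0 i)].

Lemma fundamental_domainP (y : 'cV[R]_n) :
  (forall i, 0 <= y i 0 <= 1) -> fundamental_domain (A *m y).
Proof.
by move=> yP; exists y^T; rewrite ?trmxK // => i /=; rewrite in_itv /= mxE yP.
Qed.

Lemma compact_fundamental_domain : compact fundamental_domain.
Proof.
apply: continuous_compact; last first.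
  apply: (@rV_compact R n (fun=> `[0, 1]%classic)) => i.
  exact: segment_compact.
apply: continuous_subspaceT => v.
by apply: continuous_comp; [exact: continuous_trmx|exact: continuous_mulmx].
Qed.

(** Compactness provides a modulus for [x] in the fundamental domain and arbitrary [y]; periodicity
    moves any pair by one common lattice vector until [x] lies there. *)
Lemma torus_unif_cont (phi : 'cV[R]_n -> R) : torus_cont phi -> unif_cont phi.
Proof.
move=> [cphi pphi] e e0.
have /compact_near_coveringP/(_ R 0^'+
   (fun d x => forall y, `|x - y| < d -> `|phi x - phi y| < e) _) :=
  compact_fundamental_domain.
case.
  move=> x Kx.
  have e20 : 0 < e / 2 by rewrite divr_gt0.
  have /cvgrPdist_lt/(_ _ e20) /nbhs_ballP [d /= d0 dphi] := cphi x.
  have d20 : 0 < d / 2 by rewrite divr_gt0.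
  exists (ball x (d / 2), [set r | r < d / 2]) => /=.
    split; first exact: nbhsx_ballx.
    exact: nbhs_right_lt.
  move=> [x' r] /= [xx' rd] y x'y.
  have ld2 : d / 2 < d by rewrite ltr_pdivrMr // ltr_pMr // ltr1n.
  have h1 : `|phi x - phi x'| < e / 2.
    by apply: dphi; apply: le_ball xx'; exact: ltW.
  have h2 : `|phi x - phi y| < e / 2.
    apply: dphi; rewrite -ball_normE /ball_ /= -(subrKA x').
    rewrite (splitr d) (le_lt_trans (ler_normD _ _)) // ltrD //.
      by move: xx'; rewrite -ball_normE.
    exact: lt_trans x'y rd.
  rewrite -(subrKA (phi x)) (splitr e) (le_lt_trans (ler_normD _ _)) //.
  by rewrite ltrD // distrC.
move=> d /= d0 /(_ (d / 2)) H.
exists (d / 2); first by rewrite divr_gt0.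
move=> x y xy; have [z [t [xz tP]]] := reduce_mod_lattice x.
rewrite -(pphi x z) -(pphi y z); apply: H.
- rewrite /= sub0r normrN gtr0_norm ?divr_gt0 //.
  by rewrite ltr_pdivrMr // ltr_pMr // ltr1n.
- by rewrite divr_gt0.
- by rewrite xz; exact: fundamental_domainP.
- by rewrite opprD addrACA subrr addr0.
Qed.

Lemma torus_bounded (phi : 'cV[R]_n -> R) : torus_cont phi ->
  exists2 B, 0 < B & forall x, `|phi x| <= B.
Proof.
move=> [cphi pphi].
have /compact_bounded [M [_ MP]] : compact (phi @` fundamental_domain).
  apply: continuous_compact; last exact: compact_fundamental_domain.
  exact: continuous_subspaceT.
have M0 : 0 < `|M| + 1 by rewrite ltr_wpDl.
exists (`|M| + 1) => // x; have [z [t [xz tP]]] := reduce_mod_lattice x.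
apply: MP; first by rewrite (le_lt_trans (ler_norm M)) // ltrDl.
by exists (A *m t); [exact: fundamental_domainP|rewrite -xz pphi].
Qed.

Lemma torus_cst c : torus_cont (fun=> c).
Proof. by split=> [|//]; exact: cst_continuous. Qed.

Lemma torusD f g : torus_cont f -> torus_cont g -> torus_cont (fun x => f x + g x).
Proof.
move=> [cf pf] [cg pg]; split=> [x|x z]; last by rewrite pf pg.
exact: (cvgD (cf x) (cg x)).
Qed.

Lemma torusM f g : torus_cont f -> torus_cont g -> torus_cont (fun x => f x * g x).
Proof.
move=> [cf pf] [cg pg]; split=> [x|x z]; last by rewrite pf pg.
exact: (cvgM (cf x) (cg x)).
Qed.

Lemma torus_comp (h : R -> R) f : continuous h -> torus_cont f ->
  torus_cont (fun x => h (f x)).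
Proof.
move=> ch [cf pf]; split=> [x|x z]; last by rewrite pf.
by apply: continuous_comp; [exact: cf|exact: ch].
Qed.

Lemma torusN f : torus_cont f -> torus_cont (fun x => - f x).
Proof.
move=> [cf pf]; split=> [x|x z]; last by rewrite pf.
exact: (cvgN (cf x)).
Qed.

Lemma torusB f g : torus_cont f -> torus_cont g -> torus_cont (fun x => f x - g x).
Proof. by move=> tf tg; apply: torusD => //; exact: torusN. Qed.

Lemma torusZ c f : torus_cont f -> torus_cont (fun x => c * f x).
Proof. by move=> tf; apply: torusM => //; exact: torus_cst. Qed.

Lemma torus_sum (I : Type) (r : seq I) (P : pred I) (f : I -> 'cV[R]_n -> R) :
  (forall i, P i -> torus_cont (f i)) ->
  torus_cont (fun x => \sum_(i <- r | P i) f i x).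
Proof.
move=> tf; elim: r => [|i r IH].
  by under eq_fun do rewrite big_nil; exact: torus_cst.
case Pi : (P i); last by under eq_fun do rewrite big_cons Pi.
under eq_fun do rewrite big_cons Pi.
by apply: torusD => //; exact: tf.
Qed.

Lemma torus_shift f v : torus_cont f -> torus_cont (fun x => f (x + v)).
Proof.
move=> [cf pf]; split=> [x|x z]; last by rewrite addrAC pf.
have cs : {for x, continuous (fun y : 'cV[R]_n => y + v)}.
  exact: (cvgD cvg_id (cvg_cst v)).
exact: (continuous_comp cs (cf (x + v))).
Qed.

Lemma torus_opp f v : torus_cont f -> torus_cont (fun x => f (v - x)).
Proof.
move=> [cf pf]; split=> [x|x z]; last first.
  have -> : v - (x + A *m map_mx intr z) = v - x + A *m map_mx intr (- z).
    by rewrite map_mxN mulmxN opprD addrA.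
  exact: pf.
have cs : continuous (fun y : 'cV[R]_n => v - y).
  apply: unif_cont_continuous => e e0; exists e => // a b.
  have -> : v - a - (v - b) = b - a by rewrite opprB addrC addrA subrK.
  by rewrite distrC.
exact: (continuous_comp (cs x) (cf (v - x))).
Qed.

(** Lattice coordinates without the Jacobian: the average over the torus rather than the
    integral. *)
Definition mean (phi : 'cV[R]_n -> R) : R :=
  cube_integral (fun t => phi (A *m t)).

Lemma unif_cont_coord phi : torus_cont phi ->
  unif_cont (fun t : 'cV[R]_n => phi (A *m t)).
Proof.
move=> /torus_unif_cont uphi e e0; have [d d0 dphi] := uphi e e0.
have [d' d'0 dA] := @unif_cont_mulmx _ _ 1 A d d0.
by exists d' => // x y /dA /dphi.
Qed.

Lemma meanD f g : torus_cont f -> torus_cont g ->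
  mean (fun x => f x + g x) = mean f + mean g.
Proof.
by have [D _ _ _ _] := @cube_integralP R n => tf tg; apply: D;
  exact: unif_cont_coord.
Qed.

Lemma meanZ c f : torus_cont f -> mean (fun x => c * f x) = c * mean f.
Proof.
by have [_ Z _ _ _] := @cube_integralP R n => tf; apply: Z; exact: unif_cont_coord.
Qed.

Lemma mean_cst c : mean (fun=> c) = c.
Proof. by have [_ _ C _ _] := @cube_integralP R n; exact: C. Qed.

Lemma mean_le f g : torus_cont f -> torus_cont g ->
  (forall x, f x <= g x) -> mean f <= mean g.
Proof.
by have [_ _ _ M _] := @cube_integralP R n => tf tg fg; apply: M => // ;
  exact: unif_cont_coord.
Qed.

Lemma meanN f : torus_cont f -> mean (fun x => - f x) = - mean f.
Proof.
move=> tf; rewrite -mulN1r -meanZ //; congr mean; apply/funext => x.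
by rewrite mulN1r.
Qed.

Lemma meanB f g : torus_cont f -> torus_cont g ->
  mean (fun x => f x - g x) = mean f - mean g.
Proof. by move=> tf tg; rewrite meanD ?meanN //; exact: torusN. Qed.

Lemma mean_sum (I : Type) (r : seq I) (P : pred I) (f : I -> 'cV[R]_n -> R) :
  (forall i, P i -> torus_cont (f i)) ->
  mean (fun x => \sum_(i <- r | P i) f i x) = \sum_(i <- r | P i) mean (f i).
Proof.
move=> tf; elim: r => [|i r IH].
  by rewrite big_nil -[RHS]mean_cst; congr mean; apply/funext => x; rewrite big_nil.
rewrite big_cons -IH; case: ifP => Pi.
  rewrite -meanD; [|exact: tf|exact: torus_sum].
  by congr mean; apply/funext => x; rewrite big_cons Pi.
by congr mean; apply/funext => x; rewrite big_cons Pi.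
Qed.

Lemma mean_shift f v : torus_cont f -> mean (fun x => f (x + v)) = mean f.
Proof.
move=> tf; have [cf pf] := tf.
rewrite -[RHS](cube_integral_shift (invmx A *m v)); last 2 first.
- exact: unif_cont_coord.
- by move=> x z; rewrite mulmxDr pf.
by congr cube_integral; apply/funext => x; rewrite mulmxDr mulKVmx.
Qed.

Lemma mean_norm_le f (c : R) : torus_cont f -> (forall x, `|f x| <= c) ->
  `|mean f| <= c.
Proof.
move=> tf fc; rewrite ler_norml -(mean_cst (- c)) -{2}(mean_cst c).
apply/andP; split; apply: mean_le => //; do ?exact: torus_cst.
- by move=> x; have := fc x; rewrite ler_norml => /andP[].
- by move=> x; have := fc x; rewrite ler_norml => /andP[].
Qed.

End TorusMean.

(** * Characters of the torus *)

Section Trig.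
Context {R : realType}.

Lemma sin_cosD2pi_nat (x : R) (k : nat) :
  cos (x + 2 * pi * k%:R) = cos x /\ sin (x + 2 * pi * k%:R) = sin x.
Proof.
elim: k => [|k [IHc IHs]]; first by rewrite mulr0 addr0.
have -> : x + 2 * pi * k.+1%:R = x + 2 * pi * k%:R + pi *+ 2.
  by rewrite -(addn1 k) natrD; ring.
by rewrite cosD2pi sinD2pi.
Qed.

Lemma sin_cosD2pi_int (x : R) (k : int) :
  cos (x + 2 * pi * k%:~R) = cos x /\ sin (x + 2 * pi * k%:~R) = sin x.
Proof.
case: k => k; first exact: sin_cosD2pi_nat.
rewrite NegzE rmorphN /= mulrN.
have [] := sin_cosD2pi_nat (x - 2 * pi * k.+1%:R) k.+1.
by rewrite subrK => -> ->.
Qed.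

(** Serves to recognise lattice points: when the cosines attached to the dual basis are all close to
    1, the lattice coordinates are all close to integers. The threshold [1 - cos (2 pi d)] comes
    from monotonicity of the cosine on [[0, pi]]. *)
Lemma near_int_of_cos (d : R) : 0 < d -> d <= 2^-1 ->
  exists2 c : R, 0 < c & forall s : R, 1 - cos (2 * pi * s) < c ->
    exists k : int, `|s - k%:~R| < d.
Proof.
move=> d0 d1; exists (1 - cos (2 * pi * d)).
  rewrite subr_gt0 -[ltRHS]cos0 ltr_cos ?in_itv /= ?lexx ?pi_ge0 //.
    by rewrite !mulr_gt0 ?pi_gt0.
  rewrite !mulr_ge0 ?pi_ge0 ?(ltW d0) //=.
  by have := pi_gt0 R; nra.
move=> s; rewrite ltrD2l ltrN2 => sc.
pose k := Num.floor (s + 2^-1); exists k.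
have k1 : k%:~R <= s + 2^-1 by exact: ge_floor.
have k2 : s + 2^-1 < k%:~R + 1.
  by rewrite (lt_le_trans (floorD1_gt _)) // intrD.
have sk : `|s - k%:~R| <= 2^-1 by rewrite ler_norml; apply/andP; split; lra.
rewrite ltNge; apply/negP => dk; move: sc; apply/negP; rewrite -leNgt.
have -> : cos (2 * pi * s) = cos (2 * pi * `|s - k%:~R|).
  have -> : 2 * pi * `|s - k%:~R| = `|2 * pi * (s - k%:~R)|.
    by rewrite normrM ger0_norm // mulr_ge0 // pi_ge0.
  rewrite cos_norm.
  have [<- _] := sin_cosD2pi_int (2 * pi * (s - k%:~R)) k.
  by rewrite -mulrDr subrK.
rewrite leNgt ltr_cos ?in_itv /= -?leNgt.
- by rewrite ler_pM2l // mulr_gt0 // pi_gt0.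
- rewrite !mulr_ge0 ?pi_ge0 //=.
  by have := pi_gt0 R; nra.
- rewrite !mulr_ge0 ?pi_ge0 ?(ltW d0) //=.
  by have := pi_gt0 R; nra.
Qed.

End Trig.

Section Characters.
Context {R : realType} {n : nat} (A : 'M[R]_n).
Hypothesis Au : A \in unitmx.
Implicit Types m : 'cV[int]_n.

Lemma dotC (u v : 'cV[R]_n) : dot u v = dot v u.
Proof. by apply: eq_bigr => i _; rewrite mulrC. Qed.

Lemma dotDr (u v w : 'cV[R]_n) : dot u (v + w) = dot u v + dot u w.
Proof. by rewrite /dot -big_split; apply: eq_bigr => i _; rewrite mxE mulrDr. Qed.

Lemma dotZr c (u v : 'cV[R]_n) : dot u (c *: v) = c * dot u v.
Proof. by rewrite /dot mulr_sumr; apply: eq_bigr => i _; rewrite mxE mulrCA. Qed.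

Lemma dotDl (u v w : 'cV[R]_n) : dot (u + v) w = dot u w + dot v w.
Proof. by rewrite dotC dotDr !(dotC w). Qed.

Lemma dotZl c (u v : 'cV[R]_n) : dot (c *: u) v = c * dot u v.
Proof. by rewrite dotC dotZr dotC. Qed.

Lemma dotNr (u v : 'cV[R]_n) : dot u (- v) = - dot u v.
Proof. by rewrite -scaleN1r dotZr mulN1r. Qed.

Lemma dotNl (u v : 'cV[R]_n) : dot (- u) v = - dot u v.
Proof. by rewrite dotC dotNr dotC. Qed.

Lemma dot_ge0 (u : 'cV[R]_n) : 0 <= dot u u.
Proof. by apply: sumr_ge0 => i _; rewrite -expr2 sqr_ge0. Qed.

Lemma dot_eq0 (u : 'cV[R]_n) : (dot u u == 0) = (u == 0).
Proof.
apply/eqP/eqP => [|->]; last by rewrite /dot big1 // => i _; rewrite mxE mul0r.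
move=> /eqP; rewrite psumr_eq0 => [/allP u0|i _]; last by rewrite -expr2 sqr_ge0.
apply/colP => i; rewrite mxE; apply/eqP.
by have := u0 i (mem_index_enum _); rewrite -expr2 sqrf_eq0.
Qed.

Lemma dot_mulmx p (B : 'M[R]_(n, p)) u v : dot (B^T *m u) v = dot u (B *m v).
Proof.
transitivity ((u^T *m B *m v) 0 0); last first.
  by rewrite -mulmxA mxE; apply: eq_bigr => i _; rewrite mxE.
by rewrite mxE; apply: eq_bigr => i _; rewrite -[B^T *m u]trmxK trmx_mul trmxK mxE.
Qed.

(** The dual lattice vector with integer coordinates [m] in the basis dual to the columns of [A]. *)
Definition freq m : 'cV[R]_n := invmx A^T *m map_mx intr m.

Lemma freqP m : A^T *m freq m = map_mx intr m.
Proof. by rewrite mulKVmx // unitmx_tr. Qed.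

Lemma freqD m m' : freq (m + m') = freq m + freq m'.
Proof. by rewrite /freq map_mxD mulmxDr. Qed.

Lemma freqN m : freq (- m) = - freq m.
Proof. by rewrite /freq map_mxN mulmxN. Qed.

Lemma freq_eq0 m : (freq m == 0) = (m == 0).
Proof.
apply/eqP/eqP => [fm|->]; last by rewrite /freq map_mx0 mulmx0.
have := freqP m; rewrite fm mulmx0 => /esym m0; apply/colP => i.
have /colP/(_ i)/eqP := m0; rewrite !mxE intr_eq0 => /eqP ->; by [].
Qed.

Definition cosf m (x : 'cV[R]_n) : R := cos (2 * pi * dot (freq m) x).
Definition sinf m (x : 'cV[R]_n) : R := sin (2 * pi * dot (freq m) x).

Lemma continuous_dot (u : 'cV[R]_n) : continuous (dot u).
Proof.
apply: unif_cont_continuous => e e0.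
have [d d0 du] := @unif_cont_mulmx R 1 n 1 u^T e e0.
exists d => // x y /du; apply: le_lt_trans.
have := mx_norm_entry (u^T *m x - u^T *m y) 0 0; rewrite !mxE.
by under eq_bigr do rewrite mxE; under [X in _ - X]eq_bigr do rewrite mxE.
Qed.

Lemma continuous_phase (u : 'cV[R]_n) :
  continuous (fun x => 2 * pi * dot u x).
Proof.
move=> x; exact: (cvgM (cvg_cst (2 * pi)) (@continuous_dot u x)).
Qed.

Lemma dot_freq_lattice m (z : 'cV[int]_n) :
  dot (freq m) (A *m map_mx intr z) = (\sum_i m i 0 * z i 0)%:~R.
Proof.
rewrite -dot_mulmx freqP rmorph_sum; apply: eq_bigr => i _.
by rewrite !mxE rmorphM.
Qed.

Lemma torus_cosf m : torus_cont A (cosf m).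
Proof.
split=> [x|x z].
  exact: (continuous_comp (@continuous_phase (freq m) x) (@continuous_cos R _)).
rewrite /cosf dotDr dot_freq_lattice mulrDr.
by have [] := sin_cosD2pi_int (2 * pi * dot (freq m) x) (\sum_i m i 0 * z i 0).
Qed.

Lemma torus_sinf m : torus_cont A (sinf m).
Proof.
split=> [x|x z].
  exact: (continuous_comp (@continuous_phase (freq m) x) (@continuous_sin R _)).
rewrite /sinf dotDr dot_freq_lattice mulrDr.
by have [] := sin_cosD2pi_int (2 * pi * dot (freq m) x) (\sum_i m i 0 * z i 0).
Qed.

Lemma cosf0 x : cosf 0 x = 1.
Proof.
have /eqP f0 : freq 0 == 0 by rewrite freq_eq0.
by rewrite /cosf f0 /dot big1 ?mulr0 ?cos0 // => i _; rewrite mxE mul0r.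
Qed.

Lemma sinf0 x : sinf 0 x = 0.
Proof.
have /eqP f0 : freq 0 == 0 by rewrite freq_eq0.
by rewrite /sinf f0 /dot big1 ?mulr0 ?sin0 // => i _; rewrite mxE mul0r.
Qed.

Lemma cosfN m x : cosf (- m) x = cosf m x.
Proof. by rewrite /cosf freqN dotNl mulrN cosN. Qed.

Lemma sinfN m x : sinf (- m) x = - sinf m x.
Proof. by rewrite /sinf freqN dotNl mulrN sinN. Qed.

Lemma cosfB m m' x : cosf (m - m') x = cosf m x * cosf m' x + sinf m x * sinf m' x.
Proof. by rewrite /cosf freqD freqN dotDl dotNl mulrBr cosB. Qed.

Lemma cosfD m m' x : cosf (m + m') x = cosf m x * cosf m' x - sinf m x * sinf m' x.
Proof. by rewrite /cosf freqD dotDl mulrDr cosD. Qed.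

Lemma cosf_sub m x y : cosf m (x - y) = cosf m x * cosf m y + sinf m x * sinf m y.
Proof. by rewrite /cosf dotDr dotNr mulrBr cosB. Qed.

(** For nonzero [m], a translation by half a period along [freq A m] changes the sign of the
    character, so its mean equals its own opposite. *)
Lemma mean_cosf m : mean A (cosf m) = (m == 0)%:R.
Proof.
have [->|m0] := eqVneq m 0.
  by rewrite -[RHS](mean_cst A); congr mean; apply/funext => x; rewrite cosf0.
have f0 : dot (freq m) (freq m) != 0 by rewrite dot_eq0 freq_eq0.
pose v := (2 * dot (freq m) (freq m))^-1 *: freq m.
have := mean_shift Au v (torus_cosf m).
have -> : (fun x => cosf m (x + v)) = (fun x => - cosf m x).
  apply/funext => x; rewrite /cosf dotDr dotZr mulrDr.
  have -> : 2 * pi * ((2 * dot (freq m) (freq m))^-1 * dot (freq m) (freq m)) = pi.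
    by field.
  by rewrite cosDpi.
rewrite meanN //; last exact: torus_cosf.
by rewrite mulr0n => h; lra.
Qed.

End Characters.

(** * Fejer kernels *)

Lemma cvgr_sum (R : realType) (T I : Type) (F : set_system T) (r : seq I)
    (f : I -> T -> R) (l : I -> R) : Filter F ->
  (forall i, f i x @[x --> F] --> l i) ->
  \sum_(i <- r) f i x @[x --> F] --> \sum_(i <- r) l i.
Proof.
move=> FF fl; elim: r => [|i r IH].
  by under eq_fun do rewrite big_nil; rewrite big_nil; exact: cvg_cst.
under eq_fun do rewrite big_cons; rewrite big_cons.
exact: (cvgD (fl i) IH).
Qed.

Section FejerAverage.
Context {R : realType} {n : nat}.
Implicit Types (m : 'cV[int]_n) (K : nat).

Definition diffvec K (j l : {ffun 'I_n -> 'I_K.+1}) : 'cV[int]_n :=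
  \col_i ((j i)%:Z - (l i)%:Z).

(** A Fejer sum: [T d] is counted with weight [prod_i (1 - |d_i| / (K + 1))], and 0 outside the box.
    Summing over pairs of points of the box instead of writing the weights makes the positivity of
    the kernel visible. *)
Definition favg K (T : 'cV[int]_n -> R) : R :=
  (K.+1%:R ^+ n)^-1 * \sum_(j : {ffun 'I_n -> 'I_K.+1})
    \sum_(l : {ffun 'I_n -> 'I_K.+1}) T (diffvec j l).

Lemma favgD K T U : favg K (fun d => T d + U d) = favg K T + favg K U.
Proof.
rewrite /favg -mulrDr -big_split /=; congr (_ * _); apply: eq_bigr => j _.
by rewrite big_split.
Qed.

Lemma favgZ K c T : favg K (fun d => c * T d) = c * favg K T.
Proof.
rewrite /favg mulrCA; congr (_ * _); rewrite mulr_sumr.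
by apply: eq_bigr => j _; rewrite mulr_sumr.
Qed.

Lemma favg_sum K (I : Type) (r : seq I) (P : pred I) (T : I -> 'cV[int]_n -> R) :
  favg K (fun d => \sum_(i <- r | P i) T i d) = \sum_(i <- r | P i) favg K (T i).
Proof.
rewrite /favg -mulr_sumr; congr (_ * _).
rewrite [RHS]exchange_big; apply: eq_bigr => j _.
by rewrite [RHS]exchange_big.
Qed.

Lemma favg_le K T U : (forall d, T d <= U d) -> favg K T <= favg K U.
Proof.
move=> TU; rewrite ler_wpM2l // ?invr_ge0 ?exprn_ge0 //.
by apply: ler_sum => j _; apply: ler_sum.
Qed.

Lemma card_add_lt (k p : nat) : (\sum_(b < k) (b + p < k) = k - p)%N.
Proof.
elim: k => [|k IH]; first by rewrite big_ord0.
have [kp|kp] := leqP p k; last first.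
  rewrite big1 => [|i _]; first by apply/esym/eqP; rewrite subn_eq0.
  by apply/eqP; rewrite eqb0 -leqNgt (leq_trans kp) // leq_addl.
rewrite big_ord_recl add0n ltnS kp subSn // -IH add1n.
by congr S; apply: eq_bigr => i _; rewrite lift0 addSn ltnS.
Qed.

Lemma card_diff K (k : int) :
  (\sum_(a < K.+1) \sum_(b < K.+1) ((a%:Z - b%:Z)%R == k))%N = (K.+1 - `|k|)%N.
Proof.
have pos (p : nat) : (\sum_(a < K.+1) \sum_(b < K.+1) ((a%:Z - b%:Z)%R == p%:Z))%N
    = (K.+1 - p)%N.
  rewrite exchange_big /=.
  transitivity (\sum_(b < K.+1) (b + p < K.+1))%N.
    apply: eq_bigr => b _; case: ltnP => bp.
      rewrite (bigD1 (Ordinal bp)) //= big1 ?addn0 => [|i /negP ib].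
        by rewrite PoszD addrC addKr eqxx.
      apply/eqP; rewrite eqb0; apply/negP => /eqP ibp; apply: ib.
      by apply/eqP/val_inj => /=; lia.
    rewrite big1 // => i _; apply/eqP; rewrite eqb0; apply/negP => /eqP ibp.
    by have := ltn_ord i; lia.
  exact: card_add_lt.
case: k => p; first exact: pos.
rewrite exchange_big /= -pos; apply: eq_bigr => b _; apply: eq_bigr => a _.
by congr nat_of_bool; apply/eqP/eqP; lia.
Qed.

(** The number of pairs with difference [m] is a product over the coordinates. The truncated
    subtraction accounts for [|m_i| > K], where there is no pair. *)
Lemma favg_eq K m :
  favg K (fun d => (d == m)%:R) = \prod_i ((K.+1 - `|m i 0%R|)%N%:R / K.+1%:R).
Proof.
rewrite big_split /= prodr_const card_ord exprVn mulrC; congr (_ * _).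
transitivity (\sum_(j : {ffun 'I_n -> 'I_K.+1}) \sum_(l : {ffun 'I_n -> 'I_K.+1})
   \prod_i ((j i)%:Z - (l i)%:Z == m i 0)%:R : R).
  apply: eq_bigr => j _; apply: eq_bigr => l _.
  have [jl|] := eqVneq (diffvec j l) m.
    rewrite big1 // => i _.
    by move/colP/(_ i): jl; rewrite mxE => ->; rewrite eqxx.
  move=> jl; have [i ji] : exists i, (j i)%:Z - (l i)%:Z != m i 0.
    apply/existsP; apply: contraNT jl; rewrite negb_exists => /forallP h.
    by apply/eqP/colP => i; rewrite mxE; apply/eqP; have := h i; rewrite negbK.
  by rewrite (bigD1 i) //= (negbTE ji) mul0r.
pose G i (a b : 'I_K.+1) : R := (a%:Z - b%:Z == m i 0)%:R.
transitivity (\sum_(j : {ffun 'I_n -> 'I_K.+1}) \prod_i \sum_b G i (j i) b).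
  by apply: eq_bigr => j _; rewrite (bigA_distr_bigA (fun i b => G i (j i) b)).
rewrite -(bigA_distr_bigA (fun i a => \sum_b G i a b)).
apply: eq_bigr => i _; rewrite -card_diff natr_sum; apply: eq_bigr => a _.
by rewrite natr_sum.
Qed.

Lemma favg_eqN K m : favg K (fun d => (d == - m)%:R) = favg K (fun d => (d == m)%:R).
Proof. by rewrite !favg_eq; apply: eq_bigr => i _; rewrite mxE abszN. Qed.

Lemma favg_eq0 K : favg K (fun d => (d == 0)%:R) = 1.
Proof.
by rewrite favg_eq big1 // => i _; rewrite mxE /= subn0 divff // pnatr_eq0.
Qed.

Lemma favg_eq_cvg m :
  favg K (fun d => (d == m)%:R) @[K --> \oo] --> (1 : R).
Proof.
under eq_fun do rewrite favg_eq.
suff h (r : seq 'I_n) :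
    (\prod_(i <- r) ((K.+1 - `|m i 0%R|)%N%:R / K.+1%:R : R)) @[K --> \oo] --> (1 : R).
  exact: h.
elim: r => [|i r IH].
  by under eq_fun do rewrite big_nil; exact: cvg_cst.
under eq_fun do rewrite big_cons.
suff hi : ((K.+1 - `|m i 0%R|)%N%:R / K.+1%:R : R) @[K --> \oo] --> (1 : R).
  by have /(_ _) := cvgM hi IH; rewrite mulr1; apply.
have h0 : (1 - `|m i 0%R|%N%:R * K.+1%:R^-1 : R) @[K --> \oo] --> (1 : R).
  have /(_ _) h1 := cvgM (cvg_cst (`|m i 0%R|%N%:R : R)) (@cvg_harmonic R).
  by have /(_ _) := cvgB (cvg_cst (1 : R)) (h1 _); rewrite mulr0 subr0; apply.
apply: cvg_trans h0; apply: near_eq_cvg; near=> K.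
have Km : (`|m i 0%R| <= K.+1)%N by apply: leqW; near: K; exact: nbhs_infty_ge.
by rewrite natrB // mulrBl divff // pnatr_eq0.
Unshelve. all: by end_near. Qed.

End FejerAverage.

Section Fejer.
Context {R : realType} {n : nat} (A : 'M[R]_n).
Hypothesis Au : A \in unitmx.
Implicit Types (m : 'cV[int]_n) (K : nat).

Definition kernel K (x : 'cV[R]_n) : R := favg K (fun d => cosf A d x).

Lemma torus_favg K (T : 'cV[int]_n -> 'cV[R]_n -> R) :
  (forall d, torus_cont A (T d)) -> torus_cont A (fun x => favg K (T^~ x)).
Proof.
move=> tT; apply: torusZ; apply: torus_sum => j _.
by apply: torus_sum => l _.
Qed.

Lemma mean_favg K (T : 'cV[int]_n -> 'cV[R]_n -> R) :
  (forall d, torus_cont A (T d)) ->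
  mean A (fun x => favg K (T^~ x)) = favg K (fun d => mean A (T d)).
Proof.
move=> tT; have tj (j : {ffun 'I_n -> 'I_K.+1}) :
    torus_cont A (fun x => \sum_l T (diffvec j l) x) by exact: torus_sum.
rewrite meanZ //; last exact: torus_sum.
congr (_ * _); rewrite mean_sum //; apply: eq_bigr => j _.
by rewrite mean_sum.
Qed.

Lemma torus_kernel K : torus_cont A (kernel K).
Proof. by apply: torus_favg => d; exact: torus_cosf. Qed.

Lemma kernelN K x : kernel K (- x) = kernel K x.
Proof.
congr (_ * _); apply: eq_bigr => j _; apply: eq_bigr => l _.
by rewrite /cosf dotNr mulrN cosN.
Qed.

(** The double sum is the squared modulus of one exponential sum, split into its cosine and sine
    parts. *)
Lemma kernel_ge0 K x : 0 <= kernel K x.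
Proof.
rewrite mulr_ge0 // ?invr_ge0 ?exprn_ge0 //.
pose v (j : {ffun 'I_n -> 'I_K.+1}) : 'cV[int]_n := \col_i (j i)%:Z.
have -> : \sum_(j : {ffun 'I_n -> 'I_K.+1}) \sum_(l : {ffun 'I_n -> 'I_K.+1})
    cosf A (diffvec j l) x =
    (\sum_j cosf A (v j) x) ^+ 2 + (\sum_j sinf A (v j) x) ^+ 2.
  rewrite !expr2 !mulr_suml -big_split; apply: eq_bigr => j _ /=.
  rewrite !mulr_sumr -big_split; apply: eq_bigr => l _ /=.
  rewrite -cosfB; congr cosf; apply/colP => i; rewrite !mxE //.
by rewrite addr_ge0 ?sqr_ge0.
Qed.

Lemma mean_cosf_cosf m d :
  mean A (fun x => cosf A m x * cosf A d x) = 2^-1 * ((d == m)%:R + (d == - m)%:R).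
Proof.
have -> : (fun x => cosf A m x * cosf A d x) =
          (fun x => 2^-1 * (cosf A (d - m) x + cosf A (d + m) x)).
  by apply/funext => x; rewrite cosfB cosfD; field.
rewrite meanZ ?meanD ?mean_cosf ?subr_eq0 ?addr_eq0 //;
  by do ?apply: torusD; exact: torus_cosf.
Qed.

(** Orthogonality of characters leaves only the Fejer weight of [m]. For unit vectors [m] its
    convergence to 1 expresses that the kernel concentrates at lattice points. *)
Lemma mean_cosf_kernel K m :
  mean A (fun x => cosf A m x * kernel K x) = favg K (fun d => (d == m)%:R).
Proof.
have -> : (fun x => cosf A m x * kernel K x) =
    (fun x => favg K (fun d => cosf A m x * cosf A d x)).
  by apply/funext => x; rewrite favgZ.
rewrite (mean_favg _ (T := fun d x => cosf A m x * cosf A d x)); last first.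
  by move=> d; apply: torusM; exact: torus_cosf.
under eq_fun do rewrite mean_cosf_cosf.
by rewrite favgZ favgD favg_eqN; field.
Qed.

Lemma mean_kernel K : mean A (kernel K) = 1.
Proof.
rewrite -(@favg_eq0 R n K) -mean_cosf_kernel; congr mean; apply/funext => x.
by rewrite cosf0 // mul1r.
Qed.

Definition conv K (phi : 'cV[R]_n -> R) (x : 'cV[R]_n) : R :=
  mean A (fun t => phi t * kernel K (x - t)).

(** No factor 2: [fcos] and [- fsin] are the real and imaginary parts of the complex coefficient,
    and sums run over both [m] and [- m]. *)
Definition fcos (phi : 'cV[R]_n -> R) m := mean A (fun x => phi x * cosf A m x).
Definition fsin (phi : 'cV[R]_n -> R) m := mean A (fun x => phi x * sinf A m x).

Lemma conv_favg K phi x : torus_cont A phi ->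
  conv K phi x = favg K (fun d => fcos phi d * cosf A d x + fsin phi d * sinf A d x).
Proof.
move=> tphi.
have tc d : torus_cont A (fun t => phi t * cosf A d t).
  by apply: torusM => //; exact: torus_cosf.
have ts d : torus_cont A (fun t => phi t * sinf A d t).
  by apply: torusM => //; exact: torus_sinf.
have -> : conv K phi x = mean A (fun t => favg K (fun d =>
    cosf A d x * (phi t * cosf A d t) + sinf A d x * (phi t * sinf A d t))).
  congr mean; apply/funext => t; rewrite -favgZ; congr favg; apply/funext => d.
  by rewrite cosf_sub; ring.
rewrite (mean_favg _ (T := fun d t =>
    cosf A d x * (phi t * cosf A d t) + sinf A d x * (phi t * sinf A d t))).
  congr favg; apply/funext => d; rewrite meanD ?meanZ //; try exact: torusZ.
  by rewrite mulrC [X in _ + X]mulrC.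
by move=> d; apply: torusD; exact: torusZ.
Qed.

Lemma conv_shift K phi x : torus_cont A phi ->
  conv K phi x = mean A (fun s => phi (x + s) * kernel K s).
Proof.
move=> tphi; rewrite /conv -(mean_shift _ x); last 2 first.
- exact: Au.
- by apply: torusM => //; apply: torus_opp; exact: torus_kernel.
congr mean; apply/funext => t; rewrite addrC opprD addrA subrr add0r.
by rewrite kernelN.
Qed.

(** Uniform continuity in a form that can be averaged against the kernel. Either all the cosines are
    within [c] of 1, and [s] is so close to a lattice point that the oscillation is below [e]; or
    one term of the sum is at least [c], and [C = 2 B / c] makes the right side exceed twice the sup
    bound [B] of [phi]. *)
Lemma torus_modulus (phi : 'cV[R]_n -> R) (e : R) : torus_cont A phi -> 0 < e ->
  exists2 C : R, 0 < C & forall x s,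
    `|phi (x + s) - phi x| <= e + C * \sum_i (1 - cosf A (delta_mx i 0) s).
Proof.
move=> tphi e0.
have [B B0 phiB] := torus_bounded Au tphi.
have [d d0 dphi] := torus_unif_cont Au tphi e0.
have [d1 d10 dA] := @unif_cont_mulmx R n n 1 A d d0.
pose d2 := Num.min d1 2^-1.
have d20 : 0 < d2 by rewrite lt_min d10 invr_gt0 ltr0n.
have [c c0 cP] := @near_int_of_cos R d2 d20 (ltac:(by rewrite ge_min lexx orbT)).
exists (2 * B / c); first by rewrite !mulr_gt0 ?invr_gt0.
move=> x s; have [u su] : exists u, s = A *m u.
  by exists (invmx A *m s); rewrite mulKVmx.
(* The character of a dual basis vector reads off one lattice coordinate of [s]. *)
have cosu i : cosf A (delta_mx i 0) s = cos (2 * pi * u i 0).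
  rewrite /cosf; congr (cos (_ * _)).
  rewrite su -dot_mulmx freqP // /dot (bigD1 i) //= big1 => [|j ji].
    by rewrite !mxE !eqxx mul1r addr0.
  by rewrite !mxE (negbTE ji) mul0r.
have pos i : 0 <= 1 - cosf A (delta_mx i 0) s by rewrite cosu subr_ge0 cos_le1.
have [/existsP [i ci]|/existsPn far] :=
    boolP [exists i, c <= 1 - cosf A (delta_mx i 0) s].
  apply: (@le_trans _ _ (2 * B)).
    rewrite (le_trans (ler_normB _ _)) // mulr_natl mulr2n.
    by rewrite lerD ?phiB.
  apply: ler_wpDl; first exact: ltW.
  rewrite -(mulrA (2 * B)); apply: ler_peMr; first by rewrite mulr_ge0 // ltW.
  rewrite mulrC ler_pdivlMr // mul1r (le_trans ci) // (bigD1 i) //=.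
  by rewrite lerDl sumr_ge0.
have zP i : exists k : int, `|u i 0 - k%:~R| < d2.
  by apply: cP; rewrite -cosu ltNge far.
pose z : 'cV[int]_n := \col_i sval (cid (zP i)).
have us : `|u - map_mx intr z| < d1.
  apply: (@lt_le_trans _ _ d2); last by rewrite ge_min lexx.
  rewrite [ltLHS]mx_normrE; apply/bigmax_ltP; split; first exact: d20.
  by move=> [i j] _ /=; rewrite !mxE ord1; exact: (svalP (cid (zP i))).
have -> : phi x = phi (x + A *m map_mx intr z) by case: tphi => _ ->.
rewrite (le_trans (ltW (dphi _ _ _))) //.
  rewrite opprD addrACA subrr add0r.
  by rewrite su; exact: dA.
by rewrite lerDl mulr_ge0 ?sumr_ge0 // !mulr_ge0 ?invr_ge0 ?ltW.
Qed.

(** The kernel is nonnegative of mean 1, so averaging [torus_modulus] against it bounds the error by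
    [e / 2] plus [C] times the sum of one minus the Fejer weights of the unit vectors, which tends
    to 0. *)
Lemma conv_unif_cvg phi (e : R) : torus_cont A phi -> 0 < e ->
  \forall K \near \oo, forall x, `|conv K phi x - phi x| <= e.
Proof.
move=> tphi e0; have e20 : 0 < e / 2 by rewrite divr_gt0.
have [C C0 phiC] := torus_modulus tphi e20.
have bound K x : `|conv K phi x - phi x| <=
    e / 2 + C * \sum_(i < n) (1 - favg K (fun d : 'cV[int]_n => (d == delta_mx i 0)%:R)).
  have tk := torus_kernel K.
  have t1 : torus_cont A (fun s => phi (x + s)).
    by under eq_fun do rewrite addrC; exact: torus_shift.
  have t2 : torus_cont A (fun s => (phi (x + s) - phi x) * kernel K s).
    by apply: torusM => //; apply: torusB => //; exact: torus_cst.
  have t3 i : torus_cont A (fun s => 1 - cosf A (delta_mx i 0) s).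
    by apply: torusB; [exact: torus_cst|exact: torus_cosf].
  have t4 : torus_cont A (fun s => (e / 2 +
      C * \sum_i (1 - cosf A (delta_mx i 0) s)) * kernel K s).
    apply: torusM => //; apply: torusD; first exact: torus_cst.
    by apply: torusZ; exact: torus_sum.
  have -> : conv K phi x - phi x =
      mean A (fun s => (phi (x + s) - phi x) * kernel K s).
    rewrite conv_shift // -[X in _ - X]mulr1 -(mean_kernel K) -meanZ //.
    rewrite -meanB //; [|exact: torusM|exact: torusZ].
    by congr mean; apply/funext => s; rewrite mulrBl.
  have -> : e / 2 + C * \sum_(i < n) (1 - favg K (fun d : 'cV[int]_n => (d == delta_mx i 0)%:R)) =
      mean A (fun s => (e / 2 +
      C * \sum_i (1 - cosf A (delta_mx i 0) s)) * kernel K s).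
    have -> : (fun s => (e / 2 +
        C * \sum_i (1 - cosf A (delta_mx i 0) s)) * kernel K s) =
        (fun s => e / 2 * kernel K s +
        C * \sum_i (kernel K s - cosf A (delta_mx i 0) s * kernel K s)).
      apply/funext => s; rewrite mulrDl -(mulrA C) mulr_suml; congr (_ + _ * _).
      by apply: eq_bigr => i _; rewrite mulrBl mul1r.
    have t5 i : torus_cont A
        (fun s => kernel K s - cosf A (delta_mx i 0) s * kernel K s).
      by apply: torusB => //; apply: torusM => //; exact: torus_cosf.
    have t6 : torus_cont A (fun s =>
        \sum_i (kernel K s - cosf A (delta_mx i 0) s * kernel K s)).
      exact: torus_sum.
    rewrite meanD //; [|exact: torusZ|exact: torusZ].
    rewrite (meanZ Au (e / 2) tk) (meanZ Au C t6) mean_kernel mulr1 mean_sum //; congr (_ + _ * _).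
    apply: eq_bigr => i _; rewrite meanB //; last by apply: torusM => //; exact: torus_cosf.
    by rewrite mean_kernel mean_cosf_kernel.
  have le2 s : `|(phi (x + s) - phi x) * kernel K s| <=
      (e / 2 + C * \sum_i (1 - cosf A (delta_mx i 0) s)) * kernel K s.
    by rewrite normrM (ger0_norm (kernel_ge0 _ _)) ler_wpM2r ?kernel_ge0.
  rewrite ler_norml -meanN //; apply/andP; split; apply: mean_le => //.
  - exact: torusN.
  - by move=> s; have := le2 s; rewrite ler_norml => /andP[].
  - by move=> s; have := le2 s; rewrite ler_norml => /andP[].
have lim0 : (C * \sum_(i < n) (1 - favg K (fun d : 'cV[int]_n => (d == delta_mx i 0)%:R)))
    @[K --> \oo] --> (0 : R).
  have : (\sum_(i < n) (1 - favg K (fun d : 'cV[int]_n => (d == delta_mx i 0)%:R)))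
      @[K --> \oo] --> (\sum_(i < n) (1 - 1) : R).
    apply: cvgr_sum => i; exact: (cvgB (cvg_cst (1 : R)) (favg_eq_cvg (delta_mx i 0))).
  rewrite big1 => [h|i _]; last by rewrite subrr.
  by have /(_ _) := cvgM (cvg_cst C) h; rewrite mulr0; apply.
move/cvgrPdist_lt : lim0 => /(_ _ e20) lim0; near=> K => x.
rewrite (le_trans (bound K x)) // [leRHS]splitr lerD2l.
rewrite (le_trans (ler_norm _)) // -normrN -sub0r ltW //.
by near: K.
Unshelve. all: by end_near. Qed.

End Fejer.

(** * Parseval and Fourier coefficients of derivatives *)

Section Parseval.
Context {R : realType} {n : nat} (A : 'M[R]_n).
Hypothesis Au : A \in unitmx.
Implicit Types (m : 'cV[int]_n) (K : nat) (phi : 'cV[R]_n -> R).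

Lemma favg_supp K (L : seq 'cV[int]_n) (T : 'cV[int]_n -> R) : uniq L ->
  (forall d, d \notin L -> T d = 0) ->
  favg K T = \sum_(m <- L) T m * favg K (fun d => (d == m)%:R).
Proof.
move=> uL TL; under [RHS]eq_bigr do rewrite -favgZ.
rewrite -favg_sum; congr favg; apply/funext => d.
have [dL|dL] := boolP (d \in L).
  rewrite (bigD1_seq d) //= eqxx mulr1 big1 ?addr0 // => m md.
  by rewrite eq_sym (negbTE md) mulr0.
rewrite TL // big_seq big1 // => m mL.
by have [dm|] := eqVneq d m; [rewrite dm mL in dL|rewrite mulr0].
Qed.

Lemma favg_ge_term K (T : 'cV[int]_n -> R) m : (forall d, 0 <= T d) ->
  T m * favg K (fun d => (d == m)%:R) <= favg K T.
Proof.
move=> T0; rewrite -favgZ; apply: favg_le => d.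
by have [->|] := eqVneq d m; rewrite ?mulr1 ?mulr0.
Qed.

Lemma conv_cvg phi x : torus_cont A phi -> conv A K phi x @[K --> \oo] --> phi x.
Proof.
move=> tphi; apply/cvgrPdist_le => e e0; near=> K.
by rewrite distrC; move: x; near: K; exact: conv_unif_cvg.
Unshelve. all: by end_near. Qed.

(** All Fejer means of [phi] vanish, and they converge to [phi]. *)
Lemma fourier_unique phi : torus_cont A phi ->
  (forall m, fcos A phi m = 0 /\ fsin A phi m = 0) -> forall x, phi x = 0.
Proof.
move=> tphi phi0 x; have := conv_cvg (x := x) tphi.
have -> : (fun K => conv A K phi x) = cst 0.
  apply/funext => K; rewrite conv_favg // /favg big1 ?mulr0 // => j _.
  by rewrite big1 // => l _; have [-> ->] := phi0 (diffvec j l); rewrite !mul0r addr0.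
by move=> /cvg_lim <- //; rewrite lim_cst.
Qed.

Definition fpow phi m : R := fcos A phi m ^+ 2 + fsin A phi m ^+ 2.

Lemma fpow_ge0 phi m : 0 <= fpow phi m.
Proof. by rewrite addr_ge0 ?sqr_ge0. Qed.

Lemma mean_conv K phi : torus_cont A phi ->
  mean A (fun x => phi x * conv A K phi x) = favg K (fpow phi).
Proof.
move=> tphi.
have tc d : torus_cont A (fun t => phi t * cosf A d t).
  by apply: torusM => //; exact: torus_cosf.
have ts d : torus_cont A (fun t => phi t * sinf A d t).
  by apply: torusM => //; exact: torus_sinf.
pose T d x := fcos A phi d * (phi x * cosf A d x) + fsin A phi d * (phi x * sinf A d x).
transitivity (mean A (fun x => favg K (T^~ x))).
  congr mean; apply/funext => x; rewrite conv_favg // -favgZ.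
  by congr favg; apply/funext => d; rewrite /T; ring.
rewrite mean_favg //; last by move=> d; apply: torusD; exact: torusZ.
by congr favg; apply/funext => d; rewrite meanD ?meanZ //; exact: torusZ.
Qed.

Lemma torus_conv K phi : torus_cont A phi -> torus_cont A (conv A K phi).
Proof.
move=> tphi.
have -> : conv A K phi = fun x =>
    favg K (fun d => fcos A phi d * cosf A d x + fsin A phi d * sinf A d x).
  by apply/funext => x; rewrite conv_favg.
apply: (torus_favg _ (T := fun d x => fcos A phi d * cosf A d x + fsin A phi d * sinf A d x)).
by move=> d; apply: torusD; apply: torusZ; [exact: torus_cosf|exact: torus_sinf].
Qed.

(** Parseval in Cesaro form: by [mean_conv] the Fejer sum of the powers is the mean of [phi] times
    its Fejer mean, and the latter converges uniformly to [phi]. *)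
Lemma parseval phi : torus_cont A phi ->
  favg K (fpow phi) @[K --> \oo] --> mean A (fun x => phi x ^+ 2).
Proof.
move=> tphi; have [B B0 phiB] := torus_bounded Au tphi.
apply/cvgrPdist_le => e e0; near=> K.
have tc := torus_conv K tphi.
rewrite -mean_conv // -meanB //; [|exact: torusM|exact: torusM].
apply: mean_norm_le => //; first by apply: torusB; exact: torusM.
move=> x; rewrite expr2 -mulrBr normrM distrC.
rewrite (_ : e = B * (e / B)); last by rewrite mulrC divfK // gt_eqF.
rewrite ler_pM //; move: x; near: K.
by apply: conv_unif_cvg => //; rewrite divr_gt0.
Unshelve. all: by end_near. Qed.

End Parseval.

(* Locked, lest unification compare iterated derivatives by unfolding them. *)
HB.lock Definition pd (R : realType) (n : nat) (i : 'I_n)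
    (phi : 'cV[R]_n -> R) : 'cV[R]_n -> R :=
  fun x => 'D_(delta_mx i 0) phi x.
Arguments pd {R n} i phi _.

(** * Partial derivatives on the torus and their Fourier coefficients *)

Section Derivatives.
Context {R : realType} {n : nat} (A : 'M[R]_n).
Hypothesis Au : A \in unitmx.
Implicit Types (m : 'cV[int]_n) (K : nat) (phi : 'cV[R]_n -> R).

Lemma line_quotient (f : 'cV[R]_n -> R) (x v : 'cV[R]_n) (t : R) :
  (fun h : R => h^-1 *: (f (x + (h *: (1 : R) + t) *: v) - f (x + t *: v))) =
  (fun h : R => h^-1 *: (f (h *: v + (x + t *: v)) - f (x + t *: v))).
Proof.
apply/funext => h; congr (_ *: (f _ - _)).
by rewrite scalerDl addrCA [h *: 1]mulr1.
Qed.

Lemma is_derive_line (f : 'cV[R]_n -> R) (x v : 'cV[R]_n) (t l : R) :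
  is_derive t (1 : R) (fun t => f (x + t *: v)) l <-> is_derive (x + t *: v) v f l.
Proof.
split=> - [df fl]; split.
- by move: df; rewrite /derivable line_quotient.
- by rewrite -fl /derive line_quotient.
- by rewrite /derivable line_quotient.
- by rewrite -fl /derive line_quotient.
Qed.

Lemma pdE (i : 'I_n) phi x : pd i phi x = 'D_(delta_mx i 0) phi x.
Proof. by rewrite unlock. Qed.

Lemma is_derive_pd (i : 'I_n) phi x : derivable phi x (delta_mx i 0) ->
  is_derive x (delta_mx i 0) phi (pd i phi x).
Proof. by move=> d; rewrite pdE; exact: DeriveDef. Qed.

Lemma pd_val (i : 'I_n) phi x (l : R) :
  is_derive x (delta_mx i 0) phi l -> pd i phi x = l.
Proof. by rewrite pdE => -[]. Qed.

Definition pderivable (i : 'I_n) phi := forall x, derivable phi x (delta_mx i 0).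

(** A difference [phi (x + h e_i) - phi x] has mean zero by translation invariance. By the mean
    value theorem and uniform continuity of the derivative it differs from [h] times the derivative
    by at most [h e]; taking for [e] half the absolute value of a nonzero mean is contradictory. *)
Lemma mean_pd i phi : torus_cont A phi -> pderivable i phi ->
  torus_cont A (pd i phi) -> mean A (pd i phi) = 0.
Proof.
move=> tphi dphi tpd; apply/eqP; rewrite -normr_eq0 -[_ == _]orbF.
apply/negbNE/negP; rewrite orbF => N0.
have e0 : 0 < `|mean A (pd i phi)| / 2 by rewrite divr_gt0 // lt_def N0 normr_ge0.
have [d d0 dP] := torus_unif_cont Au tpd e0.
set e := _ / 2 in e0 dP; pose h := d / 2; have h0 : 0 < h by rewrite divr_gt0.
have ts : torus_cont A (fun x => phi (x + h *: delta_mx i 0)) by exact: torus_shift.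
have tB : torus_cont A (fun x => phi (x + h *: delta_mx i 0) - phi x) by exact: torusB.
have tZ : torus_cont A (fun x => h * pd i phi x) by exact: torusZ.
have : `|mean A (fun x => h * pd i phi x - (phi (x + h *: delta_mx i 0) - phi x))|
    <= h * e.
  apply: mean_norm_le => //; first exact: torusB.
  move=> x.
  have D (t : R) : is_derive t (1 : R) (fun t => phi (x + t *: delta_mx i 0))
      (pd i phi (x + t *: delta_mx i 0)).
    by apply/is_derive_line; apply: is_derive_pd.
  have [|c cP] := MVT_segment (ltW h0) (fun t _ => D t).
    by apply: derivable_within_continuous => t _; case: (D t).
  rewrite scale0r addr0 subr0 => ->.
  rewrite mulrC -mulrBl normrM (gtr0_norm h0) mulrC ler_wpM2l ?(ltW h0) //.
  apply/ltW/dP; rewrite opprD addrA subrr add0r normrN normrZ.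
  move: cP; rewrite in_itv /= => /andP[c0 ch]; rewrite (ger0_norm c0).
  apply: (@le_lt_trans _ _ (h * 1)).
    rewrite ler_pM //; apply: mx_norm_le => // a b; rewrite mxE.
    by case: (_ && _); rewrite ?normr1 ?normr0.
  by rewrite mulr1 ltr_pdivrMr // ltr_pMr // ltr1n.
rewrite meanB // meanB // mean_shift // subrr subr0 meanZ // normrM (gtr0_norm h0).
rewrite ler_pM2l // /e ler_pdivlMr // -subr_ge0 => h1.
have : 0 < `|mean A (pd i phi)| by rewrite lt_def N0 normr_ge0.
by move: h1; lra.
Qed.

Lemma is_derive_phase (u x v : 'cV[R]_n) :
  is_derive (0 : R) (1 : R) (fun t => 2 * pi * dot u (x + t *: v))
    (2 * pi * dot u v).
Proof.
have -> : (fun t => 2 * pi * dot u (x + t *: v)) =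
    (fun t : R => 2 * pi * dot u x + (2 * pi * dot u v) * t).
  by apply/funext => t; rewrite dotDr dotZr; ring.
have := is_deriveD (is_derive_cst (2 * pi * dot u x) (0 : R) (1 : R))
  (is_deriveZ (2 * pi * dot u v) (is_derive_id (0 : R) (1 : R))).
by rewrite add0r [_ *: 1]mulr1.
Qed.

Lemma is_derive_cosf m x v :
  is_derive x v (cosf A m) (- (2 * pi * dot (freq A m) v) * sinf A m x).
Proof.
rewrite -[x]addr0 -(scale0r v); apply/is_derive_line.
have dc := @is_derive_cos R (2 * pi * dot (freq A m) (x + 0 *: v)).
have := @is_derive1_comp R (@cos R) _ 0 _ _ dc (is_derive_phase (freq A m) x v).
by rewrite /sinf [X in is_derive _ _ _ X]mulrC mulrN mulNr.
Qed.

Lemma is_derive_sinf m x v :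
  is_derive x v (sinf A m) ((2 * pi * dot (freq A m) v) * cosf A m x).
Proof.
rewrite -[x]addr0 -(scale0r v); apply/is_derive_line.
have dc := @is_derive_sin R (2 * pi * dot (freq A m) (x + 0 *: v)).
have := @is_derive1_comp R (@sin R) _ 0 _ _ dc (is_derive_phase (freq A m) x v).
by rewrite /cosf [X in is_derive _ _ _ X]mulrC.
Qed.

Lemma dot_delta (u : 'cV[R]_n) i : dot u (delta_mx i 0) = u i 0.
Proof.
rewrite /dot (bigD1 i) //= big1 => [|j ji]; first by rewrite mxE !eqxx mulr1 addr0.
by rewrite mxE (negbTE ji) mulr0.
Qed.

Section FourierDerivative.
Variables (i : 'I_n) (phi : 'cV[R]_n -> R).
Hypotheses (tphi : torus_cont A phi) (dphi : pderivable i phi)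
  (tpd : torus_cont A (pd i phi)).

(** Integration by parts: [mean_pd] applied to the product of [phi] and the cosine. *)
Lemma fcos_pd m : fcos A (pd i phi) m = 2 * pi * freq A m i 0 * fsin A phi m.
Proof.
have tc := torus_cosf Au m; have ts := torus_sinf Au m.
have D x : is_derive x (delta_mx i 0) (fun x => phi x * cosf A m x)
    (pd i phi x * cosf A m x - 2 * pi * freq A m i 0 * (phi x * sinf A m x)).
  have d1 : is_derive x (delta_mx i 0) phi (pd i phi x) by exact: is_derive_pd.
  have := is_deriveM d1 (is_derive_cosf m x (delta_mx i 0)).
  rewrite dot_delta => h; apply: is_derive_eq h _.
  by rewrite /GRing.scale /=; ring.
have pdE : pd i (fun x => phi x * cosf A m x) =
    (fun x => pd i phi x * cosf A m x - 2 * pi * freq A m i 0 * (phi x * sinf A m x)).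
  by apply/funext => x; exact: pd_val (D x).
have := @mean_pd i _ (torusM tphi tc) (fun x => let: DeriveDef h _ := D x in h).
rewrite pdE meanB //; [|exact: torusM|by apply: torusZ; exact: torusM].
rewrite meanZ; [|by []|exact: torusM].
move=> h; apply/eqP; rewrite -subr_eq0; apply/eqP; apply: h.
by apply: torusB; [|apply: torusZ]; exact: torusM.
Qed.

Lemma fsin_pd m : fsin A (pd i phi) m = - (2 * pi * freq A m i 0 * fcos A phi m).
Proof.
have tc := torus_cosf Au m; have ts := torus_sinf Au m.
have D x : is_derive x (delta_mx i 0) (fun x => phi x * sinf A m x)
    (pd i phi x * sinf A m x + 2 * pi * freq A m i 0 * (phi x * cosf A m x)).
  have d1 : is_derive x (delta_mx i 0) phi (pd i phi x) by exact: is_derive_pd.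
  have := is_deriveM d1 (is_derive_sinf m x (delta_mx i 0)).
  rewrite dot_delta => h; apply: is_derive_eq h _.
  by rewrite /GRing.scale /=; ring.
have pdE : pd i (fun x => phi x * sinf A m x) =
    (fun x => pd i phi x * sinf A m x + 2 * pi * freq A m i 0 * (phi x * cosf A m x)).
  by apply/funext => x; exact: pd_val (D x).
have := @mean_pd i _ (torusM tphi ts) (fun x => let: DeriveDef h _ := D x in h).
rewrite pdE meanD //; [|exact: torusM|by apply: torusZ; exact: torusM].
rewrite meanZ; [|by []|exact: torusM].
move=> h; apply/eqP; rewrite -addr_eq0; apply/eqP; apply: h.
by apply: torusD; [|apply: torusZ]; exact: torusM.
Qed.

End FourierDerivative.

Definition torus_smooth phi := forall s : seq 'I_n,
  torus_cont A (foldr pd phi s) /\ forall i, pderivable i (foldr pd phi s).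

Lemma torus_smooth_cont phi : torus_smooth phi -> torus_cont A phi.
Proof. by move=> /(_ [::]) []. Qed.

Lemma torus_smooth_pd i phi : torus_smooth phi -> torus_smooth (pd i phi).
Proof.
move=> sphi s.
by have := sphi (rcons s i); rewrite foldr_rcons.
Qed.

Lemma torus_smooth_derivable i phi : torus_smooth phi -> pderivable i phi.
Proof. by move=> /(_ [::]) [_]; apply. Qed.

Lemma fcos_pd_smooth i phi m : torus_smooth phi ->
  fcos A (pd i phi) m = 2 * pi * freq A m i 0 * fsin A phi m.
Proof.
move=> sphi; apply: fcos_pd.
- exact: torus_smooth_cont.
- exact: torus_smooth_derivable.
- exact: (torus_smooth_cont (torus_smooth_pd i sphi)).
Qed.

Lemma fsin_pd_smooth i phi m : torus_smooth phi ->
  fsin A (pd i phi) m = - (2 * pi * freq A m i 0 * fcos A phi m).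
Proof.
move=> sphi; apply: fsin_pd.
- exact: torus_smooth_cont.
- exact: torus_smooth_derivable.
- exact: (torus_smooth_cont (torus_smooth_pd i sphi)).
Qed.

Lemma fcosB phi psi m : torus_cont A phi -> torus_cont A psi ->
  fcos A (fun x => phi x - psi x) m = fcos A phi m - fcos A psi m.
Proof.
move=> tphi tpsi; have tc := torus_cosf Au m.
rewrite /fcos -meanB //; [|exact: torusM|exact: torusM].
by congr mean; apply/funext => x; rewrite mulrBl.
Qed.

Lemma fsinB phi psi m : torus_cont A phi -> torus_cont A psi ->
  fsin A (fun x => phi x - psi x) m = fsin A phi m - fsin A psi m.
Proof.
move=> tphi tpsi; have tc := torus_sinf Au m.
rewrite /fsin -meanB //; [|exact: torusM|exact: torusM].
by congr mean; apply/funext => x; rewrite mulrBl.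
Qed.

Lemma fcos_pd2 i j phi m : torus_smooth phi ->
  fcos A (pd i (pd j phi)) m =
  - (4 * pi ^+ 2 * (freq A m i 0 * freq A m j 0)) * fcos A phi m.
Proof.
move=> sphi; rewrite (fcos_pd_smooth i m (torus_smooth_pd j sphi)).
by rewrite (fsin_pd_smooth j m sphi); ring.
Qed.

Lemma fsin_pd2 i j phi m : torus_smooth phi ->
  fsin A (pd i (pd j phi)) m =
  - (4 * pi ^+ 2 * (freq A m i 0 * freq A m j 0)) * fsin A phi m.
Proof.
move=> sphi; rewrite (fsin_pd_smooth i m (torus_smooth_pd j sphi)).
by rewrite (fcos_pd_smooth j m sphi); ring.
Qed.

(* The difference of the two sides has zero Fourier coefficients. *)
Lemma pdC i j phi x : torus_smooth phi -> pd i (pd j phi) x = pd j (pd i phi) x.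
Proof.
move=> sphi; have s2 k l := torus_smooth_pd k (torus_smooth_pd l sphi).
apply/eqP; rewrite -subr_eq0; apply/eqP; move: x.
have tij := torus_smooth_cont (s2 i j); have tji := torus_smooth_cont (s2 j i).
apply: (fourier_unique Au (torusB tij tji)) => m.
rewrite (fcosB m tij tji) (fsinB m tij tji); split.
  apply/eqP; rewrite subr_eq0; apply/eqP.
  apply: (etrans (fcos_pd2 i j m sphi)).
  by apply/esym/(etrans (fcos_pd2 j i m sphi)); ring.
apply/eqP; rewrite subr_eq0; apply/eqP.
apply: (etrans (fsin_pd2 i j m sphi)).
by apply/esym/(etrans (fsin_pd2 j i m sphi)); ring.
Qed.

Definition lap phi : 'cV[R]_n -> R := fun x => \sum_i pd i (pd i phi) x.

Lemma fcos_lap phi m : torus_smooth phi ->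
  fcos A (lap phi) m = - (4 * pi ^+ 2 * dot (freq A m) (freq A m)) * fcos A phi m.
Proof.
move=> sphi; have t2 i := torus_smooth_cont (torus_smooth_pd i (torus_smooth_pd i sphi)).
have tM i : torus_cont A (fun x => pd i (pd i phi) x * cosf A m x).
  exact: (torusM (t2 i) (torus_cosf Au m)).
transitivity (\sum_i fcos A (pd i (pd i phi)) m).
  rewrite /fcos -mean_sum //; congr mean; apply/funext => x.
  by rewrite mulr_suml.
rewrite /dot mulr_sumr -sumrN mulr_suml; apply: eq_bigr => i _.
rewrite (fcos_pd2 i i m sphi).
by ring.
Qed.

Lemma fsin_lap phi m : torus_smooth phi ->
  fsin A (lap phi) m = - (4 * pi ^+ 2 * dot (freq A m) (freq A m)) * fsin A phi m.
Proof.
move=> sphi; have t2 i := torus_smooth_cont (torus_smooth_pd i (torus_smooth_pd i sphi)).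
have tM i : torus_cont A (fun x => pd i (pd i phi) x * sinf A m x).
  exact: (torusM (t2 i) (torus_sinf Au m)).
transitivity (\sum_i fsin A (pd i (pd i phi)) m).
  rewrite /fsin -mean_sum //; congr mean; apply/funext => x.
  by rewrite mulr_suml.
rewrite /dot mulr_sumr -sumrN mulr_suml; apply: eq_bigr => i _.
rewrite (fsin_pd2 i i m sphi).
by ring.
Qed.

Lemma torus_lap phi : torus_smooth phi -> torus_cont A (lap phi).
Proof.
move=> sphi; apply: torus_sum => i _.
exact: (torus_smooth_cont (torus_smooth_pd i (torus_smooth_pd i sphi))).
Qed.

Lemma fpow_lap phi m : torus_smooth phi ->
  fpow A (lap phi) m =
  16 * pi ^+ 4 * dot (freq A m) (freq A m) ^+ 2 * fpow A phi m.
Proof. by move=> sphi; rewrite /fpow fcos_lap // fsin_lap //; ring. Qed.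

Lemma fpow_pd i phi m : torus_smooth phi ->
  fpow A (pd i phi) m = 4 * pi ^+ 2 * freq A m i 0 ^+ 2 * fpow A phi m.
Proof. by move=> sphi; rewrite /fpow fcos_pd_smooth // fsin_pd_smooth //; ring. Qed.

End Derivatives.

(** * Korkine-Zolotarev bounds in dimension three *)

Section Ternary.
Context {R : rcfType}.
Implicit Types s t b u w p g : R.

(** After elimination of [b ^+ 2] this is a lower bound for [2 * b * t]. The difference of the
    squares is [1/2 - s] times a cubic positive on [[1/3, 1/2]], with equality at [s = 1/2]. *)
Lemma corner_ineq_near s t b : 1/3 <= s -> s <= 1/2 -> 0 <= t -> 0 <= b ->
  b ^+ 2 = 1 - s ^+ 2 -> t ^+ 2 = 1/3 - s ^+ 2 ->
  1/4 + b ^+ 2 <= s + 2 * b * t.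
Proof.
move=> s1 s2 t0 b0 bs ts.
have h : 5/4 - s - s ^+ 2 <= 2 * b * t.
  rewrite -ler_sqr ?nnegrE; [|nra|by rewrite !mulr_ge0].
  have -> : (2 * b * t) ^+ 2 = 4 * (1 - s ^+ 2) * (1/3 - s ^+ 2).
    by rewrite -bs -ts; ring.
  have g0 : 0 <= - 3 * s ^+ 3 + s ^+ 2 / 2 + 49/12 * s - 11/24.
    have s3 : s ^+ 3 <= 1/8.
      have -> : 1/8 = (1/2) ^+ 3 :> R by field.
      by rewrite lerXn2r ?nnegrE; lra.
    by have := sqr_ge0 s; lra.
  have : 0 <= (1/2 - s) * (- 3 * s ^+ 3 + s ^+ 2 / 2 + 49/12 * s - 11/24).
    by rewrite mulr_ge0; lra.
  by lra.
by rewrite bs; lra.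
Qed.

(** It reduces to [(1 - s) ^+ 2 <= b * t], where the difference of the squares is
    [4 (1 - s)^2 (1/2 - s) (s - 1/3)]: both ends of the range of [s] are cases of equality. *)
Lemma corner_ineq_far s t b : 1/3 <= s -> s <= 1/2 -> 0 <= t -> 0 <= b ->
  b ^+ 2 = 1 - s ^+ 2 -> t ^+ 2 = 1/3 - s ^+ 2 ->
  (1 - s) ^+ 2 + b ^+ 2 <= 2 * ((1 - s) * s + b * t).
Proof.
move=> s1 s2 t0 b0 bs ts.
have h : (1 - s) ^+ 2 <= b * t.
  rewrite -ler_sqr ?nnegrE; [|nra|by rewrite !mulr_ge0].
  have -> : (b * t) ^+ 2 = (1 - s ^+ 2) * (1/3 - s ^+ 2).
    by rewrite -bs -ts; ring.
  have f : 0 <= 4 * (1 - s) * (1/2 - s) * (s - 1/3) by rewrite !mulr_ge0; lra.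
  by lra.
by rewrite bs; lra.
Qed.

(** A linear form compared at two points of a circle: since [(s - w) (w + s) = (u - t) (u + t)], the
    difference of its values times [w + s] is [(u - t) (be (w + s) - al (u + t))]. *)
Lemma arc_mono s t u w (al be : R) : 0 < w + s -> t <= u ->
  w ^+ 2 + u ^+ 2 = s ^+ 2 + t ^+ 2 -> al * (u + t) <= be * (w + s) ->
  al * s + be * t <= al * w + be * u.
Proof.
move=> ws tu e h.
have e1 : (s - w) * (w + s) = (u - t) * (u + t) by lra.
rewrite -subr_ge0 -(pmulr_lge0 _ ws).
have -> : (al * w + be * u - (al * s + be * t)) * (w + s) =
   be * (w + s) * (u - t) - al * ((s - w) * (w + s)) by ring.
rewrite e1.
have -> : be * (w + s) * (u - t) - al * ((u - t) * (u + t)) =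
   (u - t) * (be * (w + s) - al * (u + t)) by ring.
by rewrite mulr_ge0 ?subr_ge0.
Qed.

Lemma sqr_dist_le (x y d : R) : x - y <= d -> y - x <= d -> (x - y) ^+ 2 <= d ^+ 2.
Proof.
move=> h1 h2; rewrite -[leLHS]real_normK ?num_real // lerXn2r ?nnegrE //.
  by rewrite (le_trans (normr_ge0 (x - y))) // ler_norml; apply/andP; split; lra.
by rewrite ler_norml; apply/andP; split; lra.
Qed.

(* The Korkine-Zolotarev bound [a_{i+2}^2 >= 2/3 a_i^2], normalized to
   [a_i = 1]. With [s^2 = 1 - b^2], [t^2 = b^2 - 2/3], [w^2 = 1/3 - u^2], a
   violation puts the point [(g, u)] in a region that the two corner
   inequalities show to be empty; along the arc [w^2 + u^2 = 1/3] the worst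
   case is [u = t]. *)
Lemma ternary_bound_normalized p b g u c2 :
  0 <= p -> p <= 1/2 -> 0 < b -> - (1/2) <= g -> g <= 1/2 -> 0 <= u -> u <= b / 2 ->
  1 <= p ^+ 2 + b ^+ 2 -> b ^+ 2 <= u ^+ 2 + c2 -> 1 <= g ^+ 2 + u ^+ 2 + c2 ->
  1 <= (g - p) ^+ 2 + (u - b) ^+ 2 + c2 ->
  1 <= (g - p + 1) ^+ 2 + (u - b) ^+ 2 + c2 ->
  2/3 <= c2.
Proof.
move=> p0 p1 b0 g0 g1 u0 u1 H1 H2 H3 H4 H5; rewrite leNgt; apply/negP => c23.
have b34 : 3/4 <= b ^+ 2.
  have : p ^+ 2 <= (1/2) ^+ 2 by rewrite lerXn2r ?nnegrE; lra.
  by lra.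
have ub : u ^+ 2 <= b ^+ 2 / 4.
  have -> : b ^+ 2 / 4 = (b / 2) ^+ 2 by field.
  by rewrite lerXn2r ?nnegrE; lra.
have b89 : b ^+ 2 <= 8/9 by lra.
have root (x : R) : 0 <= x -> exists y : R, 0 <= y /\ y ^+ 2 = x.
  by move=> x0; exists (Num.sqrt x); rewrite sqrtr_ge0 sqr_sqrtr.
(* If [c2 < 2/3], the three length conditions force [s <= p], [t <= u] and [w <= |g|]. *)
have [|s [s0 s2]] := root (1 - b ^+ 2); first by lra.
have [|t [t0 t2]] := root (b ^+ 2 - 2/3); first by lra.
have [|w [w0 w2]] := root (1/3 - u ^+ 2); first by lra.
have third (x : R) : 0 <= x -> 1/9 <= x ^+ 2 -> 1/3 <= x.
  move=> x0 x2; have x3 : (1/3) ^+ 2 <= x ^+ 2 by lra.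
  by move: x3; rewrite ler_sqr ?nnegrE; lra.
have s3 : 1/3 <= s by apply: third => //; lra.
have w3 : 1/3 <= w by apply: third => //; lra.
have s12 : s <= 1/2 by rewrite -ler_sqr ?nnegrE //; lra.
have sp : s <= p by rewrite -ler_sqr ?nnegrE //; lra.
have tu : t <= u by rewrite -ler_sqr ?nnegrE //; lra.
have tb : t <= b by lra.
have bs : b ^+ 2 = 1 - s ^+ 2 by lra.
have ts : t ^+ 2 = 1/3 - s ^+ 2 by lra.
have ws : 0 < w + s by lra.
have arc : w ^+ 2 + u ^+ 2 = s ^+ 2 + t ^+ 2 by lra.
have bw : b * (2/3) <= b * (w + s) by rewrite ler_wpM2l; lra.
have near_corner : 1/4 + b ^+ 2 <= w + 2 * b * u.
  have := corner_ineq_near s3 s12 t0 (ltW b0) bs ts.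
  have := @arc_mono s t u w 1 (2 * b) ws tu arc; rewrite !mul1r => h1 h2.
  by apply: le_trans h2 _; apply: h1; lra.
have far_corner : (1 - s) ^+ 2 + b ^+ 2 <= 2 * ((1 - s) * w + b * u).
  have h2 := corner_ineq_far s3 s12 t0 (ltW b0) bs ts.
  apply: le_trans h2 _; rewrite ler_pM2l //; apply: arc_mono => //.
  have : (1 - s) * (u + t) <= 2/3 * b by rewrite ler_pM; lra.
  by lra.
(* For basis vectors [(1, 0, 0)], [(p, b, 0)] and a third one starting with [(g, u)], the
   contradiction comes from the third minus the second if [g >= 0], and from that difference plus
   the first if [g < 0]: they would be shorter than 1. *)
have [g_ge0|g_lt0] := leP 0 g.
- have wg : w <= g.
    by rewrite -ler_sqr ?nnegrE //; lra.
  have d : (g - p) ^+ 2 <= (1/2 - s) ^+ 2 \/ (g - p) ^+ 2 <= (1/2 - w) ^+ 2.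
    have [gp|/ltW gp] := leP p g; [left|right].
      by rewrite lerXn2r ?nnegrE; lra.
    by apply: sqr_dist_le; lra.
  case: d => d; last by lra.
  have := corner_ineq_near s3 s12 t0 (ltW b0) bs ts.
  have : (u - b) ^+ 2 <= (t - b) ^+ 2.
    by rewrite -[leLHS]sqrrN -[leRHS]sqrrN lerXn2r ?nnegrE; lra.
  by lra.
- have wg : w <= - g.
    by rewrite -ler_sqr ?nnegrE ?sqrrN //; lra.
  have : (g - p + 1) ^+ 2 <= (1 - s - w) ^+ 2 by rewrite lerXn2r ?nnegrE; lra.
  by lra.
Qed.

(** Reflecting the second axis and changing the sign of the second basis vector replaces [al], [u]
    by their opposites; reflecting the first axis does so for [al], [g]. This reduces to
    [al, u >= 0], where three choices of [k], [l] suffice. *)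
Lemma ternary_bound_unit al b g u c2 :
  `|al| <= 1/2 -> 0 < b -> `|g| <= 1/2 -> `|u| <= b / 2 ->
  1 <= al ^+ 2 + b ^+ 2 -> b ^+ 2 <= u ^+ 2 + c2 ->
  (forall k l : int,
     1 <= (k%:~R + l%:~R * al + g) ^+ 2 + (l%:~R * b + u) ^+ 2 + c2) ->
  2/3 <= c2.
Proof.
move=> + b0.
wlog u0 : al u / 0 <= u => [wl al1 g1 u1 H1 H2 H3|].
  have [u0|/ltW u0] := leP 0 u; first exact: (wl al u).
  apply: (wl (- al) (- u)); rewrite ?normrN ?sqrrN ?oppr_ge0 // => k l.
  have := H3 k (- l); rewrite !rmorphN /= !mulrN !mulNr.
  by rewrite -[(- (l%:~R * b) + u) ^+ 2]sqrrN opprD opprK.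
wlog a0 : al g / 0 <= al => [wl al1 g1 u1 H1 H2 H3|].
  have [a0|/ltW a0] := leP 0 al; first exact: (wl al g).
  apply: (wl (- al) (- g)); rewrite ?normrN ?sqrrN ?oppr_ge0 // => k l.
  have := H3 (- k) l; rewrite !rmorphN /=.
  by rewrite -[(_ + g) ^+ 2]sqrrN !opprD opprK mulrN.
move=> al1 g1 u1 H1 H2 H3.
move: al1 g1 u1; rewrite (ger0_norm a0) (ger0_norm u0) ler_norml => a1 /andP[g0 g1] u1.
apply: (@ternary_bound_normalized al b g u c2) => //.
- by have := H3 0 0; rewrite !mul0r !add0r.
- have := H3 0 (-1); rewrite !mulN1r add0r.
  by rewrite [- al + g]addrC [- b + u]addrC.
- have := H3 1 (-1); rewrite !mulN1r.
  have -> : 1 - al + g = g - al + 1 by ring.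
  by rewrite [- b + u]addrC.
Qed.

Lemma ternary_bound P al b g u c :
  0 < P -> `|al| <= P / 2 -> 0 < b -> `|g| <= P / 2 -> `|u| <= b / 2 ->
  P ^+ 2 <= al ^+ 2 + b ^+ 2 -> b ^+ 2 <= u ^+ 2 + c ^+ 2 ->
  (forall k l : int,
     P ^+ 2 <= (k%:~R * P + l%:~R * al + g) ^+ 2 + (l%:~R * b + u) ^+ 2 + c ^+ 2) ->
  2/3 * P ^+ 2 <= c ^+ 2.
Proof.
move=> P0 al1 b0 g1 u1 H1 H2 H3.
have P20 : 0 < P ^+ 2 by rewrite exprn_gt0.
have Pn : P != 0 by rewrite gt_eqF.
have sc (x : R) : `|x| <= P / 2 -> `|x / P| <= 1/2.
  move=> h; rewrite normrM normfV (gtr0_norm P0) ler_pdivrMr //.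
  lra.
rewrite -ler_pdivlMr // -expr_div_n.
apply: (@ternary_bound_unit (al / P) (b / P) (g / P) (u / P)).
- exact: sc.
- exact: divr_gt0.
- exact: sc.
- rewrite normrM normfV (gtr0_norm P0) mulrAC ler_pM2r ?invr_gt0 //.
- by rewrite !expr_div_n -mulrDl ler_pdivlMr // mul1r.
- by rewrite !expr_div_n -mulrDl ler_pM2r ?invr_gt0.
- move=> k l.
  have -> : k%:~R + l%:~R * (al / P) + g / P = (k%:~R * P + l%:~R * al + g) / P.
    by field.
  have -> : l%:~R * (b / P) + u / P = (l%:~R * b + u) / P by field.
  by rewrite !expr_div_n -!mulrDl ler_pdivlMr // mul1r.
Qed.

End Ternary.

(** * The dual lattice inequality *)

(** The arithmetic of the exceptional case in [dual_gap_ge0], with [x] and [y] the squares of the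
    entries q and k of xi. The possibly negative contribution [- x * y] of k is cancelled by [x * y]
    from q, leaving at least [x * s + y ^+ 2 + rest ^+ 2]. *)
Lemma gap_arith (R : realFieldType) (s x y rest r iq ik T G : R) :
  0 < s -> 0 <= x -> 0 <= y -> 0 <= rest -> r = x + (y + rest) ->
  iq <= s + x -> ik <= 2 * s + 2 * x -> rest * r <= T ->
  G = x * (2 * s + r - iq) + (y * (2 * s + r - ik) + T) ->
  0 <= G /\ (G = 0 -> r = 0).
Proof.
move=> s0 x0 y0 rest0 rE iqs iks restT GE.
have hq : x * (s + y + rest) <= x * (2 * s + r - iq) by rewrite ler_wpM2l //; lra.
have hk : y * (y + rest - x) <= y * (2 * s + r - ik) by rewrite ler_wpM2l //; lra.
have p1 : 0 <= x * rest by rewrite mulr_ge0.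
have p2 : 0 <= y * rest by rewrite mulr_ge0.
have key : x * s + y ^+ 2 + rest ^+ 2 <= G.
  rewrite GE; apply: le_trans (lerD hq (lerD hk restT)).
  by rewrite rE; lra.
have p3 : 0 <= x * s by rewrite mulr_ge0 // ltW.
have p4 := sqr_ge0 y; have p5 := sqr_ge0 rest.
split=> [|g0]; first by lra.
have /eqP : rest ^+ 2 = 0 by lra.
have /eqP : y ^+ 2 = 0 by lra.
have /eqP : x * s = 0 by lra.
rewrite mulf_eq0 (gt_eqF s0) orbF => /eqP xz.
rewrite sqrf_eq0 => /eqP yz; rewrite sqrf_eq0 => /eqP rz.
by rewrite rE xz yz rz !addr0.
Qed.

(** The Korkine-Zolotarev conditions in coordinates: for a triangular basis, projecting off the
    columns before [p] erases the coordinates before [p], so the last clause says that [A p p] is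
    the least length of a nonzero projected lattice vector. *)
Definition reduced_upper (R : rcfType) (n : nat) (A : 'M[R]_n) : Prop :=
  [/\ (forall i j : 'I_n, (j < i)%N -> A i j = 0),
      (forall i : 'I_n, 0 < A i i),
      (forall i j : 'I_n, (i < j)%N -> `|A i j| <= A i i / 2) &
      (forall (p : 'I_n) (z : 'cV[int]_n),
         (exists2 i : 'I_n, (p <= i)%N & (A *m map_mx intr z) i 0 != 0) ->
         A p p ^+ 2 <= \sum_(i < n | (p <= i)%N) (A *m map_mx intr z) i 0 ^+ 2)].

(** * Ratios between the diagonal entries of a reduced basis *)

Section Reduced.
Context {R : rcfType} {n : nat} (A : 'M[R]_n).
Hypothesis redA : reduced_upper A.

Lemma mul_three (p q r i : 'I_n) (k l t : int) :
  (A *m map_mx intr (\col_j (k *+ (j == p) + l *+ (j == q) + t *+ (j == r)) : 'cV[int]_n)) i 0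
  = k%:~R * A i p + l%:~R * A i q + t%:~R * A i r.
Proof.
rewrite mxE.
under eq_bigr => j _ do rewrite !mxE !rmorphD !rmorphMn /= !mulrDr.
rewrite !big_split /=.
have E (s : 'I_n) (c : int) : \sum_j A i j * (c%:~R *+ (j == s)) = c%:~R * A i s.
  rewrite (bigD1 s) //= eqxx big1 ?addr0 => [|j /negbTE ->]; last by rewrite mulr0.
  by rewrite mulrC.
by rewrite !E.
Qed.

(** The minimality of [A p p] tested on column [q] plus [k] times column [p]. The value [k = 0]
    gives the ratio 3/4; a general [k] serves in the exceptional case of [dual_gap_ge0]. *)
Lemma reduced_step (p q : 'I_n) (k : int) : q = p.+1 :> nat ->
  A p p ^+ 2 <= (k%:~R * A p p + A p q) ^+ 2 + A q q ^+ 2.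
Proof.
move=> qp; have [U D _ S] := redA.
have zE i := mul_three p p q i k 0 1.
have := S p (\col_j (k *+ (j == p) + 0 *+ (j == p) + 1 *+ (j == q))).
under eq_bigr do rewrite zE mul0r addr0 mul1r.
have pq : p != q by apply/eqP => /(congr1 val) /=; lia.
rewrite (bigD1 p) //= (bigD1 q) /=; last by rewrite eq_sym pq qp leqnSn.
rewrite big1 ?addr0 => [|i /andP[/andP[pi ip] iq]]; last first.
  rewrite !U ?mulr0 ?addr0 ?expr0n //; move: ip iq; rewrite -!val_eqE /=; lia.
rewrite (U q p) ?mulr0 ?add0r ?qp //.
apply; exists q; first by rewrite qp.
by rewrite zE mul0r addr0 mul1r (U q p) ?qp // mulr0 add0r gt_eqF.
Qed.

Lemma reduced_step1 (p q : 'I_n) : q = p.+1 :> nat ->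
  A p p ^+ 2 <= A p q ^+ 2 + A q q ^+ 2.
Proof. by move=> qp; have := reduced_step 0 qp; rewrite mul0r add0r. Qed.

Lemma reduced_ratio1 (p q : 'I_n) : q = p.+1 :> nat ->
  3/4 * A p p ^+ 2 <= A q q ^+ 2.
Proof.
move=> qp; have [_ D B _] := redA.
have h1 := reduced_step1 qp.
have : A p q ^+ 2 <= (A p p / 2) ^+ 2.
  rewrite -[leLHS]real_normK ?num_real // lerXn2r ?nnegrE //.
    by rewrite divr_ge0 // ltW.
  by apply: B; rewrite qp.
by rewrite expr_div_n; lra.
Qed.

Lemma reduced_ratio2 (p r : 'I_n) : r = p.+2 :> nat ->
  2/3 * A p p ^+ 2 <= A r r ^+ 2.
Proof.
move=> rp; have [U D B S] := redA.
have qn : (p.+1 < n)%N by have := ltn_ord r; lia.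
pose q : 'I_n := Ordinal qn.
have qp : q = p.+1 :> nat by [].
have rq : r = q.+1 :> nat by rewrite rp.
apply: (@ternary_bound R _ (A p q) (A q q) (A p r) (A q r)) => //.
- by apply: B; rewrite qp.
- by apply: B; rewrite rp; lia.
- by apply: B; rewrite rq.
- exact: reduced_step1.
- exact: reduced_step1.
move=> k l; have zE i := mul_three p q r i k l 1.
have := S p (\col_j (k *+ (j == p) + l *+ (j == q) + 1 *+ (j == r))).
under eq_bigr do rewrite zE mul1r.
have pq : p != q by apply/eqP => /(congr1 val) /=; lia.
have pr : p != r by apply/eqP => /(congr1 val) /=; lia.
have qr : q != r by apply/eqP => /(congr1 val) /=; lia.
rewrite (bigD1 p) //= (bigD1 q) /=; last by rewrite eq_sym pq leqnSn.
rewrite (bigD1 r) /=; last by rewrite ![r == _]eq_sym pr qr !andbT rp; lia.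
rewrite big1 ?addr0 => [|i /andP[/andP[/andP[pi ip] iq] ir]]; last first.
  have ri : (r < i)%N by move: ip iq ir; rewrite -!val_eqE /=; lia.
  by rewrite !U ?mulr0 ?addr0 ?expr0n //; move: ri; rewrite rp /=; lia.
rewrite addrA (U q p) ?(U r p) ?(U r q) ?mulr0 ?add0r ?rp /=; try lia.
apply; exists r; first by rewrite rp; lia.
rewrite zE mul1r (U r p) ?(U r q) ?mulr0 ?add0r ?rp ?gt_eqF //=; try lia.
Qed.

(** Distance three is one step of ratio 3/4 followed by a double step of ratio 2/3, and the product
    is exactly 1/2. *)
Lemma reduced_ratio_half (p q : 'I_n) : (p < q)%N -> (q <= p + 3)%N ->
  A p p ^+ 2 / 2 <= A q q ^+ 2.
Proof.
move=> pq qp; have p2 := sqr_ge0 (A p p).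
have [q1|q1] := eqVneq (q : nat) p.+1.
  by have := reduced_ratio1 q1; lra.
have [q2|q2] := eqVneq (q : nat) p.+2.
  by have := reduced_ratio2 q2; lra.
have p1n : (p.+1 < n)%N by have := ltn_ord q; lia.
have h1 := @reduced_ratio1 p (Ordinal p1n) erefl.
have q3 : q = (Ordinal p1n).+2 :> nat by rewrite /=; lia.
by have := reduced_ratio2 q3; lra.
Qed.

(** At distance four the ratio is at least [3/4 * 1/2 = 3/8], above 1/4. Strictness makes the gap
    positive when [|m_p| >= 2]. *)
Lemma reduced_ratio_quarter (p q : 'I_n) : (p < q)%N -> (q <= p + 4)%N ->
  A p p ^+ 2 < 4 * A q q ^+ 2.
Proof.
move=> pq qp; have [_ D _ _] := redA.
have p2 : 0 < A p p ^+ 2 by rewrite exprn_gt0.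
have [q3|q3] := leqP q (p + 3); first by have := reduced_ratio_half pq q3; lra.
have p1n : (p.+1 < n)%N by have := ltn_ord q; lia.
have h1 := @reduced_ratio1 p (Ordinal p1n) erefl.
have : A (Ordinal p1n) (Ordinal p1n) ^+ 2 / 2 <= A q q ^+ 2.
  by apply: reduced_ratio_half => /=; lia.
by lra.
Qed.

(** * Vectors of the dual of a reduced lattice *)

Section Dual.
Variables (m : 'cV[int]_n) (xi : 'cV[R]_n).
Hypothesis xim : A^T *m xi = map_mx intr m.

Lemma dual_entry (j : 'I_n) : \sum_(k < n | (k <= j)%N) A k j * xi k 0 = (m j 0)%:~R.
Proof.
have [U _ _ _] := redA.
have /colP/(_ j) := xim; rewrite !mxE => <-.
rewrite [RHS](bigID (fun k : 'I_n => (k <= j)%N)) /= [X in _ + X]big1 ?addr0.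
  by apply: eq_bigr => k _; rewrite mxE.
by move=> k; rewrite -ltnNge => jk; rewrite mxE U // mul0r.
Qed.

Lemma dual_zero (p : nat) : (forall k : 'I_n, (k < p)%N -> m k 0 = 0) ->
  forall k : 'I_n, (k < p)%N -> xi k 0 = 0.
Proof.
have [_ D _ _] := redA; move=> m0 k.
have [N] := ubnP (k : nat); elim: N k => // N IH k kN kp.
have := dual_entry k; rewrite m0 // (bigD1 k) //= big1 ?addr0.
  by move/eqP; rewrite mulf_eq0 gt_eqF //= => /eqP.
move=> j /andP[jk]; rewrite -val_eqE /= => jk'.
by rewrite IH ?mulr0 //; lia.
Qed.

Definition sqn : R := \sum_(k < n) xi k 0 ^+ 2.
Definition dual_gap : R := sqn ^+ 2 - \sum_(k < n) xi k 0 ^+ 2 / A k k ^+ 2.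

Lemma dual_gapE : dual_gap = \sum_(k < n) xi k 0 ^+ 2 * (sqn - (A k k ^+ 2)^-1).
Proof.
rewrite /dual_gap expr2 {1}/sqn mulr_suml -sumrB.
by apply: eq_bigr => k _; rewrite mulrBr.
Qed.

(** Let [p] be the first index with [m p 0] nonzero, so that [xi p 0] is [m p 0] divided by [A p p].
    If [|m_p| >= 2], then [sqn] is at least [4 / a_pp^2], which exceeds every [1 / a_kk^2] with
    [k >= p]. If [|m_p| = 1], the gap is a sum over [k != p] whose coefficients are at least [r] as
    soon as [a_kk^2 >= a_pp^2 / 2], whence a gap of at least [r ^+ 2]. *)
Lemma dual_gap_ge0 : (n <= 5)%N -> 0 <= dual_gap /\
  (dual_gap = 0 -> xi = 0 \/ exists p : 'I_n,
     xi p 0 ^+ 2 = (A p p ^+ 2)^-1 /\ forall k, k != p -> xi k 0 = 0).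
Proof.
move=> n5; have [U D B S] := redA.
have D2 k : 0 < A k k ^+ 2 by rewrite exprn_gt0.
have [p0 mp0|m0] := pickP (fun p => m p 0 != 0); last first.
  have x0 (k : 'I_n) : xi k 0 = 0.
    apply: (@dual_zero n) => // j _; apply/eqP; have := m0 j; case: eqP => //.
  split; last by left; apply/colP => k; rewrite x0 mxE.
  by rewrite dual_gapE big1 // => k _; rewrite x0 expr0n mul0r.
case: (@arg_minnP _ p0 (fun p => m p 0 != 0) (fun p : 'I_n => p : nat) mp0).
move=> p mp pmin.
have z (k : 'I_n) : (k < p)%N -> xi k 0 = 0.
  apply: dual_zero => j jp; apply/eqP/negPn/negP => /pmin; lia.
have xp : A p p * xi p 0 = (m p 0)%:~R.
  rewrite -dual_entry (bigD1 p) //= big1 ?addr0 // => j /andP[jp].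
  by rewrite -val_eqE /= => jp'; rewrite z ?mulr0 //; lia.
have xp2 : xi p 0 ^+ 2 = (m p 0)%:~R ^+ 2 / A p p ^+ 2.
  by rewrite -xp exprMn mulrAC divff ?mul1r // gt_eqF.
pose s := (A p p ^+ 2)^-1; have s0 : 0 < s by rewrite invr_gt0.
have sqn_ge : xi p 0 ^+ 2 <= sqn.
  by rewrite /sqn (bigD1 p) //= lerDl sumr_ge0 // => k _; rewrite sqr_ge0.
have termz (k : 'I_n) : (k < p)%N -> xi k 0 ^+ 2 * (sqn - (A k k ^+ 2)^-1) = 0.
  by move=> kp; rewrite z // expr0n mul0r.
have pn := ltn_ord p.
have [m1|m1] := eqVneq `|m p 0%R|%N 1%N; last first.
  have m4 : 4 <= (m p 0)%:~R ^+ 2 :> R.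
    have : (2 <= `|m p 0%R|)%N by move: mp m1; rewrite -absz_gt0; case: absz => [|[|?]].
    rewrite -[leRHS]real_normK ?num_real // -intr_norm -abszE => h.
    have -> : 4 = 2%:R ^+ 2 :> R by ring.
    by rewrite lerXn2r ?nnegrE ?ler0n // ler_nat.
  have L4 : 4 * s <= sqn.
    by apply: le_trans sqn_ge; rewrite xp2 ler_pM2r ?invr_gt0.
  have pos (k : 'I_n) : (p <= k)%N -> 0 < sqn - (A k k ^+ 2)^-1.
    move=> pk; rewrite subr_gt0; apply: lt_le_trans L4.
    rewrite -[ltLHS]mul1r ltr_pdivrMr // mulrAC ltr_pdivlMr // mul1r.
    have [kp|kp] := eqVneq k p; first by rewrite kp; have := D2 p; lra.
    apply: reduced_ratio_quarter; first by move: kp; rewrite -val_eqE /=; lia.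
    by have := ltn_ord k; lia.
  suff : 0 < dual_gap by move=> g0; split; [exact: ltW|move=> g; rewrite g ltxx in g0].
  rewrite dual_gapE (bigD1 p) //= ltr_pwDl //.
    by rewrite mulr_gt0 ?pos // xp2 mulr_gt0 ?invr_gt0 //; lra.
  apply: sumr_ge0 => k _; have [kp|kp] := ltnP k p; first by rewrite termz.
  by rewrite mulr_ge0 ?sqr_ge0 // ltW // pos.
have xps : xi p 0 ^+ 2 = s.
  rewrite xp2 -[X in X / _]real_normK ?num_real // -intr_norm -abszE m1.
  by rewrite expr1n mul1r.
pose r : R := \sum_(k < n | k != p) xi k 0 ^+ 2.
have r0 : 0 <= r by apply: sumr_ge0 => k _; rewrite sqr_ge0.
have sqnE : sqn = s + r by rewrite /sqn (bigD1 p) //= xps.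
(* The term of index [p] equals [s * r] and is distributed over the other indices, which turns
   [sqn = s + r] into [2 * s + r]. *)
have gapE : dual_gap = \sum_(k < n | k != p) xi k 0 ^+ 2 * (2 * s + r - (A k k ^+ 2)^-1).
  rewrite dual_gapE (bigD1 p) //= xps sqnE.
  have -> : s * (s + r - (A p p ^+ 2)^-1) = \sum_(k < n | k != p) xi k 0 ^+ 2 * s.
    by rewrite -mulr_suml -/r -/s; ring.
  by rewrite -big_split; apply: eq_bigr => k _ /=; ring.
suff [g1 g2] : 0 <= dual_gap /\ (dual_gap = 0 -> r = 0).
  split=> // /g2 rz; right; exists p; split=> // k kp.
  have /eqP := rz; rewrite psumr_eq0 => [/allP/(_ k (mem_index_enum _))|j _].
    by rewrite kp /= sqrf_eq0 => /eqP.
  by rewrite sqr_ge0.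
have [small|big] := boolP [forall k : 'I_n, (p < k)%N ==> (A p p ^+ 2 / 2 <= A k k ^+ 2)].
  have h : r ^+ 2 <= dual_gap.
    rewrite expr2 {1}/r gapE mulr_suml; apply: ler_sum => k kp.
    have [kp'|pk] := ltnP k p; first by rewrite z // expr0n !mul0r.
    rewrite ler_wpM2l ?sqr_ge0 //.
    have : (A k k ^+ 2)^-1 <= 2 * s; last by lra.
    have pk' : (p < k)%N by move: kp; rewrite -val_eqE /=; lia.
    have /forallP/(_ k) := small; rewrite pk' /= => h.
    have -> : 2 * s = (A p p ^+ 2 / 2)^-1 by rewrite invf_div.
    by rewrite lef_pV2 ?posrE ?divr_gt0.
  split; first by apply: le_trans h; rewrite sqr_ge0.
  move=> g0; apply/eqP; rewrite -sqrf_eq0; apply/eqP/le_anti.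
  by rewrite sqr_ge0 andbT -g0.
(* Only [k = p + 4] escapes the ratio bound. Then [xi_{p+1}] must compensate:
   [A_{p+1}] corrected by a multiple of [A_p] is a lattice vector orthogonal to
   [xi], and its length being at least [a_pp] bounds [a_{p+1,p+1}] below. *)
have [k pk kbig] : exists2 k : 'I_n, (p < k)%N & A k k ^+ 2 < A p p ^+ 2 / 2.
  move: big; rewrite negb_forall => /existsP[k]; rewrite negb_imply -ltNge.
  by move=> /andP[? ?]; exists k.
have pk4 : (k == p + 4 :> nat)%N.
  have kn := ltn_ord k; rewrite eqn_leq; apply/andP; split; first by lia.
  rewrite leqNgt; apply/negP => kp3.
  have := @reduced_ratio_half p k pk; rewrite -ltnS -addnS => /(_ kp3); lra.
have pqn : (p.+1 < n)%N by have := ltn_ord k; lia.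
pose q : 'I_n := Ordinal pqn.
have qp : q != p by rewrite -val_eqE /=; lia.
have kp : k != p by rewrite -val_eqE /=; lia.
have kq : k != q by rewrite -val_eqE /= (eqP pk4); clear; lia.
have Dq : (A q q ^+ 2)^-1 <= s + xi q 0 ^+ 2.
  pose e : int := m p 0.
  have ee : e%:~R ^+ 2 = 1 :> R.
    by rewrite -[LHS]real_normK ?num_real // -intr_norm -abszE m1 expr1n.
  have xq : A p q * xi p 0 + A q q * xi q 0 = (m q 0)%:~R.
    rewrite -dual_entry (bigD1 p) /=; last by rewrite leqnSn.
    rewrite (bigD1 q) /=; last by rewrite leqnn.
    rewrite big1 ?addr0 // => j /andP[/andP[jq jp] jq'].
    by rewrite z ?mulr0 //; move: jq jp jq'; rewrite -!val_eqE /=; clear; lia.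
  (* As [e = m_p] is 1 or -1, the multiplier [- e m_q] makes the vector orthogonal to [xi]. Its
     entry at [p] becomes [- e a_pp a_qq xi_q], so [a_pp^2 <= a_qq^2 (1 + a_pp^2 xi_q^2)]. *)
  have := @reduced_step p q (- (e * m q 0)) erefl.
  rewrite rmorphN rmorphM /= -xq.
  have -> : - (e%:~R * (A p q * xi p 0 + A q q * xi q 0)) * A p p + A p q =
      A p q * (1 - e%:~R * (A p p * xi p 0)) - e%:~R * (A p p * A q q * xi q 0) by ring.
  rewrite xp -/e -expr2 ee subrr mulr0 sub0r sqrrN exprMn ee mul1r => h.
  have Dpn : A p p != 0 by rewrite gt_eqF.
  have -> : s + xi q 0 ^+ 2 = (1 + A p p ^+ 2 * xi q 0 ^+ 2) / A p p ^+ 2.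
    by rewrite /s; field.
  rewrite ler_pdivlMr // mulrC ler_pdivrMr // mulrDl mul1r.
  by apply: le_trans h _; rewrite !exprMn; lra.
have Dk : (A k k ^+ 2)^-1 <= 2 * s + 2 * xi q 0 ^+ 2.
  have h : A q q ^+ 2 / 2 <= A k k ^+ 2.
    apply: reduced_ratio_half; rewrite (eqP pk4) /=; last by rewrite addSnnS.
    by rewrite -addn1 ltn_add2l.
  have : (A k k ^+ 2)^-1 <= (A q q ^+ 2 / 2)^-1 by rewrite lef_pV2 ?posrE ?divr_gt0.
  by rewrite invf_div; lra.
pose rest : R := \sum_(j < n | (j != p) && (j != q) && (j != k)) xi j 0 ^+ 2.
have rest0 : 0 <= rest by apply: sumr_ge0 => j _; rewrite sqr_ge0.
have rE : r = xi q 0 ^+ 2 + (xi k 0 ^+ 2 + rest).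
  by rewrite /r (bigD1 q) //= (bigD1 k) //= kp kq.
have xq0 := sqr_ge0 (xi q 0); have xk0 := sqr_ge0 (xi k 0).
have restD : rest * r <= \sum_(j < n | (j != p) && (j != q) && (j != k))
    xi j 0 ^+ 2 * (2 * s + r - (A j j ^+ 2)^-1).
  rewrite /rest mulr_suml; apply: ler_sum => j /andP[/andP[jp jq] jk].
  have [jp'|pj] := ltnP j p; first by rewrite z // expr0n !mul0r.
  rewrite ler_wpM2l ?sqr_ge0 //.
  have : (A j j ^+ 2)^-1 <= 2 * s; last by lra.
  have h : A p p ^+ 2 / 2 <= A j j ^+ 2.
    have jn := ltn_ord j.
    apply: reduced_ratio_half; move: jp jq jk pj jn n5 pk4; rewrite -!val_eqE /=;
      clear; lia.
  have -> : 2 * s = (A p p ^+ 2 / 2)^-1 by rewrite invf_div.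
  by rewrite lef_pV2 ?posrE ?divr_gt0.
have gE : dual_gap = xi q 0 ^+ 2 * (2 * s + r - (A q q ^+ 2)^-1) +
    (xi k 0 ^+ 2 * (2 * s + r - (A k k ^+ 2)^-1) +
    \sum_(j < n | (j != p) && (j != q) && (j != k))
    xi j 0 ^+ 2 * (2 * s + r - (A j j ^+ 2)^-1)).
  by rewrite gapE (bigD1 q) //= (bigD1 k) //= kp kq.
exact: (gap_arith s0 xq0 xk0 rest0 rE Dq Dk restD gE).
Qed.

End Dual.

End Reduced.

(** * Reduced bases in triangular form *)

Section KorkineZolotarev.
Context {R : realType} {n : nat} (A : 'M[R]_n).

Definition truncate (i : 'I_n) (v : 'cV[R]_n) : 'cV[R]_n :=
  \col_k (if (k < i)%N then 0 else v k 0).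

Lemma enorm_sqr (m : nat) (v : 'cV[R]_m) : enorm v ^+ 2 = dot v v.
Proof. by rewrite sqr_sqrtr // dot_ge0. Qed.

Lemma enorm_ge0 (m : nat) (v : 'cV[R]_m) : 0 <= enorm v.
Proof. exact: sqrtr_ge0. Qed.

Hypothesis Au : A \in unitmx.
Hypothesis upA : forall i j : 'I_n, (j < i)%N -> A i j = 0.

Lemma upper_diag_neq0 (i : 'I_n) : A i i != 0.
Proof.
have : \det A^T = \prod_(i < n) A^T i i.
  apply: det_trig; apply/is_trig_mxP => k l kl; rewrite mxE; exact: upA.
rewrite det_tr => dA; move: Au; rewrite unitmxE dA unitfE => /prodf_neq0/(_ i isT).
by rewrite mxE.
Qed.

Lemma upper_solve_zero (c : 'cV[R]_n) (i : nat) :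
  (forall k : 'I_n, (i <= k)%N -> (A *m c) k 0 = 0) ->
  forall k : 'I_n, (i <= k)%N -> c k 0 = 0.
Proof.
move=> Ac k; have [N] := ubnP (n - k); elim: N k => // N IH k kN ik.
have := Ac k ik; rewrite mxE (bigD1 k) //= big1 ?addr0.
  by move/eqP; rewrite mulf_eq0 (negbTE (upper_diag_neq0 k)) /= => /eqP.
move=> j; rewrite -val_eqE /= => jk.
have [kj|jk'] := ltnP j k; first by rewrite upA // mul0r.
have kj : (k < j)%N by rewrite ltn_neqAle eq_sym jk.
by rewrite IH ?mulr0 //; have := ltn_ord j; lia.
Qed.

(** By definiteness of [dot], a row space meets its orthogonal complement trivially; [proj_mx] is
    then the projection one expects. *)
Lemma kermx_cap0 (B : 'M[R]_n) : (kermx B^T :&: B)%MS = 0.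
Proof.
apply/eqP; rewrite -submx0; apply/row_subP => i.
set x := row i _; have xK : (x <= kermx B^T :&: B)%MS by exact: row_sub.
move: xK; rewrite sub_capmx => /andP[/sub_kermxP xB /submxP[y xy]].
have : dot x^T x^T = 0.
  have -> : dot x^T x^T = (x *m x^T) 0 0.
    by rewrite mxE; apply: eq_bigr => k _; rewrite !mxE.
  by rewrite {2}xy trmx_mul mulmxA xB mul0mx mxE.
by move/eqP; rewrite dot_eq0 => /eqP/(congr1 trmx); rewrite trmxK trmx0 => ->; exact: sub0mx.
Qed.

(** The first [i] columns of an invertible upper triangular matrix span the first [i] coordinate
    axes. Hence [v] splits into [truncate i v], orthogonal to them, and a remainder in their
    span. *)
Lemma perp_projE (i : 'I_n) (v : 'cV[R]_n) : perp_proj A i v = truncate i v.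
Proof.
rewrite /perp_proj; set B := span_before A i.
have cap0 := kermx_cap0 B.
pose u := v - truncate i v.
have wK : ((truncate i v)^T <= kermx B^T)%MS.
  apply/sub_kermxP/rowP => k; rewrite !mxE big1 // => l _; rewrite !mxE.
  case: (ltnP l i) => [li|il]; first by rewrite mul0r.
  by case: (ltnP k i) => ki; rewrite ?mulr0 // upA ?mulr0 // (leq_trans ki).
have uB : (u^T <= B)%MS.
  apply/submxP; exists (invmx A *m u)^T; apply/rowP => l.
  have c0 : forall k : 'I_n, (i <= k)%N -> (invmx A *m u) k 0 = 0.
    apply: upper_solve_zero => k ik; rewrite mulKVmx // !mxE.
    by rewrite ltnNge ik /= subrr.
  rewrite mxE -[u in LHS](mulKVmx Au) [LHS]mxE [RHS]mxE.
  apply: eq_bigr => k _; rewrite [in RHS]mxE [B k l]mxE.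
  case: (ltnP k i) => ki; first by rewrite mulrC.
  by rewrite c0 // !mulr0 ?mul0r.
have vE : v^T = (truncate i v)^T + u^T by rewrite -linearD /= addrC subrK.
by rewrite vE mulmxDl proj_mx_id // proj_mx_0 // addr0 trmxK.
Qed.

Lemma dot_truncate (i : 'I_n) (v : 'cV[R]_n) :
  dot (truncate i v) (truncate i v) = \sum_(k < n | (i <= k)%N) v k 0 ^+ 2.
Proof.
rewrite /dot [RHS]big_mkcond; apply: eq_bigr => k _; rewrite !mxE ltnNge.
by case: leqP => _ /=; rewrite ?mul0r // expr2.
Qed.

Lemma col_perpE (i : 'I_n) : col_perp A i = A i i *: delta_mx i 0.
Proof.
rewrite /col_perp perp_projE; apply/colP => k; rewrite !mxE andbT.
have [->|ki] := eqVneq k i; first by rewrite ltnn mulr1.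
rewrite mulr0; case: ltnP => // ik; rewrite upA //.
by rewrite ltn_neqAle eq_sym ik andbT.
Qed.

Lemma truncate0 (i : 'I_n) v : i = 0%N :> nat -> truncate i v = v.
Proof. by move=> i0; apply/colP => k; rewrite mxE i0. Qed.

End KorkineZolotarev.

Lemma kz_reduced_upper (R : realType) (n : nat) (A : 'M[R]_n) :
  korkine_zolotarev A -> kz_normalized A -> reduced_upper A.
Proof.
move=> [Au size short0 short] [/is_trig_mxP trig norm0 norm].
have upA (i j : 'I_n) : (j < i)%N -> A i j = 0.
  by move=> ji; have := trig j i ji; rewrite mxE.
have D i : 0 < A i i.
  have [i0|i0] := posnP i; first by have [-> ->] := norm0 i i0.
  by have [-> ] := norm i i0.
split=> // [i j ij|p z [i pi zi]].
  have := size i j ij; rewrite (col_perpE Au upA) enorm_sqr dotZr dot_delta.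
  rewrite dotZl dotZr dot_delta !mxE !eqxx mulr1 normrM (gtr0_norm (D i)).
  by move=> h; rewrite -(ler_pM2l (D i)); lra.
rewrite -(dot_truncate p) -enorm_sqr.
have w0 : truncate p (A *m map_mx intr z) != 0.
  apply: contraNneq zi => /colP/(_ i); rewrite [LHS]mxE ltnNge pi /= => ->.
  by rewrite mxE.
have AzL : lattice A (A *m map_mx intr z) by apply/asboolP; exists z.
have le : A p p <= enorm (truncate p (A *m map_mx intr z)).
  have [p0|p0] := posnP p.
    have [-> _] := norm0 p p0; have [_ _] := short0 p p0; apply => //=.
    by rewrite truncate0.
  have [-> _] := norm p p0; have [_ _] := short p p0; apply => //=.
  exists (A *m map_mx intr z) => //.
  exact: perp_projE.
by rewrite lerXn2r ?nnegrE ?enorm_ge0 // ltW.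
Qed.

(** * Geometry of flat isometric immersions *)

Section Lift.
Context {R : realType} {n N : nat} (A : 'M[R]_n) (f : torus A -> 'cV[R]_N).
Hypothesis Au : A \in unitmx.
Notation F := (periodic_lift f).

Lemma lift_periodic : torus_periodic A F.
Proof.
move=> x z; rewrite /periodic_lift; congr f; apply/eqP.
rewrite -ring_quotient.Quotient.idealrBE addrAC subrr add0r.
by apply/asboolP; exists z.
Qed.

Definition coordf (k : 'I_N) (x : 'cV[R]_n) : R := F x k 0.

Lemma partial_periodic i (G : 'cV[R]_n -> 'cV[R]_N) :
  torus_periodic A G -> torus_periodic A (partial i G).
Proof.
move=> pG x z; set a := A *m _; set v : 'cV[R]_n := delta_mx i 0.
have Q : (fun h : R => h^-1 *: (G (h *: v + (x + a)) - G (x + a))) =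
         (fun h : R => h^-1 *: (G (h *: v + x) - G x)).
  by apply/funext => h; rewrite addrA !pG.
exact: (congr1 (fun q : R -> 'cV[R]_N => lim (q @ 0^')) Q).
Qed.

Hypothesis sF : smooth F.

Lemma coordf_partial (s : seq 'I_n) (k : 'I_N) x :
  (foldr (fun i G => partial i G) F s x) k 0 = foldr pd (coordf k) s x.
Proof.
elim: s x => [|i s IH] x //=; rewrite /partial derive_mx; last first.
  exact/diff_derivable/sF.
by rewrite mxE pdE; congr ('D_(_) _ x); apply/funext => y; exact: IH.
Qed.

Lemma coordf_smooth k : torus_smooth A (coordf k).
Proof.
move=> s.
have E : foldr pd (coordf k) s = fun x => (foldr (fun i G => partial i G) F s x) k 0.
  by apply/funext => x; rewrite coordf_partial.
rewrite E; split; first split.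
- move=> x; have c := differentiable_continuous (sF s x).
  exact: (continuous_comp c (@coord_continuous _ _ _ k 0 _)).
- move=> x z; congr (fun_of_matrix _ k 0); move: x z.
  by elim: s {E} => [|i s IH]; [exact: lift_periodic|exact: partial_periodic].
- move=> i x; have /derivable_mxP := diff_derivable (v := delta_mx i 0) (sF s x).
  exact.
Qed.

Lemma partial_coordf i x k : partial i F x k 0 = pd i (coordf k) x.
Proof. exact: (coordf_partial [:: i]). Qed.

Lemma partial2_coordf i j x k :
  partial i (partial j F) x k 0 = pd i (pd j (coordf k)) x.
Proof. exact: (coordf_partial [:: i; j]). Qed.

Lemma pd_sum_prod (phi psi : 'I_N -> 'cV[R]_n -> R) (c : R) i x :
  (forall k, torus_smooth A (phi k)) -> (forall k, torus_smooth A (psi k)) ->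
  (forall x, \sum_k phi k x * psi k x = c) ->
  \sum_k (pd i (phi k) x * psi k x + phi k x * pd i (psi k) x) = 0.
Proof.
move=> sphi spsi cst.
have D k : is_derive x (delta_mx i 0) (fun x => phi k x * psi k x)
    (pd i (phi k) x * psi k x + phi k x * pd i (psi k) x).
  have d1 : is_derive x (delta_mx i 0) (phi k) (pd i (phi k) x).
    by apply: is_derive_pd; exact: torus_smooth_derivable (sphi k) x.
  have d2 : is_derive x (delta_mx i 0) (psi k) (pd i (psi k) x).
    by apply: is_derive_pd; exact: torus_smooth_derivable (spsi k) x.
  have h := is_deriveM d1 d2; apply: is_derive_eq h _.
  by rewrite /GRing.scale /=; ring.
have dS := is_derive_sum D.
have E : \sum_k (fun x => phi k x * psi k x) = fun=> c.
  by apply/funext => y; rewrite fct_sumE cst.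
move: dS; rewrite E => -[_ <-].
exact: derive_cst.
Qed.

Hypothesis iso : forall x, induced_metric F x = 1%:M.

Lemma metric_coordf i j x :
  \sum_k pd i (coordf k) x * pd j (coordf k) x = (i == j)%:R.
Proof.
have /matrixP/(_ i j) := iso x; rewrite !mxE => <-.
by apply: eq_bigr => k _; rewrite !partial_coordf.
Qed.

Definition christoffel i j l x :=
  \sum_k pd i (pd j (coordf k)) x * pd l (coordf k) x.

(** The symbol is symmetric in its first two indices, as second derivatives commute, and
    antisymmetric in the last two, as the metric is constant; alternating the two symmetries shows
    it is its own opposite. *)
Lemma christoffel_eq0 i j l x : christoffel i j l x = 0.
Proof.
have s1 i k := torus_smooth_pd i (coordf_smooth k).
have anti a b c : christoffel a b c x = - christoffel a c b x.
  apply/eqP; rewrite -addr_eq0; apply/eqP.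
  have := pd_sum_prod a x (s1 b) (s1 c) (metric_coordf b c).
  rewrite big_split /= => <-; congr (_ + _).
  by apply: eq_bigr => k _; rewrite mulrC.
have sym a b c : christoffel a b c x = christoffel b a c x.
  by apply: eq_bigr => k _; rewrite (pdC Au _ _ _ (coordf_smooth k)).
have : christoffel i j l x = - christoffel i j l x.
  rewrite {1}anti sym anti opprK sym anti sym.
  by [].
by move=> h; lra.
Qed.

(** Differentiating [<F_ii, F_j> = 0] along j and [<F_ij, F_j> = 0] along i produces the same
    third-order term [<F_iij, F_j>]; comparing the two identities eliminates it. *)
Lemma gauss_equation i j x :
  \sum_k pd i (pd j (coordf k)) x ^+ 2 =
  \sum_k pd i (pd i (coordf k)) x * pd j (pd j (coordf k)) x.
Proof.
have s1 i k := torus_smooth_pd i (coordf_smooth k).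
have s2 i j k := torus_smooth_pd i (torus_smooth_pd j (coordf_smooth k)).
have e1 := pd_sum_prod j x (s2 i i) (s1 j) (christoffel_eq0 i i j).
have e2 := pd_sum_prod i x (s2 i j) (s1 j) (christoffel_eq0 i j j).
pose T (a b : 'I_n) := \sum_k pd i (pd a (pd b (coordf k))) x * pd j (coordf k) x.
pose S := \sum_k pd i (pd i (coordf k)) x * pd j (pd j (coordf k)) x.
have h2 : T i j + \sum_k pd i (pd j (coordf k)) x ^+ 2 = 0.
  rewrite -big_split -[RHS]e2; apply: eq_bigr => k _ /=.
  by rewrite expr2.
have h1 : T i j + S = 0.
  rewrite -big_split -[RHS]e1; apply: eq_bigr => k _ /=.
  congr (_ * _ + _).
  apply/esym/(etrans (pdC Au j i x (s1 i k))).
  congr (pd _ _ x); apply/funext => y.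
  exact: (pdC Au j i y (coordf_smooth k)).
by apply: (addrI (T i j)); rewrite h2 -/S h1.
Qed.

Definition lap_sqn x : R := \sum_k lap (coordf k) x ^+ 2.

Lemma lap_sqnE x : lap_sqn x = \sum_i \sum_j \sum_k pd i (pd j (coordf k)) x ^+ 2.
Proof.
under eq_bigr => i _ do under eq_bigr => j _ do rewrite gauss_equation.
transitivity (\sum_k \sum_i \sum_j
    pd i (pd i (coordf k)) x * pd j (pd j (coordf k)) x).
  apply: eq_bigr => k _; rewrite /lap expr2 mulr_suml.
  by apply: eq_bigr => i _; rewrite mulr_sumr.
by rewrite exchange_big; apply: eq_bigr => i _; rewrite exchange_big.
Qed.

(** The tangential components of the second derivatives are Christoffel symbols, hence zero. *)
Lemma second_formE x i j : second_form F x i j = partial i (partial j F) x.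
Proof.
rewrite /second_form iso invmx1 big1 ?subr0 // => k _; rewrite big1 // => l _.
have -> : dot (partial i (partial j F) x) (partial k F x) = 0.
  rewrite -(christoffel_eq0 i j k x); apply: eq_bigr => c _.
  by rewrite partial2_coordf partial_coordf.
by rewrite mulr0 scale0r.
Qed.

Lemma second_form_sqnormE x : second_form_sqnorm F x = lap_sqn x.
Proof.
rewrite lap_sqnE /second_form_sqnorm iso invmx1.
apply: eq_bigr => i _; apply: eq_bigr => j _.
rewrite (bigD1 i) //= [X in _ + X]big1 ?addr0 => [|k ki]; last first.
  by rewrite big1 // => l _; rewrite mxE eq_sym (negbTE ki) !mul0r.
rewrite (bigD1 j) //= big1 ?addr0 => [|l lj]; last first.
  by rewrite !mxE [j == l]eq_sym (negbTE lj) mulr0 mul0r.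
rewrite !mxE !eqxx !mul1r; apply: eq_bigr => k _.
by rewrite second_formE partial2_coordf expr2.
Qed.

Lemma mean_curvatureE x k : (mean_curvature F x) k 0 = n%:R^-1 * lap (coordf k) x.
Proof.
rewrite /mean_curvature iso invmx1 mxE summxE; congr (_ * _).
apply: eq_bigr => i _; rewrite summxE (bigD1 i) //= big1 ?addr0 => [|j ji].
  by rewrite second_formE mxE [1%:M _ _]mxE eqxx mul1r partial2_coordf.
by rewrite mxE [1%:M _ _]mxE eq_sym (negbTE ji) mul0r.
Qed.

Lemma lap_sqn_ge0 x : 0 <= lap_sqn x.
Proof. by apply: sumr_ge0 => k _; rewrite sqr_ge0. Qed.

Lemma torus_lap_sqn : torus_cont A lap_sqn.
Proof.
apply: torus_sum => k _; under eq_fun do rewrite expr2.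
by apply: torusM; exact: torus_lap (coordf_smooth k).
Qed.

Lemma torus_lap_sqn_pow : torus_cont A (fun x => lap_sqn x `^ (n%:R / 2)).
Proof.
have E : (fun x => lap_sqn x `^ (n%:R / 2)) = fun x => (Num.sqrt (lap_sqn x)) ^+ n.
  apply/funext => x; rewrite mulrC powRrM powR12_sqrt ?lap_sqn_ge0 //.
  by rewrite powR_mulrn ?sqrtr_ge0.
rewrite E; apply: (torus_comp (h := fun y : R => Num.sqrt y ^+ n)) torus_lap_sqn => y.
exact: (continuous_comp (@sqrt_continuous R y) (@exprn_continuous R n _)).
Qed.

(** Since [n H] is the Laplacian of the immersion, [S - n |H|^2] is [(n - 1) / n] times [|Lap F|^2],
    and the prefactor of the energy cancels this constant. *)
Lemma willmoreE : (2 <= n)%N ->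
  willmore f = `|\det A| * mean A (fun x => lap_sqn x `^ (n%:R / 2)).
Proof.
move=> n2; have n0 : n%:R != 0 :> R by rewrite pnatr_eq0; lia.
have n1 : 0 < n%:R - 1 :> R by rewrite subr_gt0 ltr1n.
have np : 0 < n%:R :> R by rewrite ltr0n; lia.
pose integrand x :=
  (second_form_sqnorm F x - n%:R * enorm (mean_curvature F x) ^+ 2) `^ (n%:R / 2) *
  Num.sqrt (\det (induced_metric F x)).
have -> : willmore f =
    (n%:R / (n%:R - 1)) `^ (n%:R / 2) * (`|\det A| * mean A integrand) by [].
rewrite mulrCA; congr (_ * _).
pose c : R := (n%:R - 1) / n%:R.
have c0 : 0 < c by rewrite divr_gt0.
have -> : integrand =
    (fun x => c `^ (n%:R / 2) * lap_sqn x `^ (n%:R / 2)).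
  apply/funext => x; rewrite /integrand iso det1 sqrtr1 mulr1.
  rewrite -powRM ?lap_sqn_ge0 ?ltW //; congr (_ `^ _).
  rewrite second_form_sqnormE enorm_sqr.
  have -> : dot (mean_curvature F x) (mean_curvature F x) = n%:R^-1 ^+ 2 * lap_sqn x.
    rewrite /dot mulr_sumr; apply: eq_bigr => k _.
    by rewrite !mean_curvatureE; ring.
  by rewrite /c; field.
have tQ := torus_lap_sqn_pow.
rewrite meanZ // mulrA -powRM ?divr_ge0 ?(ltW np) ?(ltW n1) //.
have -> : n%:R / (n%:R - 1) * c = 1 by rewrite /c; field; rewrite n0 gt_eqF.
by rewrite powR1 mul1r.
Qed.

End Lift.

(** * The energy bound *)

Section Deficit.
Context {R : realType} {n : nat} (A : 'M[R]_n).
Hypothesis Au : A \in unitmx.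

(** The share of one coordinate function in the mean of [|Lap F|^2] minus [mu_bound]. *)
Definition energy_deficit (phi : 'cV[R]_n -> R) : R :=
  mean A (fun x => lap phi x ^+ 2) -
  4 * pi ^+ 2 * \sum_i (A i i ^+ 2)^-1 * mean A (fun x => pd i phi x ^+ 2).

Lemma energy_deficit_cvg phi : torus_smooth A phi ->
  favg K (fun m => 16 * pi ^+ 4 * dual_gap A (freq A m) * fpow A phi m) @[K --> \oo]
  --> energy_deficit phi.
Proof.
move=> sphi.
have h1 := parseval Au (torus_lap sphi).
have h2 i := parseval Au (torus_smooth_cont (torus_smooth_pd i sphi)).
have h3 : \sum_i ((A i i ^+ 2)^-1 * favg K (fpow A (pd i phi))) @[K --> \oo] -->
    \sum_i (A i i ^+ 2)^-1 * mean A (fun x => pd i phi x ^+ 2).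
  by apply: cvgr_sum => i; exact: (cvgM (cvg_cst _) (h2 i)).
suff -> : (fun K => favg K (fun m => 16 * pi ^+ 4 * dual_gap A (freq A m) * fpow A phi m)) =
    (fun K => favg K (fpow A (lap phi)) - 4 * pi ^+ 2 *
  \sum_i ((A i i ^+ 2)^-1 * favg K (fpow A (pd i phi)))).
  exact: (cvgB h1 (cvgM (cvg_cst (4 * pi ^+ 2)) h3)).
apply/funext => K; apply/esym.
under eq_bigr do rewrite -favgZ.
rewrite -favg_sum -favgZ -mulN1r -favgZ -favgD; congr favg; apply/funext => m.
rewrite fpow_lap // /dual_gap.
under eq_bigr do rewrite fpow_pd //.
have -> : \sum_i (A i i ^+ 2)^-1 * (4 * pi ^+ 2 * freq A m i 0 ^+ 2 * fpow A phi m) =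
   4 * pi ^+ 2 * fpow A phi m * \sum_i freq A m i 0 ^+ 2 / A i i ^+ 2.
  by rewrite mulr_sumr; apply: eq_bigr => i _; ring.
have -> : dot (freq A m) (freq A m) = sqn (freq A m).
  by apply: eq_bigr => i _; rewrite expr2.
ring.
Qed.

(** All terms of the Fejer sums are nonnegative, so each sum is at least the weighted term of index
    [m], and that weight tends to 1. Nonnegativity of the deficit and its rigidity both come from
    here. *)
Lemma energy_deficit_ge phi m : reduced_upper A -> (n <= 5)%N -> torus_smooth A phi ->
  0 <= 16 * pi ^+ 4 * dual_gap A (freq A m) * fpow A phi m <= energy_deficit phi.
Proof.
move=> redA n5 sphi.
have T0 d : 0 <= 16 * pi ^+ 4 * dual_gap A (freq A d) * fpow A phi d.
  rewrite mulr_ge0 ?fpow_ge0 // mulr_ge0 ?mulr_ge0 ?exprn_ge0 ?pi_ge0 //.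
  by have [] := dual_gap_ge0 redA (freqP Au d) n5.
rewrite T0 /=.
pose c := 16 * pi ^+ 4 * dual_gap A (freq A m) * fpow A phi m.
have h : c * favg K (fun d => (d == m)%:R) @[K --> \oo] --> c.
  by have /(_ _) := cvgM (cvg_cst c) (favg_eq_cvg m); rewrite mulr1; apply.
apply: (@ler_cvg_to nat \oo _ R _ _ c _ h (energy_deficit_cvg sphi)).
by apply: nearW => K; exact: (favg_ge_term K m T0).
Qed.

End Deficit.

(** The constant [c] is the slope of [y^(n/2)] at [mu]. In terms of the square roots [Y] and [M] of
    [y] and [mu], the difference is a polynomial: zero for [n = 2], and otherwise [(Y - M)^2] times
    a factor nonnegative for [Y, M >= 0]. *)
Lemma tangent_ineq (R : realType) (n : nat) (mu : R) : (2 <= n <= 5)%N ->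
  0 < mu -> exists2 c : R, 0 < c &
  forall y, 0 <= y -> mu `^ (n%:R / 2) + c * (y - mu) <= y `^ (n%:R / 2).
Proof.
move=> n25 mu0; pose M := Num.sqrt mu.
have M0 : 0 < M by rewrite sqrtr_gt0.
have Mmu : mu = M ^+ 2 by rewrite sqr_sqrtr // ltW.
have pE (y : R) : 0 <= y -> y `^ (n%:R / 2) = Num.sqrt y ^+ n.
  by move=> y0; rewrite mulrC powRrM powR12_sqrt // powR_mulrn ?sqrtr_ge0.
exists (n%:R / 2 * M ^+ (n - 2)).
  rewrite mulr_gt0 ?exprn_gt0 // divr_gt0 // ltr0n.
  by case/andP: n25 => h _; apply: leq_trans h.
move=> y y0; rewrite !pE ?(ltW mu0) // -/M.
have -> : y - mu = Num.sqrt y ^+ 2 - M ^+ 2 by rewrite sqr_sqrtr // Mmu.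
have Y0 := sqrtr_ge0 y; move: (Num.sqrt y) Y0 => Y Y0.
have {y0 pE Mmu mu0 y} M0' := ltW M0.
rewrite -subr_ge0.
have [n2|n3|n4|n5] : [\/ n = 2%N, n = 3%N, n = 4%N | n = 5%N].
  by case: n n25 => [|[|[|[|[|[|?]]]]]] //= _; [constructor 1|constructor 2|constructor 3|constructor 4].
- rewrite n2 /= expr0.
  by have -> : Y ^+ 2 - (M ^+ 2 + 2 / 2 * 1 * (Y ^+ 2 - M ^+ 2)) = 0 by field.
- rewrite n3 /= expr1.
  have -> : Y ^+ 3 - (M ^+ 3 + 3 / 2 * M * (Y ^+ 2 - M ^+ 2)) =
    (Y - M) ^+ 2 * (2 * Y + M) / 2 by field.
  by rewrite divr_ge0 // mulr_ge0 ?sqr_ge0 // addr_ge0 // mulr_ge0.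
- rewrite n4 /=.
  have -> : Y ^+ 4 - (M ^+ 4 + 4 / 2 * M ^+ 2 * (Y ^+ 2 - M ^+ 2)) =
    (Y ^+ 2 - M ^+ 2) ^+ 2 by field.
  by rewrite sqr_ge0.
- rewrite n5 /=.
  have -> : Y ^+ 5 - (M ^+ 5 + 5 / 2 * M ^+ 3 * (Y ^+ 2 - M ^+ 2)) =
    (Y - M) ^+ 2 * (2 * Y ^+ 3 + 4 * Y ^+ 2 * M + 6 * Y * M ^+ 2 + 3 * M ^+ 3) / 2.
    by field.
  by rewrite divr_ge0 // mulr_ge0 ?sqr_ge0 // !addr_ge0 // !mulr_ge0 // ?exprn_ge0.
Qed.

Section WillmoreBound.
Context {R : realType} {n N : nat} (A : 'M[R]_n) (f : torus A -> 'cV[R]_N).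
Hypothesis n25 : (2 <= n <= 5)%N.
Hypothesis Au : A \in unitmx.
Hypothesis redA : reduced_upper A.
Hypothesis sF : smooth (periodic_lift f).
Hypothesis iso : forall x, induced_metric (periodic_lift f) x = 1%:M.

(** The constant value of [|Lap F|^2] on the extremal immersions, by [trig_lap_sqn]. *)
Definition mu_bound : R := 4 * pi ^+ 2 * \sum_i (A i i ^+ 2)^-1.

Lemma mu_bound_gt0 : 0 < mu_bound.
Proof.
have [_ D _ _] := redA; have n0 : (0 < n)%N by case/andP: n25 => h _; exact: leq_trans h.
rewrite mulr_gt0 ?mulr_gt0 ?exprn_gt0 ?pi_gt0 // (bigD1 (Ordinal n0)) //=.
rewrite ltr_pwDl ?invr_gt0 ?exprn_gt0 // sumr_ge0 // => i _.
by rewrite invr_ge0 exprn_ge0 // ltW.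
Qed.

Lemma det_upper : `|\det A| = \prod_(i < n) A i i.
Proof.
have [U D _ _] := redA.
have -> : \det A = \prod_(i < n) A i i.
  rewrite -det_tr det_trig; last by apply/is_trig_mxP => i j ij; rewrite mxE U.
  by apply: eq_bigr => i _; rewrite mxE.
by rewrite ger0_norm // prodr_ge0 // => i _; exact: ltW.
Qed.

Lemma boundE : (2 * pi) ^+ n * (\prod_(i < n) A i i) *
    (\sum_(i < n) (A i i ^+ 2)^-1) `^ (n%:R / 2) =
  `|\det A| * mu_bound `^ (n%:R / 2).
Proof.
have S0 : 0 <= \sum_(i < n) (A i i ^+ 2)^-1.
  by apply: sumr_ge0 => i _; rewrite invr_ge0 sqr_ge0.
have p0 : 0 <= 4 * pi ^+ 2 :> R by rewrite mulr_ge0 ?sqr_ge0.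
have E : (4 * pi ^+ 2) `^ (n%:R / 2) = (2 * pi) ^+ n :> R.
  have -> : 4 * pi ^+ 2 = (2 * pi) ^+ 2 :> R by ring.
  rewrite -(powR_mulrn 2) ?mulr_ge0 ?pi_ge0 // -powRrM.
  have -> : 2 * (n%:R / 2) = n%:R :> R by field.
  by rewrite powR_mulrn // mulr_ge0 ?pi_ge0.
by rewrite det_upper /mu_bound powRM // E; ring.
Qed.

Let sk := coordf_smooth sF.

Lemma mean_pd_sqn i : \sum_k mean A (fun x => pd i (coordf f k) x ^+ 2) = 1.
Proof.
have t k : torus_cont A (fun x => pd i (coordf f k) x ^+ 2).
  have tk := torus_smooth_cont (torus_smooth_pd i (sk k)).
  by under eq_fun do rewrite expr2; exact: torusM.
rewrite -mean_sum // -[RHS](mean_cst A); congr mean; apply/funext => x.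
have m := metric_coordf sF iso i i x; rewrite eqxx in m; apply: etrans m.
by apply: eq_bigr => k _; rewrite expr2.
Qed.

Lemma sum_energy_deficit :
  \sum_k energy_deficit A (coordf f k) = mean A (lap_sqn f) - mu_bound.
Proof.
have t k : torus_cont A (fun x => lap (coordf f k) x ^+ 2).
  by under eq_fun do rewrite expr2; apply: torusM; exact: torus_lap (sk k).
rewrite sumrB -mean_sum //; congr (_ - _).
rewrite -mulr_sumr /mu_bound; congr (_ * _); rewrite exchange_big /=.
by apply: eq_bigr => i _; rewrite -mulr_sumr mean_pd_sqn mulr1.
Qed.

(** The tangent inequality averaged over the torus. A positive [c] matters for rigidity: equality of
    the energies then bounds the deficit above by 0. *)
Lemma willmore_deficit : exists2 c : R, 0 < c &
  `|\det A| * mu_bound `^ (n%:R / 2) + c * (mean A (lap_sqn f) - mu_bound)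
  <= willmore f.
Proof.
have [c c0 cP] := tangent_ineq n25 mu_bound_gt0.
have d0 : 0 < `|\det A| by rewrite normr_gt0 -unitfE -unitmxE.
exists (`|\det A| * c); first by rewrite mulr_gt0.
have n2 : (2 <= n)%N by case/andP: n25.
rewrite (willmoreE Au sF iso n2) -mulrA -mulrDr ler_pM2l //.
have tQ := torus_lap_sqn sF.
have tB : torus_cont A (fun x => lap_sqn f x - mu_bound).
  by apply: torusB => //; exact: torus_cst.
have tT : torus_cont A (fun x => mu_bound `^ (n%:R / 2) + c * (lap_sqn f x - mu_bound)).
  by apply: torusD; [exact: torus_cst|exact: torusZ].
have -> : mu_bound `^ (n%:R / 2) + c * (mean A (lap_sqn f) - mu_bound) =
    mean A (fun x => mu_bound `^ (n%:R / 2) + c * (lap_sqn f x - mu_bound)).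
  have tc := @torus_cst R n A; have tZ := torusZ c tB.
  by rewrite (meanD Au (tc _) tZ) (meanZ Au c tB) (meanB Au tQ (tc _)) !mean_cst.
apply: mean_le => //; first exact: torus_lap_sqn_pow sF.
by move=> x; apply: cP; exact: lap_sqn_ge0.
Qed.

Lemma deficit_ge0 k : 0 <= energy_deficit A (coordf f k).
Proof.
have n5 : (n <= 5)%N by case/andP: n25.
by have /andP[] := energy_deficit_ge Au 0 redA n5 (sk k); exact: le_trans.
Qed.

Lemma willmore_ge : `|\det A| * mu_bound `^ (n%:R / 2) <= willmore f.
Proof.
have [c c0] := willmore_deficit; apply: le_trans; rewrite lerDl.
rewrite mulr_ge0 ?(ltW c0) // -sum_energy_deficit sumr_ge0 // => k _.
exact: deficit_ge0.
Qed.

Lemma willmore_eq_gap : willmore f = `|\det A| * mu_bound `^ (n%:R / 2) ->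
  forall k m, dual_gap A (freq A m) = 0 \/ fpow A (coordf f k) m = 0.
Proof.
move=> weq k m; have [c c0] := willmore_deficit.
rewrite weq gerDl pmulr_rle0 // -sum_energy_deficit => le0.
have n5 : (n <= 5)%N by case/andP: n25.
have : \sum_k energy_deficit A (coordf f k) == 0.
  by rewrite eq_le le0 sumr_ge0 // => j _; exact: deficit_ge0.
rewrite psumr_eq0 => [/allP/(_ k (mem_index_enum _))/= /eqP dk|j _]; last first.
  exact: deficit_ge0.
have := energy_deficit_ge Au m redA n5 (sk k); rewrite dk -eq_le eq_sym.
have p0 : 0 < 16 * pi ^+ 4 :> R by rewrite mulr_gt0 // exprn_gt0 // pi_gt0.
by rewrite -mulrA mulf_eq0 (gt_eqF p0) /= mulf_eq0 => /orP[/eqP ->|/eqP ->]; [left|right].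
Qed.

End WillmoreBound.

(** * The equality case: diagonality and Fourier support *)

Section Support.
Context {R : realType} {n : nat} (A : 'M[R]_n).
Hypothesis Au : A \in unitmx.
Hypothesis dA : is_diag_mx A.
Implicit Types (phi : 'cV[R]_n -> R).

Lemma diag_mulmx (x : 'cV[R]_n) j : (A^T *m x) j 0 = A j j * x j 0.
Proof.
rewrite mxE (bigD1 j) //= mxE big1 ?addr0 // => k kj; rewrite mxE.
by move/is_diag_mxP: dA => ->; rewrite ?mul0r.
Qed.

Lemma diag_neq0 p : A p p != 0.
Proof.
apply: (upper_diag_neq0 Au) => i j ji; move/is_diag_mxP: dA => -> //.
by rewrite gtn_eqF.
Qed.

Lemma freq_entry m j : A j j * freq A m j 0 = (m j 0)%:~R.
Proof. by rewrite -diag_mulmx freqP // mxE. Qed.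

Lemma freq_delta p : freq A (delta_mx p 0) = (A p p)^-1 *: delta_mx p 0.
Proof.
apply/colP => j; apply: (mulfI (diag_neq0 j)); rewrite freq_entry !mxE andbT.
have [->|jp] := eqVneq j p; last by rewrite mulr0 mulr0.
by rewrite mulr1 divff // diag_neq0.
Qed.

Lemma cosf_delta p x : cosf A (delta_mx p 0) x = cos (2 * pi * x p 0 / A p p).
Proof.
rewrite /cosf freq_delta dotZl dotC dot_delta; congr cos.
by rewrite [in RHS]mulrC mulrCA.
Qed.

Lemma sinf_delta p x : sinf A (delta_mx p 0) x = sin (2 * pi * x p 0 / A p p).
Proof.
rewrite /sinf freq_delta dotZl dotC dot_delta; congr sin.
by rewrite [in RHS]mulrC mulrCA.
Qed.

(** For diagonal [A], the integer coordinates of 0 and of the dual vectors [e_p / a_pp] and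
    [- e_p / a_pp]. *)
Definition axis_freqs : seq 'cV[int]_n :=
  0 :: [seq delta_mx p 0 | p <- index_enum 'I_n] ++ [seq - delta_mx p 0 | p <- index_enum 'I_n].

Lemma axis_freqs_uniq : uniq axis_freqs.
Proof.
have dd (p q : 'I_n) : (delta_mx p 0 : 'cV[int]_n) q 0 = (q == p)%:R.
  by rewrite mxE andbT.
have inj : injective (fun p : 'I_n => delta_mx p 0 : 'cV[int]_n).
  move=> p q /colP/(_ p); rewrite !dd eqxx => /esym/eqP.
  by case: (p =P q).
have injN : injective (fun p : 'I_n => - delta_mx p 0 : 'cV[int]_n).
  by move=> p q /oppr_inj/inj.
rewrite /axis_freqs cons_uniq cat_uniq (map_inj_uniq inj) (map_inj_uniq injN).
rewrite !index_enum_uniq andbT /= .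
rewrite mem_cat negb_or; apply/andP; split; first (apply/andP; split).
- apply/mapP => -[p _ /colP/(_ p)]; rewrite dd mxE eqxx => /eqP.
  by rewrite eq_sym oner_eq0.
- apply/mapP => -[p _ /colP/(_ p)]; rewrite mxE [RHS]mxE dd eqxx => /eqP.
  by rewrite eq_sym oppr_eq0 oner_eq0.
apply/hasPn => _ /mapP[p _ ->]; apply/mapP => -[q _ /colP/(_ p)].
by rewrite mxE !dd eqxx; case: eqP.
Qed.

Lemma fcosN phi m : fcos A phi (- m) = fcos A phi m.
Proof. by congr mean; apply/funext => x; rewrite cosfN. Qed.

Lemma fsinN phi m : torus_cont A phi -> fsin A phi (- m) = - fsin A phi m.
Proof.
move=> tphi; rewrite /fsin -meanN //; last first.
  by apply: torusM => //; exact: torus_sinf.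
by congr mean; apply/funext => x; rewrite sinfN mulrN.
Qed.

(** On a finite support the Fejer means are finite sums whose weights tend to 1, so [phi] is its own
    Fourier polynomial. The factor 2 joins the equal contributions of [m] and [- m]. *)
Lemma axis_support_expansion phi x : torus_cont A phi ->
  (forall m, m \notin axis_freqs -> fpow A phi m = 0) ->
  phi x = fcos A phi 0 + \sum_p
    (cosf A (delta_mx p 0) x * (2 * fcos A phi (delta_mx p 0)) +
     sinf A (delta_mx p 0) x * (2 * fsin A phi (delta_mx p 0))).
Proof.
move=> tphi supp.
pose T m := fcos A phi m * cosf A m x + fsin A phi m * sinf A m x.
have T0 m : m \notin axis_freqs -> T m = 0.
  move=> /supp /eqP; rewrite paddr_eq0 ?sqr_ge0 // !sqrf_eq0 => /andP[/eqP a /eqP b].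
  by rewrite /T a b !mul0r addr0.
have h1 : favg K T @[K --> \oo] --> phi x.
  have := conv_cvg Au (x := x) tphi.
  by under eq_fun do rewrite conv_favg //.
have h2 : favg K T @[K --> \oo] --> \sum_(m <- axis_freqs) T m.
  under eq_fun => K do rewrite (favg_supp K axis_freqs_uniq T0).
  apply: cvgr_sum => m.
  by have /(_ _) := cvgM (cvg_cst (T m)) (favg_eq_cvg m); rewrite mulr1; apply.
have -> : phi x = \sum_(m <- axis_freqs) T m.
  by rewrite -(cvg_lim _ h1) // (cvg_lim _ h2).
rewrite /axis_freqs big_cons big_cat !big_map /= -big_split /=; congr (_ + _).
  by rewrite /T cosf0 // sinf0 // mulr1 mulr0 addr0.
apply: eq_bigr => p _.
by rewrite /T fcosN fsinN // cosfN sinfN; ring.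
Qed.

End Support.

Section EqualityForward.
Context {R : realType} {n N : nat} (A : 'M[R]_n) (f : torus A -> 'cV[R]_N).
Hypothesis n25 : (2 <= n <= 5)%N.
Hypothesis Au : A \in unitmx.
Hypothesis redA : reduced_upper A.
Hypothesis sF : smooth (periodic_lift f).
Hypothesis iso : forall x, induced_metric (periodic_lift f) x = 1%:M.
Hypothesis gapP : forall k m,
  dual_gap A (freq A m) = 0 \/ fpow A (coordf f k) m = 0.

Let sk := coordf_smooth sF.

Lemma support_freq k m : fpow A (coordf f k) m != 0 ->
  freq A m = 0 \/ exists p : 'I_n,
    freq A m p 0 ^+ 2 = (A p p ^+ 2)^-1 /\ forall j, j != p -> freq A m j 0 = 0.
Proof.
have n5 : (n <= 5)%N by case/andP: n25.
have [_ h] := dual_gap_ge0 redA (freqP Au m) n5.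
by have [/h //|->] := gapP k m; rewrite eqxx.
Qed.

(* Otherwise [pd p F] has no Fourier coefficient at all. *)
Lemma axis_freq_exists p : exists m,
  freq A m p 0 ^+ 2 = (A p p ^+ 2)^-1 /\ forall j, j != p -> freq A m j 0 = 0.
Proof.
apply: contrapT => none.
have z k m : fpow A (pd p (coordf f k)) m = 0.
  rewrite fpow_pd //.
  have [->|nz] := eqVneq (fpow A (coordf f k) m) 0; first by rewrite mulr0.
  have [->|[q [qq qz]]] := support_freq nz; first by rewrite mxE expr0n !mulr0 mul0r.
  have [pq|pq] := eqVneq p q; last by rewrite qz // expr0n !mulr0 mul0r.
  by exfalso; apply: none; exists m; rewrite pq.
have m0 k : mean A (fun x => pd p (coordf f k) x ^+ 2) = 0.
  have := parseval Au (torus_smooth_cont (torus_smooth_pd p (sk k))).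
  have -> : (fun K => favg K (fpow A (pd p (coordf f k)))) = cst (0 : R).
    apply/funext => K; rewrite /favg big1 ?mulr0 // => j _.
    by rewrite big1.
  by move=> /cvg_lim <- //; rewrite lim_cst.
have := mean_pd_sqn Au sF iso p; rewrite big1 => [/esym/eqP|k _]; last exact: m0.
by rewrite oner_eq0.
Qed.

(** Pairing the dual vector [e_p / a_pp], up to sign, with column [j] gives an integer equal to
    [a_pj / a_pp] up to sign; size reduction bounds it by 1/2, so it is 0. *)
Lemma equality_diag : is_diag_mx A.
Proof.
have [U D B _] := redA.
apply/is_diag_mxP => p j; rewrite neq_ltn => /orP[pj|jp]; last exact: U.
have [m [mp mz]] := axis_freq_exists p.
have mj : A p j * freq A m p 0 = (m j 0)%:~R.
  have := dual_entry redA (freqP Au m) j; rewrite (bigD1 p) ?(ltnW pj) //=.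
  by rewrite big1 ?addr0 // => k /andP[_ kp]; rewrite mz // mulr0.
have Dp := D p.
have ab : `|A p j * freq A m p 0| <= 1/2.
  rewrite normrM.
  have -> : `|freq A m p 0| = (A p p)^-1.
    apply/eqP; rewrite -(@eqrXn2 _ 2) ?invr_ge0 ?(ltW Dp) //.
    by rewrite real_normK ?num_real // mp exprVn.
  rewrite ler_pdivrMr //; have := B p j pj; lra.
have m0 : m j 0 = 0.
  apply/eqP; rewrite -absz_eq0 -leqn0 -ltnS -(ltr_nat R).
  rewrite -[ltLHS]/((`|m j 0%R|%N : int)%:~R) abszE intr_norm -mj.
  by apply: le_lt_trans ab _; lra.
move/eqP: mj; rewrite m0 mulf_eq0 => /orP[/eqP //|/eqP f0].
by move: mp; rewrite f0 expr0n /= => /esym/eqP; rewrite invr_eq0 expf_eq0 /= gt_eqF.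
Qed.

Lemma support_axis k m : m \notin axis_freqs -> fpow A (coordf f k) m = 0.
Proof.
have dA := equality_diag; have [_ D _ _] := redA.
move=> mL; apply/eqP; apply: contraNT mL => /support_freq[/eqP|[p [pp pz]]].
  by rewrite freq_eq0 // => /eqP ->; rewrite inE eqxx.
have mz j : j != p -> m j 0 = 0.
  by move=> jp; apply/eqP; rewrite -(intr_eq0 R) -(freq_entry Au dA) pz // mulr0.
have : (m p 0)%:~R ^+ 2 == 1 :> R.
  by rewrite -(freq_entry Au dA) exprMn pp divff // expf_neq0 // gt_eqF.
rewrite sqrf_eq1 -[X in _ == X]/((1%:Z)%:~R) -[- (1 : R)]/(- (1%:Z)%:~R) -rmorphN /=.
rewrite !eqr_int inE mem_cat => /orP[] /eqP m1; apply/orP; right; apply/orP; [left|right].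
  apply/mapP; exists p; rewrite ?mem_index_enum //; apply/colP => j; rewrite mxE andbT.
  by have [->|jp] := eqVneq j p; rewrite ?m1 ?mz.
apply/mapP; exists p; rewrite ?mem_index_enum //; apply/colP => j; rewrite !mxE andbT.
by have [->|jp] := eqVneq j p; rewrite ?m1 ?mz ?oppr0.
Qed.

Lemma equality_trig_form : exists (c : 'cV[R]_N) (u v : 'I_n -> 'cV[R]_N),
  forall x, periodic_lift f x =
    c + \sum_p (cosf A (delta_mx p 0) x *: u p + sinf A (delta_mx p 0) x *: v p).
Proof.
exists (\col_k fcos A (coordf f k) 0),
  (fun p => \col_k (2 * fcos A (coordf f k) (delta_mx p 0))),
  (fun p => \col_k (2 * fsin A (coordf f k) (delta_mx p 0))) => x.
apply/colP => k; rewrite mxE summxE mxE.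
rewrite -[LHS]/(coordf f k x).
rewrite (axis_support_expansion Au x (torus_smooth_cont (sk k)) (support_axis k)).
by congr (_ + _); apply: eq_bigr => p _; rewrite !mxE.
Qed.

End EqualityForward.

(** * Immersions by trigonometric polynomials of degree one *)

Lemma dot_sumr (R : realType) (m : nat) (I : Type) (r : seq I) (w : 'cV[R]_m)
    (h : I -> 'cV[R]_m) : dot w (\sum_(i <- r) h i) = \sum_(i <- r) dot w (h i).
Proof.
elim: r => [|i r IH]; first by rewrite !big_nil /dot big1 // => i _; rewrite mxE mulr0.
by rewrite !big_cons dotDr IH.
Qed.

Lemma dot_suml (R : realType) (m : nat) (I : Type) (r : seq I) (w : 'cV[R]_m)
    (h : I -> 'cV[R]_m) : dot (\sum_(i <- r) h i) w = \sum_(i <- r) dot (h i) w.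
Proof. by rewrite dotC dot_sumr; apply: eq_bigr => i _; rewrite dotC. Qed.

Section TrigForm.
Context {R : realType} {n N : nat} (A : 'M[R]_n) (f : torus A -> 'cV[R]_N).
Hypothesis Au : A \in unitmx.
Hypothesis dA : is_diag_mx A.
Hypothesis sF : smooth (periodic_lift f).
Hypothesis iso : forall x, induced_metric (periodic_lift f) x = 1%:M.
Variables (c : 'cV[R]_N) (u v : 'I_n -> 'cV[R]_N).
Hypothesis trigF : forall x, periodic_lift f x =
  c + \sum_p (cosf A (delta_mx p 0) x *: u p + sinf A (delta_mx p 0) x *: v p).

Let w p : R := 2 * pi / A p p.

Lemma is_derive_trig_sum (a b : 'I_n -> R) (a0 : R) q x :
  is_derive x (delta_mx q 0)
    (fun x => a0 + \sum_p (cosf A (delta_mx p 0) x * a p + sinf A (delta_mx p 0) x * b p))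
    (w q * (cosf A (delta_mx q 0) x * b q - sinf A (delta_mx q 0) x * a q)).
Proof.
pose h p x := cosf A (delta_mx p 0) x * a p + sinf A (delta_mx p 0) x * b p.
have D p : is_derive x (delta_mx q 0) (h p)
   ((p == q)%:R * (w q * (cosf A (delta_mx q 0) x * b q - sinf A (delta_mx q 0) x * a q))).
  have fq : 2 * pi * dot (freq A (delta_mx p 0)) (delta_mx q 0) = (p == q)%:R * w q.
    rewrite dot_delta freq_delta // !mxE andbT eq_sym /w.
    by have [->|] := eqVneq q p; rewrite ?mulr0 ?mul0r // mulr1 mul1r.
  have d1 := is_derive_cosf A (delta_mx p 0) x (delta_mx q 0).
  have d2 := is_derive_sinf A (delta_mx p 0) x (delta_mx q 0).
  rewrite fq in d1 d2.
  have e1 := is_deriveZ (a p) d1; have e2 := is_deriveZ (b p) d2.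
  have hE : h p = (a p \*: cosf A (delta_mx p 0)) + (b p \*: sinf A (delta_mx p 0)).
    by apply/funext => y; rewrite /h mulrC [X in _ + X]mulrC.
  rewrite hE; apply: is_derive_eq (is_deriveD e1 e2) _.
  rewrite /GRing.scale /=; have [->|_] := eqVneq p q; rewrite ?mul1r ?mul0r; last ring.
  ring.
have dS := is_deriveD (is_derive_cst a0 x (delta_mx q 0)) (is_derive_sum D).
have E : (cst a0 + \sum_p h p) = (fun x => a0 + \sum_p h p x).
  by rewrite fct_sumE.
rewrite E in dS; apply: is_derive_eq dS _.
rewrite add0r (bigD1 q) //= eqxx mul1r big1 ?addr0 // => p pq.
by rewrite (negbTE pq) mul0r.
Qed.

Lemma coordf_trig k : coordf f k = fun x => c k 0 +
  \sum_p (cosf A (delta_mx p 0) x * u p k 0 + sinf A (delta_mx p 0) x * v p k 0).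
Proof.
apply/funext => x; rewrite /coordf trigF mxE summxE; congr (_ + _).
by apply: eq_bigr => p _; rewrite !mxE.
Qed.

Lemma pd_trig k q x : pd q (coordf f k) x =
  w q * (cosf A (delta_mx q 0) x * v q k 0 - sinf A (delta_mx q 0) x * u q k 0).
Proof. by rewrite coordf_trig; apply: pd_val; exact: is_derive_trig_sum. Qed.

Lemma pd2_trig k q x : pd q (pd q (coordf f k)) x =
  - w q ^+ 2 * (cosf A (delta_mx q 0) x * u q k 0 + sinf A (delta_mx q 0) x * v q k 0).
Proof.
(* The first derivative is again a sum of the same shape, with coefficients at [q] only, so
   [is_derive_trig_sum] applies once more. *)
pose a p : R := if p == q then w q * v q k 0 else 0.
pose b p : R := if p == q then - (w q * u q k 0) else 0.
have -> : pd q (coordf f k) = fun x => 0 +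
    \sum_p (cosf A (delta_mx p 0) x * a p + sinf A (delta_mx p 0) x * b p).
  apply/funext => y; rewrite pd_trig add0r (bigD1 q) //= /a /b eqxx.
  rewrite big1 ?addr0 => [|p pq]; first by ring.
  by rewrite (negbTE pq) !mulr0 addr0.
rewrite (pd_val (is_derive_trig_sum a b 0 q x)) /a /b eqxx; ring.
Qed.

Lemma angle_point (tau : 'I_n -> R) : exists x, forall p,
  cosf A (delta_mx p 0) x = cos (tau p) /\ sinf A (delta_mx p 0) x = sin (tau p).
Proof.
exists (\col_p (A p p * tau p / (2 * pi))) => p.
have e : 2 * pi * (\col_p (A p p * tau p / (2 * pi))) p 0 / A p p = tau p.
  rewrite mxE; have := diag_neq0 Au dA p; have := lt0r_neq0 (pi_gt0 R).
  by move: (pi : R) (A p p) => P a P0 a0; field; rewrite a0.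
by rewrite cosf_delta // sinf_delta // e.
Qed.

(** For diagonal [A] the phases can be prescribed independently, so the isometry condition holds for
    every choice of angles. *)
Lemma trig_metric (tau : 'I_n -> R) p q :
  dot (cos (tau p) *: v p - sin (tau p) *: u p) (cos (tau q) *: v q - sin (tau q) *: u q)
  = (p == q)%:R * (w p ^+ 2)^-1.
Proof.
have wn i : w i != 0.
  by rewrite mulf_neq0 ?invr_eq0 ?(diag_neq0 Au dA) // mulf_neq0 // gt_eqF // pi_gt0.
have [x xP] := angle_point tau.
have [[cp sp] [cq sq]] := (xP p, xP q).
have m := metric_coordf sF iso p q x.
have : w p * w q * dot (cos (tau p) *: v p - sin (tau p) *: u p)
    (cos (tau q) *: v q - sin (tau q) *: u q) = (p == q)%:R.
  rewrite -m /dot mulr_sumr; apply: eq_bigr => k _.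
  by rewrite !pd_trig cp sp cq sq !mxE; ring.
have [->|pq] := eqVneq p q.
  move=> <-; have := wn q; move: (w q) => W W0; field; exact: W0.
rewrite mulr0n => /eqP; rewrite mulf_eq0 (negbTE (mulf_neq0 (wn p) (wn q))) /= => /eqP ->.
by rewrite mul0r.
Qed.

Lemma trig_orthogonal p q :
  [/\ dot (u p) (u q) = (p == q)%:R * (w p ^+ 2)^-1,
      dot (v p) (v q) = (p == q)%:R * (w p ^+ 2)^-1 &
      dot (u p) (v q) = 0].
Proof.
have uu : dot (u p) (u q) = (p == q)%:R * (w p ^+ 2)^-1.
  have := trig_metric (fun=> pi / 2) p q.
  by rewrite cos_pihalf sin_pihalf !scale0r !scale1r !sub0r dotNl dotNr opprK.
have vv : dot (v p) (v q) = (p == q)%:R * (w p ^+ 2)^-1.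
  have := trig_metric (fun=> 0) p q.
  by rewrite cos0 sin0 !scale0r !scale1r !subr0.
split=> //; have [pq|pq] := eqVneq p q.
  (* Any angle with nonzero sine and cosine isolates the cross term; 1 radian is one. *)
  have := trig_metric (fun=> 1) p q.
  rewrite -pq eqxx mul1r in uu vv *.
  rewrite !(dotDl, dotDr, dotNl, dotNr, dotZl, dotZr) uu vv [dot (v p) (u p)]dotC => h.
  have c1 := @cos1_gt0 R.
  have s1 : 0 < sin 1 :> R by apply: sin2_gt0; rewrite ltr01 ltr1n.
  have cs := cos2Dsin2 (1 : R).
  have h2 : cos 1 * sin 1 * dot (u p) (v p) = 0.
    move: h; set d := dot _ _; set W := (w p ^+ 2)^-1 => h.
    have : (cos 1 ^+ 2 + sin 1 ^+ 2 - 1) * W = 2 * (cos 1 * sin 1 * d) by lra.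
    by rewrite cs subrr mul0r => h3; lra.
  by move/eqP: h2; rewrite !mulf_eq0 (gt_eqF c1) (gt_eqF s1) /= => /eqP.
have := trig_metric (fun r => if r == p then pi / 2 else 0) p q.
rewrite eqxx eq_sym (negbTE pq) cos_pihalf sin_pihalf cos0 sin0.
by rewrite !scale0r !scale1r sub0r subr0 dotNl mul0r => /eqP; rewrite oppr_eq0 => /eqP.
Qed.

(** The Laplacian is a sum of mutually orthogonal vectors, one for each [p], of squared length
    [w_p^4 / w_p^2 = w_p^2], because [u p] and [v p] are orthogonal of length [1 / w_p]. *)
Lemma trig_lap_sqn x : lap_sqn f x = mu_bound A.
Proof.
pose L p := - w p ^+ 2 *: (cosf A (delta_mx p 0) x *: u p + sinf A (delta_mx p 0) x *: v p).
have -> : lap_sqn f x = dot (\sum_p L p) (\sum_p L p).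
  rewrite /lap_sqn /dot; apply: eq_bigr => k _; rewrite -expr2; congr (_ ^+ 2).
  rewrite /lap summxE; apply: eq_bigr => p _.
  by rewrite pd2_trig !mxE.
rewrite dot_suml /mu_bound mulr_sumr; apply: eq_bigr => p _.
rewrite dot_sumr (bigD1 p) //= big1 ?addr0 => [|q qp].
  have [uu vv uv] := trig_orthogonal p p; rewrite eqxx mul1r in uu vv.
  rewrite /L !(dotDl, dotDr, dotZl, dotZr) uu vv [dot (v p) (u p)]dotC uv.
  have wn : w p != 0.
    by rewrite mulf_neq0 ?invr_eq0 ?(diag_neq0 Au dA) // mulf_neq0 // gt_eqF // pi_gt0.
  have cs : cosf A (delta_mx p 0) x ^+ 2 + sinf A (delta_mx p 0) x ^+ 2 = 1.
    exact: cos2Dsin2.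
  transitivity (w p ^+ 2 *
    (cosf A (delta_mx p 0) x ^+ 2 + sinf A (delta_mx p 0) x ^+ 2)); first by field.
  rewrite cs mulr1 /w; have := diag_neq0 Au dA p.
  by move: (pi : R) (A p p) => P a a0; field.
have [uu vv uv] := trig_orthogonal p q; have [_ _ vu] := trig_orthogonal q p.
rewrite eq_sym (negbTE qp) !mul0r in uu vv.
rewrite /L !(dotDl, dotDr, dotZl, dotZr) uu vv uv [dot (v p) (u q)]dotC vu; ring.
Qed.

Lemma trig_willmore : (2 <= n)%N ->
  willmore f = `|\det A| * mu_bound A `^ (n%:R / 2).
Proof.
move=> n2; rewrite (willmoreE Au sF iso n2); congr (_ * _).
rewrite -[RHS](mean_cst A); congr mean; apply/funext => x.
by rewrite trig_lap_sqn.
Qed.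

End TrigForm.

(** * Isometries and congruence *)

Section Isometries.
Context {R : realType}.

(** Once translated to fix 0, the map preserves inner products by polarization. The squared distance
    from the image of [y] to the combination of the images of the basis vectors is then computable,
    and is 0. *)
Lemma isometry_affine (N : nat) (Phi : 'cV[R]_N -> 'cV[R]_N) :
  (forall u v, enorm (Phi u - Phi v) = enorm (u - v)) ->
  forall y, Phi y = Phi 0 + \sum_i y i 0 *: (Phi (delta_mx i 0) - Phi 0).
Proof.
move=> iso y; pose Psi u := Phi u - Phi 0.
have dotB (a b : 'cV[R]_N) : dot (a - b) (a - b) = dot a a + dot b b - 2 * dot a b.
  by rewrite !(dotDl, dotDr, dotNl, dotNr) [dot b a]dotC; ring.
have sq u v : dot (Psi u - Psi v) (Psi u - Psi v) = dot (u - v) (u - v).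
  rewrite -!enorm_sqr -(iso u v); congr (enorm _ ^+ 2).
  by rewrite /Psi opprB addrA subrK.
have P0 : Psi 0 = 0 by rewrite /Psi subrr.
have nrm u : dot (Psi u) (Psi u) = dot u u by have := sq u 0; rewrite P0 !subr0.
have prod u v : dot (Psi u) (Psi v) = dot u v.
  by have := sq u v; rewrite (dotB (Psi u)) (dotB u) !nrm => h; lra.
have gram (E : 'I_N -> 'cV[R]_N) (z : 'cV[R]_N) :
    (forall i, dot z (E i) = y i 0) -> (forall i j, dot (E i) (E j) = (i == j)%:R) ->
    dot z z = dot y y -> z = \sum_i y i 0 *: E i.
  move=> zE EE zz; apply/eqP; rewrite -subr_eq0 -dot_eq0 dotB zz.
  have zS : dot z (\sum_i y i 0 *: E i) = dot y y.
    by rewrite dot_sumr; apply: eq_bigr => i _; rewrite dotZr zE.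
  have SS : dot (\sum_i y i 0 *: E i) (\sum_i y i 0 *: E i) = dot y y.
    rewrite dot_suml; apply: eq_bigr => i _; rewrite dotZl dot_sumr.
    rewrite (bigD1 i) //= dotZr EE eqxx mulr1 big1 ?addr0 // => j ji.
    by rewrite dotZr EE eq_sym (negbTE ji) mulr0.
  by rewrite zS SS; apply/eqP; ring.
rewrite -[LHS](subrK (Phi 0)) addrC; congr (_ + _); apply: gram => [i|i j|].
- by rewrite prod dot_delta.
- by rewrite prod dot_delta mxE andbT eq_sym.
- exact: nrm.
Qed.

(** Induction on the number [d] of missing rows: by rank there is a nonzero row orthogonal to those
    of [U], and it is normalized and appended. *)
Lemma orthonormal_completion (N d m : nat) (U : 'M[R]_(m, N)) (le_mN : (m <= N)%N) :
  N = (m + d)%N -> U *m U^T = 1%:M ->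
  exists W : 'M[R]_N, W *m W^T = 1%:M /\
    forall j : 'I_m, row (widen_ord le_mN j) W = row j U.
Proof.
elim: d m U le_mN => [|d IH] m U le_mN NE UU.
  rewrite addn0 in NE; move: U le_mN UU; rewrite -NE => U le UU.
  exists U; split=> // j; congr row; exact/val_inj.
have mN : (m + 1 <= N)%N by rewrite NE; lia.
have kn0 : kermx U^T != 0.
  rewrite -mxrank_eq0 mxrank_ker -lt0n subn_gt0.
  by rewrite (leq_ltn_trans (rank_leq_col _)) // -(addn1 m).
pose x := nz_row (kermx U^T).
have x0 : x != 0 by rewrite nz_row_eq0.
have xU : x *m U^T = 0 by apply/sub_kermxP; exact: nz_row_sub.
have dx : dot x^T x^T != 0 by rewrite dot_eq0 trmx_eq0.
have xx (r : 'rV[R]_N) : r *m r^T = (dot r^T r^T)%:M.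
  rewrite [LHS]mx11_scalar mxE; congr (_%:M).
  by apply: eq_bigr => i _; rewrite !mxE.
pose v := (Num.sqrt (dot x^T x^T))^-1 *: x.
have vU : v *m U^T = 0 by rewrite -scalemxAl xU scaler0.
have vv : v *m v^T = 1%:M.
  rewrite xx /v linearZ /= dotZl dotZr mulrA -expr2 exprVn sqr_sqrtr ?dot_ge0 //.
  by rewrite mulVf.
have UV : col_mx U v *m (col_mx U v)^T = 1%:M.
  rewrite tr_col_mx mul_col_row UU vU vv.
  have -> : U *m v^T = 0 by rewrite -[U]trmxK -trmx_mul vU trmx0.
  by rewrite -scalar_mx_block.
have NE' : N = (m + 1 + d)%N by rewrite NE; lia.
have [W [WW WU]] := IH _ (col_mx U v) mN NE' UV.
exists W; split=> // j; rewrite -[row j U](_ : row (lshift 1 j) (col_mx U v) = _).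
  by rewrite -WU; congr row; exact/val_inj.
by apply/rowP => k; rewrite !mxE (unsplitK (inl j)).
Qed.

End Isometries.

(** * The flat embedding as a trigonometric polynomial *)

Section FlatEmbedding.
Context {R : realType}.

Lemma sum_pad (m N : nat) (le_mN : (m <= N)%N) (g : 'cV[R]_m) (W : 'I_N -> 'cV[R]_N) :
  \sum_i pad N g i 0 *: W i = \sum_j g j 0 *: W (widen_ord le_mN j).
Proof.
rewrite (bigID (fun i : 'I_N => (i < m)%N)) /= [X in _ + X]big1 ?addr0 => [|i im].
  rewrite (big_ord_narrow le_mN) /=; apply: eq_bigr => j _; rewrite mxE.
  by rewrite (valK j).
by rewrite mxE insubN // scale0r.
Qed.

Lemma sum_mxvec (n N : nat) (h : 'I_(n * 2) -> 'cV[R]_N) :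
  \sum_j h j = \sum_p (h (mxvec_index p 0) + h (mxvec_index p 1)).
Proof.
rewrite (reindex _ (curry_mxvec_bij _ _)) /=.
transitivity (\sum_(q : 'I_n * 'I_2) h (mxvec_index q.1 q.2)).
  by apply: eq_bigr => -[].
rewrite -(pair_bigA _ (fun p b => h (mxvec_index p b))) /=.
apply: eq_bigr => p _; rewrite !big_ord_recl big_ord0 addr0.
by congr (_ + h (mxvec_index _ _)); exact/val_inj.
Qed.

(** A linear image of the flat embedding, with [W] the images of the basis vectors, is in the
    trigonometric form of degree one. Both directions of the congruence statement use it. *)
Lemma pad_flat_embedding (n N : nat) (A : 'M[R]_n) (le : (n * 2 <= N)%N)
    (W : 'I_N -> 'cV[R]_N) x : A \in unitmx -> is_diag_mx A ->
  \sum_i pad N (flat_embedding A x) i 0 *: W i =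
  \sum_p (cosf A (delta_mx p 0) x *:
            ((2 * pi)^-1 * A p p *: W (widen_ord le (mxvec_index p 0))) +
          sinf A (delta_mx p 0) x *:
            ((2 * pi)^-1 * A p p *: W (widen_ord le (mxvec_index p 1)))).
Proof.
move=> Au dA; rewrite (sum_pad le) sum_mxvec; apply: eq_bigr => p _.
rewrite cosf_delta // sinf_delta // !scalerA.
by congr (_ *: _ + _ *: _); rewrite /flat_embedding 2!mxE mxvecE mxE /=; ring.
Qed.

End FlatEmbedding.

Lemma mxvec_index_eq (m k : nat) (i i' : 'I_m) (j j' : 'I_k) :
  (mxvec_index i j == mxvec_index i' j') = (i == i') && (j == j').
Proof.
have [g gK _] := curry_mxvec_bij m k.
apply/eqP/andP => [h|[/eqP -> /eqP ->] //].
have : (i, j) = (i', j') by rewrite -[LHS]gK //= h -[RHS]gK.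
by case=> -> ->.
Qed.

(** * Congruence with the model and equality of the energy *)

Section Congruence.
Context {R : realType} {n N : nat} (A : 'M[R]_n) (f : torus A -> 'cV[R]_N).
Hypothesis Au : A \in unitmx.
Hypothesis dA : is_diag_mx A.
Hypothesis sF : smooth (periodic_lift f).
Hypothesis iso : forall x, induced_metric (periodic_lift f) x = 1%:M.

(** An isometry is affine, so the immersion has the trigonometric form, for which [trig_willmore]
    gives the energy. *)
Lemma congruent_willmore : (2 <= n)%N -> congruent (periodic_lift f) (flat_embedding A) ->
  willmore f = `|\det A| * mu_bound A `^ (n%:R / 2).
Proof.
move=> n2 [le [Phi [[_ Phi_iso] FE]]].
pose W i := Phi (delta_mx i 0) - Phi 0.
pose s p := (2 * pi)^-1 * A p p.
apply: (@trig_willmore _ _ _ A f Au dA sF iso (Phi 0)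
  (fun p => s p *: W (widen_ord le (mxvec_index p 0)))
  (fun p => s p *: W (widen_ord le (mxvec_index p 1)))) => // x.
by rewrite FE (isometry_affine Phi_iso) (pad_flat_embedding le).
Qed.

Lemma trig_congruent c (u v : 'I_n -> 'cV[R]_N) :
  (forall x, periodic_lift f x =
    c + \sum_p (cosf A (delta_mx p 0) x *: u p + sinf A (delta_mx p 0) x *: v p)) ->
  congruent (periodic_lift f) (flat_embedding A).
Proof.
move=> trigF.
have orth p q := trig_orthogonal Au dA sF iso trigF p q.
pose w p : R := 2 * pi / A p p.
have wn p : w p != 0.
  by rewrite mulf_neq0 ?invr_eq0 ?(diag_neq0 Au dA) // mulf_neq0 // gt_eqF // pi_gt0.
(* The factor [w p] makes the coefficient vectors orthonormal; they become the images of the first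
   [2 n] basis vectors. *)
pose g p (b : 'I_2) := w p *: (if b == 0 then u p else v p).
pose U : 'M[R]_(n * 2, N) :=
  \matrix_(j, k) (mxvec (\matrix_(p, b) g p b k 0)) 0 j.
have UE p b k : U (mxvec_index p b) k = g p b k 0 by rewrite mxE mxvecE mxE.
have gg p q b b' : dot (g p b) (g q b') = ((p == q) && (b == b'))%:R.
  rewrite /g dotZl dotZr.
  have [uu vv uv] := orth p q; have [_ _ vu] := orth q p.
  have wE : w p * (w q * ((p == q)%:R * (w p ^+ 2)^-1)) = (p == q)%:R.
    have [<-|_] := eqVneq p q; last by rewrite mul0r !mulr0.
    by rewrite mul1r mulrA -expr2 divff // expf_neq0.
  case: b b' => [[|[|[]//]] ?] [[|[|[]//]] ?] /=; rewrite ?andbT ?andbF.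
  - by rewrite uu wE.
  - by rewrite uv !mulr0.
  - by rewrite [dot (v p) _]dotC vu !mulr0.
  - by rewrite vv wE.
have UU : U *m U^T = 1%:M.
  apply/matrixP => i j; case/mxvec_indexP: i => p b; case/mxvec_indexP: j => q b'.
  rewrite mxE [RHS]mxE mxvec_index_eq -gg; apply: eq_bigr => k _.
  by rewrite [U^T _ _]mxE !UE.
(* The existence of [2 n] orthonormal vectors itself bounds the codomain dimension from below. *)
have le : (n * 2 <= N)%N by exact: mulmx1_min UU.
have [W [WW WU]] := orthonormal_completion le (esym (subnKC le)) UU.
have WW' : W^T *m W = 1%:M by exact: mulmx1C.
split=> //; exists (fun y => c + W^T *m y); split; first split.
- exists (fun y => W *m (y - c)) => y.
    by rewrite addrC addKr mulmxA WW mul1mx.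
  by rewrite mulmxA WW' mul1mx addrC subrK.
- move=> y z; rewrite opprD addrACA subrr add0r -mulmxBr.
  by rewrite /enorm dot_mulmx mulmxA WW mul1mx.
move=> x; rewrite trigF; congr (_ + _).
pose Wc i : 'cV[R]_N := (row i W)^T.
have -> : W^T *m pad N (flat_embedding A x) =
    \sum_i pad N (flat_embedding A x) i 0 *: Wc i.
  apply/colP => k; rewrite mxE summxE; apply: eq_bigr => i _.
  by rewrite !mxE mulrC.
rewrite (pad_flat_embedding le _ _ Au dA); apply: eq_bigr => p _.
have WcE b : Wc (widen_ord le (mxvec_index p b)) = g p b.
  by rewrite /Wc WU; apply/colP => k; rewrite mxE mxE UE.
have ws z : (2 * pi)^-1 * A p p *: (w p *: z) = z :> 'cV[R]_N.
  rewrite scalerA /w; have := diag_neq0 Au dA p; have := lt0r_neq0 (pi_gt0 R).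
  move: (pi : R) (A p p) => P a P0 a0.
  have -> : (2 * P)^-1 * a * (2 * P / a) = 1 by field; rewrite a0.
  by rewrite scale1r.
by rewrite !WcE /g /= !ws.
Qed.

End Congruence.

Unset Implicit Arguments.

Theorem theorem4p4 (R : realType) (n N : nat) (A : 'M[R]_n)
    (f : torus A -> 'cV[R]_N)
    (hn : (2 <= n <= 5)%N)
    (hKZ : korkine_zolotarev A)
    (hA : kz_normalized A)
    (hf : isometric_immersion f) :
  let bound := (2 * pi) ^+ n * (\prod_(i < n) A i i) *
               (\sum_(i < n) (A i i ^+ 2)^-1) `^ (n%:R / 2) in
  bound <= willmore f /\
  (willmore f = bound <->
     is_diag_mx A /\ congruent (periodic_lift f) (flat_embedding A)).
Proof.
move=> bound; have redA := kz_reduced_upper hKZ hA.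
have Au : A \in unitmx by case: hKZ.
case: hf => -[sF _] iso.
rewrite /bound (boundE redA); split; first exact: willmore_ge.
split=> [weq|[dA congF]].
  have gapP := willmore_eq_gap hn Au redA sF iso weq.
  have dA := equality_diag hn Au redA sF iso gapP; split=> //.
  have [c [u [v trigF]]] := equality_trig_form hn Au redA sF iso gapP.
  exact: (trig_congruent Au dA sF iso trigF).
by apply: congruent_willmore => //; case/andP: hn.
Qed.
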